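(* Let $d\ge 1$ and let $\theta:\mathbb R^d\to[0,\infty)$ be a radially decreasing measurable function with $\lim_{\|\xi\|\to\infty}\theta(\xi)=0$. Put $$I=\int_{\|\xi\|\ge 1}\frac{\theta(\xi)}{\|\xi\|^{d}}\,d\xi .$$ (a) Let $f\in L^p(\mathbb R^d)$ for some $p\in[1,2]$, and suppose that either $$\int_{\mathbb R^d}\frac{|\widehat f(\xi)|^q\,e^{q\theta(\xi)\|\xi\|}}{(1+\|\xi\|)^N}\,d\xi<\infty$$ for some $q\in[1,\infty)$ and some $N\ge 0$, or $$|\widehat f(\xi)|\le C\,|P(\xi)|\,e^{-\theta(\xi)\|\xi\|}\quad\text{for almost every }\xi\in\mathbb R^d,$$ where $C>0$ is a constant and $P$ is a polynomial. If $f$ vanishes (almost everywhere) on a nonempty open subset of $\mathbb R^d$ and $I=\infty$, then $f=0$ almost everywhere on $\mathbb R^d$. (b) If $I<\infty$, then for $q\in[1,\infty)$ and $N\ge 0$ there exists a nonzero $f\in C_c^\infty(\mathbb R^d)$ satisfying $\int_{\mathbb R^d}\frac{|\widehat f(\xi)|^q e^{q\theta(\xi)\|\xi\|}}{(1+\|\xi\|)^N}\,d\xi<\infty$, and (in the case $q=\infty$) there exists a nonzero $f\in C_c^\infty(\mathbb R^d)$ satisfying $|\widehat f(\xi)|\le C|P(\xi)|e^{-\theta(\xi)\|\xi\|}$ for almost every $\xi$, for some constant $C$ and polynomial $P$.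
   Context: The Fourier transform of $f\in L^1(\mathbb R^d)$ is $\widehat f(\xi)=\int_{\mathbb R^d}f(x)e^{-2\pi i x\cdot\xi}\,dx$, extended to $L^p(\mathbb R^d)$, $1<p\le 2$, in the usual way. A function $\theta$ on $\mathbb R^d$ is radially decreasing if it is radial and $\theta(x)\le\theta(y)$ whenever $\|x\|\ge\|y\|$; $\|\cdot\|$ is the Euclidean norm. *)

(* Defs.v *)
From HB Require Import structures.
From mathcomp Require Import all_boot all_order all_algebra.
From mathcomp Require Import all_classical all_reals all_analysis.
From mathcomp Require mpoly.

Set Implicit Arguments.
Unset Strict Implicit.
Unset Printing Implicit Defensive.

Import Order.TTheory GRing.Theory Num.Theory.
Import numFieldNormedType.Exports.
Local Open Scope classical_set_scope.
Local Open Scope ring_scope.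

Section Defs.
Context (R : realType) (d : nat).

Definition Rd : Type := g_sigma_algebraType (@open 'rV[R]_d).

Definition dotv (x y : 'rV[R]_d) : R := \sum_(i < d) x 0 i * y 0 i.
Definition enorm (x : 'rV[R]_d) : R := Num.sqrt (dotv x x).

(* lam is Lebesgue measure on R^d: it gives every closed box its volume.
   (This characterizes Lebesgue measure on the Borel sets.) *)
Definition is_lebesgue (lam : {measure set Rd -> \bar R}) : Prop :=
  forall a b : 'rV[R]_d, (forall i, a 0 i <= b 0 i) ->
    lam [set x : 'rV[R]_d | forall i, a 0 i <= x 0 i <= b 0 i]
    = (\prod_(i < d) (b 0 i - a 0 i))%:E.

(* Complex numbers are represented as pairs (real part, imaginary part). *)
Definition cabs (z : R * R) : R := Num.sqrt (z.1 ^+ 2 + z.2 ^+ 2).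
Definition csub (z w : R * R) : R * R := (z.1 - w.1, z.2 - w.2).

Definition cmeasurable (f : 'rV[R]_d -> R * R) : Prop :=
  measurable_fun (setT : set Rd) (fun x => (f x).1) /\
  measurable_fun (setT : set Rd) (fun x => (f x).2).

Definition inLp (lam : {measure set Rd -> \bar R}) (p : R)
  (f : 'rV[R]_d -> R * R) : Prop :=
  cmeasurable f /\ (\int[lam]_x ((cabs (f x)) `^ p)%R%:E < +oo)%E.

Definition Lpdist (lam : {measure set Rd -> \bar R}) (p : R)
  (f g : 'rV[R]_d -> R * R) : \bar R :=
  (\int[lam]_x ((cabs (csub (f x) (g x))) `^ p)%R%:E)%E.

(* Fourier transform of an integrable f :
   \hat f(xi) = \int f(x) e^{-2 pi i x.xi} dx  (real part, imaginary part). *)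
Definition ftL1 (lam : {measure set Rd -> \bar R})
  (f : 'rV[R]_d -> R * R) (xi : 'rV[R]_d) : R * R :=
  (fine (\int[lam]_x ((f x).1 * cos (2 * pi * dotv x xi)
                      + (f x).2 * sin (2 * pi * dotv x xi))%:E)%E,
   fine (\int[lam]_x ((f x).2 * cos (2 * pi * dotv x xi)
                      - (f x).1 * sin (2 * pi * dotv x xi))%:E)%E).

(* g is (a representative of) the Fourier transform of f in L^p,
   1 <= p <= 2: for p = 1 the integral above (a.e.); for 1 < p <= 2
   the usual extension by density from L^1 /\ L^p, i.e. g is the
   L^{p'} limit (p' = p/(p-1)) of \hat f_n for f_n in L^1 /\ L^p
   with f_n -> f in L^p. *)
Definition is_fourier (lam : {measure set Rd -> \bar R}) (p : R)
  (f g : 'rV[R]_d -> R * R) : Prop :=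
  (p = 1 /\ {ae lam, forall xi, g xi = ftL1 lam f xi}) \/
  (1 < p <= 2 /\ cmeasurable g /\
   exists fn : nat -> 'rV[R]_d -> R * R,
     (forall n, inLp lam 1 (fn n) /\ inLp lam p (fn n)) /\
     (Lpdist lam p (fn n) f @[n --> \oo] --> 0%E) /\
     (Lpdist lam (p / (p - 1)) (ftL1 lam (fn n)) g @[n --> \oo] --> 0%E)).

Definition radial (theta : 'rV[R]_d -> R) : Prop :=
  forall x y, enorm x = enorm y -> theta x = theta y.
Definition radially_decreasing (theta : 'rV[R]_d -> R) : Prop :=
  radial theta /\ forall x y, enorm y <= enorm x -> theta x <= theta y.

Definition vanishes_at_infinity (theta : 'rV[R]_d -> R) : Prop :=
  forall e, 0 < e -> exists M : R, forall x, M <= enorm x -> `|theta x| <= e.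

Definition Iint (lam : {measure set Rd -> \bar R}) (theta : 'rV[R]_d -> R)
  : \bar R :=
  (\int[lam]_(xi in [set xi : 'rV[R]_d | (1 <= enorm xi)%R])
     (theta xi / enorm xi ^+ d)%R%:E)%E.

Definition growth_int (lam : {measure set Rd -> \bar R})
  (theta : 'rV[R]_d -> R) (q N : R) (g : 'rV[R]_d -> R * R) : Prop :=
  (\int[lam]_xi (((cabs (g xi)) `^ q * expR (q * theta xi * enorm xi)
                  / (1 + enorm xi) `^ N)%R%:E) < +oo)%E.

(* |g(xi)| <= C |P(xi)| e^{-theta(xi) ||xi||} a.e., P = P1 + i P2 a
   (complex) polynomial in d variables. *)
Definition poly_bound (lam : {measure set Rd -> \bar R})
  (theta : 'rV[R]_d -> R) (C : R) (P1 P2 : mpoly.mpoly d R)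
  (g : 'rV[R]_d -> R * R) : Prop :=
  {ae lam, forall xi,
    cabs (g xi) <= C * cabs (mpoly.meval (fun i => xi 0 i) P1,
                             mpoly.meval (fun i => xi 0 i) P2)
                    * expR (- (theta xi * enorm xi))}.

Fixpoint iter_dir (vs : seq 'rV[R]_d) (h : 'rV[R]_d -> R) : 'rV[R]_d -> R :=
  match vs with
  | [::] => h
  | v :: vs' => fun x => 'D_v (iter_dir vs' h) x
  end.

Definition smooth (h : 'rV[R]_d -> R) : Prop :=
  forall (vs : seq 'rV[R]_d) (x : 'rV[R]_d), differentiable (iter_dir vs h) x.

Definition Cc_infty (f : 'rV[R]_d -> R * R) : Prop :=
  smooth (fun x => (f x).1) /\ smooth (fun x => (f x).2) /\
  compact (closure [set x | f x != (0, 0)]).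

End Defs.

(* Main.v *)
(* Write theta(xi) = th(|xi|). The integral I is finite exactly when the series
   with terms th(k)/k converges; comparing it with cubical shells of sides k^4
   shows that I = oo also forces the series of th(k^4)/k to diverge.

   (b) Ingham: the product of the factors sinc(2 pi s b_k)^2 with b_k of the order
   of th(k)/k is the transform of a positive function, supported in an interval
   because the b_k are summable, and decays like exp(- th(s) s). Tensor products
   of this function give the test functions on R^d.

   (a) Mollifying: if phi is a test function with small support whose transform
   Phi decays like exp(- 5 sqrt|xi|), then Parseval's formula shows that the
   transform F of Phi f^ is a convolution of f with phi, so F vanishes near some
   point. The weight exp(theta |xi|) bounds the n-th derivative of F along a line
   by the product of the first n numbers mu_j = c j / th(j^4), the loss being
   absorbed by exp(4 sqrt|xi|). As the series of 1/mu_j diverges, Bang's proof of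
   the Denjoy-Carleman theorem gives F = 0 everywhere. Taking for phi convolutions
   of box indicators with approximate identities, f has integral zero over all
   small boxes, hence f = 0. *)

Require Import Defs.
From HB Require Import structures.
From mathcomp Require Import all_boot all_order all_algebra.
From mathcomp Require Import all_classical all_reals all_analysis.
From mathcomp Require Import measurable_realfun ring lra zify.
From mathcomp Require mpoly.

Set Implicit Arguments.
Unset Strict Implicit.
Unset Printing Implicit Defensive.

Import Order.TTheory GRing.Theory Num.Theory.
Import numFieldNormedType.Exports.
Local Open Scope classical_set_scope.
Local Open Scope ring_scope.

(** * Integration *)

(** The exponent 4 balances two demands. Sampling [th] at [j^4] keeps the series divergent, because
    substituting [r = s^4] in [dr / r] only produces a factor 4. Conversely, only about [r^(1/4)]
    indices satisfy [j^4 < r], and in the estimate of [r^n] their factors multiply to at most a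
    constant times [exp(4 sqrt r)]. A mollifier can pay for this: [1 / sqrt k] divided by [k] is
    summable, so Ingham's construction gives decay [exp(- 5 sqrt s)] on arbitrarily small supports.
    Four of these roots cover the loss, the fifth covers powers of [1 + |xi|]. Both Fourier formulas
    are carried along together, from an explicit triangle function through averages over intervals
    to the infinite product, so that inversion is available for every function constructed. Complex
    exponentials appear as [cos (c + t)] for all phases [c]: translations and derivatives then only
    move the phase. *)

Section Rintegral_tools.
Context d (T : measurableType d) (R : realType).
Variable mu : {measure set T -> \bar R}.
Implicit Types f g : T -> R.

Lemma integrable_ge0_lty f : measurable_fun [set: T] f -> (forall x, 0 <= f x) ->
  (\int[mu]_x (f x)%:E < +oo)%E -> mu.-integrable [set: T] (EFin \o f).
Proof.
move=> mf f0 foo; apply/integrableP; split; first exact/measurable_EFinP.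
by under eq_integral do rewrite /= ger0_norm//.
Qed.

Lemma integrable_le f g : measurable_fun [set: T] f ->
  mu.-integrable [set: T] (EFin \o g) -> (forall x, `|f x| <= g x) ->
  mu.-integrable [set: T] (EFin \o f).
Proof.
move=> mf ig fg; apply: le_integrable ig => //; first exact/measurable_EFinP.
by move=> x _ /=; rewrite lee_fin (le_trans (fg x)) ?ler_norm.
Qed.

Lemma integrable_measurable f :
  mu.-integrable [set: T] (EFin \o f) -> measurable_fun [set: T] f.
Proof. by move=> /integrableP[/measurable_EFinP]. Qed.

Lemma integrable_Zl (r : R) f : mu.-integrable [set: T] (EFin \o f) ->
  mu.-integrable [set: T] (EFin \o (fun x => r * f x)).
Proof. by move=> fi; exact: (integrableZl measurableT r fi). Qed.

Lemma integrable_mulbdd f g (c : R) : mu.-integrable [set: T] (EFin \o f) ->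
  measurable_fun [set: T] g -> (forall x, `|g x| <= c) ->
  mu.-integrable [set: T] (EFin \o (fun x => f x * g x)).
Proof.
move=> fi mg gc; have fm := integrable_measurable fi.
apply: (@integrable_le _ (fun x => c * `|f x|)).
- exact: measurable_funM.
- by apply: integrable_Zl; exact: (integrable_abse fi).
- by move=> x; rewrite normrM mulrC ler_wpM2r.
Qed.

Lemma integrable_sum_seq (I : Type) (s : seq I) (F : I -> T -> R) :
  (forall i, mu.-integrable [set: T] (EFin \o F i)) ->
  mu.-integrable [set: T] (EFin \o (fun x => \sum_(i <- s) F i x)).
Proof.
move=> Fi; rewrite (_ : _ \o _ = fun x => (\sum_(i <- s) (F i x)%:E)%E).
  by apply: integrable_sum => // i _; exact: Fi.
by apply/funext => x /=; rewrite sumEFin.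
Qed.

Lemma Rintegral_sum_seq (I : Type) (s : seq I) (F : I -> T -> R) :
  (forall i, mu.-integrable [set: T] (EFin \o F i)) ->
  \int[mu]_x (\sum_(i <- s) F i x) = \sum_(i <- s) \int[mu]_x F i x.
Proof.
move=> Fi; elim: s => [|i s IH].
  by rewrite big_nil; under eq_Rintegral do rewrite big_nil; rewrite Rintegral_cst// mul0r.
under eq_Rintegral do rewrite big_cons.
by rewrite RintegralD// ?big_cons ?IH//; exact: integrable_sum_seq.
Qed.

Lemma normr_Rintegral_le f g :
  mu.-integrable [set: T] (EFin \o f) -> mu.-integrable [set: T] (EFin \o g) ->
  (forall x, `|f x| <= g x) -> `|\int[mu]_x f x| <= \int[mu]_x g x.
Proof.
move=> fi gi fg; apply: (le_trans (le_normr_Rintegral _ fi)) => //.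
by apply: le_Rintegral => //; exact: (integrable_abse fi).
Qed.

Lemma Rintegral_dominated (f_ : nat -> T -> R) f g :
  (forall n, measurable_fun [set: T] (f_ n)) ->
  (forall x, f_ n x @[n --> \oo] --> f x) ->
  mu.-integrable [set: T] (EFin \o g) ->
  (forall n x, `|f_ n x| <= g x) ->
  mu.-integrable [set: T] (EFin \o f) /\
  (\int[mu]_x f_ n x @[n --> \oo] --> \int[mu]_x f x).
Proof.
move=> mf_ ff ig fg.
have mf : measurable_fun [set: T] f.
  by apply: (measurable_fun_cvg mf_) => x _; exact: ff.
have mfE n : measurable_fun [set: T] (EFin \o f_ n) by exact/measurable_EFinP.
have mE : measurable_fun [set: T] (EFin \o f) by exact/measurable_EFinP.
have cE : {ae mu, forall x, [set: T] x -> (EFin \o f_ ^~ x) n @[n --> \oo] --> (EFin \o f) x}.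
  by apply: aeW => x _; apply: cvg_EFin; [exact: nearW|exact: ff].
have dE : {ae mu, forall x n, [set: T] x -> (`|(EFin \o f_ n) x| <= (EFin \o g) x)%E}.
  by apply: aeW => x n _; rewrite /= lee_fin.
have [fi _ fc] := dominated_convergence measurableT mfE mE cE ig dE.
split=> //; rewrite /Rintegral; apply: fine_cvg.
by rewrite fineK//; exact: integrable_fin_num.
Qed.

End Rintegral_tools.

(* A synonym of [m] indexed by a proof of sigma-finiteness, so that the bundled
   structure required by the Fubini theorems can be inferred. *)
Definition sfin_measure d (T : measurableType d) (R : realType)
  (m : {measure set T -> \bar R}) (s : sigma_finite [set: T] m) : set T -> \bar R := m.

Section sfin_measure_instance.
Context d (T : measurableType d) (R : realType).
Variables (m : {measure set T -> \bar R}) (s : sigma_finite [set: T] m).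
HB.instance Definition _ := Measure.on (sfin_measure s).
HB.instance Definition _ :=
  Measure_isSigmaFinite.Build _ _ _ (sfin_measure s) s.
End sfin_measure_instance.

(** * Fubini under domination by a product *)

Section Rintegral_fubini.
Context d1 d2 (T1 : measurableType d1) (T2 : measurableType d2) (R : realType).
Variables (m1 : {measure set T1 -> \bar R}) (m2 : {measure set T2 -> \bar R}).
Hypotheses (s1 : sigma_finite [set: T1] m1) (s2 : sigma_finite [set: T2] m2).
Variables (f : T1 * T2 -> R) (A : T1 -> R) (B : T2 -> R).
Hypothesis mf : measurable_fun [set: T1 * T2] f.
Hypothesis iA : m1.-integrable [set: T1] (EFin \o A).
Hypothesis iB : m2.-integrable [set: T2] (EFin \o B).
Hypothesis fAB : forall x y, `|f (x, y)| <= A x * B y.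

Let m1' : {sigma_finite_measure set T1 -> \bar R} := sfin_measure s1.
Let m2' : {sigma_finite_measure set T2 -> \bar R} := sfin_measure s2.

Let mfE : measurable_fun [set: T1 * T2] (EFin \o f).
Proof. exact/measurable_EFinP. Qed.

Let slice1 x : m2.-integrable [set: T2] (EFin \o (fun y => f (x, y))).
Proof.
apply: (@integrable_le _ _ _ _ _ (fun y => A x * B y)) => //.
- exact: measurableT_comp.
- exact: integrable_Zl.
Qed.

Let slice2 y : m1.-integrable [set: T1] (EFin \o (fun x => f (x, y))).
Proof.
apply: (@integrable_le _ _ _ _ _ (fun x => B y * A x)) => //.
- exact: measurableT_comp.
- exact: integrable_Zl.
- by move=> x; rewrite mulrC.
Qed.

(** The bound [fAB] gives joint integrability: the iterated integral of [|f|] is at most the product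
    of the integrals of [|A|] and [|B|], both finite. *)
Let if12 : (product_measure1 m1' m2').-integrable [set: T1 * T2] (EFin \o f).
Proof.
have mA : measurable_fun [set: T1] (fun x => `|(A x)|%:E).
  apply/measurable_EFinP; apply: measurableT_comp => //.
  exact: integrable_measurable iA.
apply/integrable12ltyP => //.
apply: (@le_lt_trans _ _ (\int[m1]_x (`|(A x)|%:E * \int[m2]_y (`|(B y)|%:E)))%E).
  apply: ge0_le_integral => //.
  - by move=> x _; exact: integral_ge0.
  - apply: (measurable_fun_fubini_tonelli_F (m2 := m2') (fun z => `|(f z)%:E|%E)) => //.
    exact: measurableT_comp.
  - exact: emeasurable_funM.
  - move=> x _; rewrite -ge0_integralZl//; last first.
      apply/measurable_EFinP; apply: measurableT_comp => //.
      exact: integrable_measurable iB.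
    apply: ge0_le_integral => //.
    + by apply: measurableT_comp => //; exact: measurableT_comp.
    + apply/measurable_EFinP; apply: measurable_funM => //; apply: measurableT_comp => //.
      exact: integrable_measurable iB.
    + move=> y _; rewrite /= lee_fin -normrM (le_trans (fAB x y))//.
      exact: ler_norm.
have /integrableP[_ Aoo] := iA; have /integrableP[_ Boo] := iB.
rewrite ge0_integralZr//; last exact: integral_ge0.
by rewrite lte_mul_pinfty// ?integral_ge0// ge0_fin_numE ?integral_ge0.
Qed.

Lemma Rintegral_fubini_measurable1 :
  measurable_fun [set: T1] (fun x => \int[m2]_y f (x, y)).
Proof.
apply/measurable_EFinP.
apply: (eq_measurable_fun (fubini_F m2' (EFin \o f))); last exact: measurable_fubini_F if12.
by move=> x _; rewrite /= /Rintegral fineK//; exact: integrable_fin_num (slice1 x).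
Qed.

Lemma Rintegral_fubini_integrable1 :
  m1.-integrable [set: T1] (EFin \o (fun x => \int[m2]_y f (x, y))).
Proof.
have h : m1.-integrable [set: T1] (fubini_F m2' (EFin \o f)) := integrable_fubini_F if12.
apply: (eq_integrable measurableT) h => x _.
by rewrite /= /Rintegral fineK//; exact: integrable_fin_num (slice1 x).
Qed.

Lemma Rintegral_fubini :
  \int[m1]_x \int[m2]_y f (x, y) = \int[m2]_y \int[m1]_x f (x, y).
Proof.
rewrite /Rintegral; congr fine.
transitivity (\int[m1]_x \int[m2]_y (f (x, y))%:E)%E.
  apply: eq_integral => x _; rewrite fineK//.
  exact: integrable_fin_num (slice1 x).
rewrite (Fubini if12); apply: eq_integral => y _; rewrite fineK//.
exact: integrable_fin_num (slice2 y).
Qed.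

(** Agreement on measurable sets is all that is asked of [nu], so the formula does not depend on
    which bundled copy of [m2] the product is formed with. *)
Lemma Rintegral_prod (nu : {measure set (T1 * T2) -> \bar R}) :
  (forall X, measurable X -> nu X = product_measure1 m1 m2 X) ->
  nu.-integrable [set: T1 * T2] (EFin \o f) /\
  \int[nu]_z f z = \int[m1]_x \int[m2]_y f (x, y).
Proof.
move=> nuE.
have nuE' X : measurable X -> X `<=` [set: T1 * T2] -> nu X = (product_measure1 m1' m2') X.
  by move=> mX _; exact: nuE.
split.
  have /integrableP[mf_ foo] := if12; apply/integrableP; split => //.
  by rewrite (@eq_measure_integral _ _ _ _ (product_measure1 m1' m2')).
rewrite /Rintegral; congr fine.
rewrite (@eq_measure_integral _ _ _ _ (product_measure1 m1' m2')) => //.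
rewrite -(integral12_prod_meas1 if12); apply: eq_integral => x _.
by rewrite fineK//; exact: integrable_fin_num (slice1 x).
Qed.

End Rintegral_fubini.

(** * Lebesgue measure on [R^d] *)

Section borel_boxes.
Context (R : realType) (d : nat).
Local Notation V := 'rV[R]_d.
Local Notation Rd := (Rd R d).

Definition cbox (a b : V) : set V := [set x | forall i, a 0 i <= x 0 i <= b 0 i].

Lemma continuous_measurable_Rd (f : V -> R) :
  continuous f -> measurable_fun [set: Rd] (f : Rd -> R).
Proof.
move=> /continuousP cf; apply: (measurability _ (RGenOpens.measurableE R)).
move=> _ [_ [a [b ->] <-]]; rewrite setTI; apply: sub_sigma_algebra.
exact/cf/interval_open.
Qed.

Lemma measurable_coord (i : 'I_d) : measurable_fun [set: Rd] (fun x : Rd => (x : V) 0 i).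
Proof. by apply: continuous_measurable_Rd; exact: coord_continuous. Qed.

Lemma measurable_cbox (a b : V) : measurable (cbox a b : set Rd).
Proof.
rewrite (_ : cbox a b = \bigcap_(i : 'I_d) ((fun x : V => x 0 i) @^-1` `[a 0 i, b 0 i]%classic)).
  apply: fin_bigcap_measurable => // i _; rewrite -[X in measurable X]setTI.
  exact: (measurable_coord i).
apply/seteqP; split => [x h i _ /=|x h i]; first by rewrite in_itv/= h.
by have := h i I; rewrite /= in_itv.
Qed.

Lemma cboxI (a b a' b' : V) : cbox a b `&` cbox a' b' =
  cbox (\row_i Num.max (a 0 i) (a' 0 i)) (\row_i Num.min (b 0 i) (b' 0 i)).
Proof.
apply/seteqP; split => [x [h h'] i|x h]; first by rewrite !mxE ge_max le_min andbACA h h'.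
by split=> i; move: (h i); rewrite !mxE ge_max le_min andbACA => /andP[].
Qed.

(** A countable family of cubes of which every open set is a union. The half-side [1 / (u.2 + 1)]
    never degenerates. *)
Definition ratbox (u : 'rV[rat]_d * nat) : set V :=
  cbox (\row_i (ratr (u.1 0 i) - u.2.+1%:R^-1)) (\row_i (ratr (u.1 0 i) + u.2.+1%:R^-1)).

Lemma open_ratbox (U : set V) (x : V) : open U -> U x ->
  exists u, ratbox u x /\ ratbox u `<=` U.
Proof.
rewrite openE => /[apply]/nbhs_ballP[e /= e0 xU].
pose n := Num.truncn (e / 2)^-1; pose r : R := n.+1%:R^-1.
have r0 : 0 < r by rewrite invr_gt0.
(* Both [x] and a point [y] of the cube lie within [r] of the rational centre, whence the factor
   2. *)
have re : 2 * r < e.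
  rewrite mulrC -ltr_pdivlMr// -[ltRHS]invrK ltf_pV2 ?posrE ?invr_gt0 ?divr_gt0//.
  exact: truncnS_gt.
have /choice[q hq] : forall i, exists q : rat, ratr q \in `]x 0 i - r, x 0 i + r[.
  by move=> i; apply: rat_in_itvoo; lra.
exists (\row_i q i, n); split=> [i|y h]; first by rewrite !mxE; move: (hq i); rewrite -/r in_itv/=; lra.
apply: xU; split=> // i j; rewrite ord1 /ball /= ltr_norml.
by move: (h j) (hq j); rewrite !mxE -/r in_itv/=; lra.
Qed.

Lemma measurable_bigcup_countType (disp : measure_display) (T : measurableType disp)
    (I : countType) (P : set I) (F : I -> set T) :
  (forall i, measurable (F i)) -> measurable (\bigcup_(i in P) F i).
Proof.
move=> mF; rewrite bigcup_mkcond; apply: countable_bigcupT_measurable => // i.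
by case: ifP => _; [exact: mF|exact: measurable0].
Qed.

(** Unlike the open sets that define [Rd], boxes have a prescribed measure; they are also stable
    under intersection, as needed for the uniqueness of measures and for Dynkin induction. *)
Lemma measurable_RdE : @measurable _ Rd = <<s [set A | exists a b, A = cbox a b] >>.
Proof.
apply/seteqP; split; last first.
  apply: smallest_sub; first exact: sigma_algebra_measurable.
  by move=> _ [a [b ->]]; exact: measurable_cbox.
apply: smallest_sub; first exact: smallest_sigma_algebra.
move=> U oU.
rewrite (_ : U = \bigcup_(u in [set u | ratbox u `<=` U]) ratbox u).
  apply: (@measurable_bigcup_countType _ (g_sigma_algebraType [set A | exists a b, A = cbox a b])).
  by move=> u; apply: sub_sigma_algebra; do 2 eexists.
apply/seteqP; split=> [x Ux|x [u uU ux]]; last exact: uU.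
by have [u [ux uU]] := open_ratbox oU Ux; exists u.
Qed.

End borel_boxes.

Section image.
Context d d' (T1 : measurableType d) (T2 : measurableType d') (R : realType).
Variables (m : {measure set T1 -> \bar R}) (f : T1 -> T2).
Hypothesis mf : measurable_fun [set: T1] f.

Definition image_measure : {measure set T2 -> \bar R} :=
  measure_function_pushforward__canonical__measure_function_Measure m mf.

Lemma image_measureE A : image_measure A = m (f @^-1` A).
Proof. by []. Qed.

Lemma Rintegral_image (h : T2 -> R) : measurable_fun [set: T2] h ->
  m.-integrable [set: T1] (EFin \o (h \o f)) ->
  image_measure.-integrable [set: T2] (EFin \o h) /\
  \int[image_measure]_y h y = \int[m]_x h (f x).
Proof.
move=> mh ih; have mhE : measurable_fun [set: T2] (EFin \o h) by exact/measurable_EFinP.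
split; first exact: (integrable_pushforward mf mhE).
by rewrite /Rintegral (integral_pushforward mf mhE).
Qed.
End image.

Section eq_measure.
Context d (T : measurableType d) (R : realType) (m1 m2 : {measure set T -> \bar R}).
Hypothesis m12 : forall A, measurable A -> m1 A = m2 A.

Lemma eq_measure_Rintegral (f : T -> R) : \int[m1]_x f x = \int[m2]_x f x.
Proof. by rewrite /Rintegral (eq_measure_integral m2)// => A mA _; exact: m12. Qed.

Lemma eq_measure_integrable (f : T -> R) : m1.-integrable [set: T] (EFin \o f) ->
  m2.-integrable [set: T] (EFin \o f).
Proof.
move=> /integrableP[mf foo]; apply/integrableP; split=> //.
by rewrite (eq_measure_integral m1)// => A mA _; rewrite m12.
Qed.
End eq_measure.

Section lebesgue_Rd.
Context (R : realType) (d : nat).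
Local Notation V := 'rV[R]_d.
Local Notation Rd := (Rd R d).
Variable lam : {measure set Rd -> \bar R}.
Hypothesis lamP : is_lebesgue lam.

Definition cube (r : R) : set V := cbox (\row_i (- r)) (\row_i r).

Lemma lebesgue_cbox (a b : V) : (forall i, a 0 i <= b 0 i) ->
  lam (cbox a b) = (\prod_(i < d) (b 0 i - a 0 i))%:E.
Proof. exact: lamP. Qed.

Lemma lebesgue_cbox_lty (a b : V) : (lam (cbox a b) < +oo)%E.
Proof.
have [ab|nab] := pselect (forall i, a 0 i <= b 0 i).
  by rewrite lebesgue_cbox// ltry.
rewrite (_ : cbox a b = set0) ?measure0 ?ltry//.
apply/seteqP; split=> // x h; apply: nab => i.
by have /andP[] := h i; exact: le_trans.
Qed.

Lemma bigcup_cube : \bigcup_n cube n%:R = setT.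
Proof.
apply/seteqP; split=> // x _.
exists (Num.truncn (\sum_i `|x 0 i|)).+1 => // i; rewrite !mxE -ler_norml.
apply/ltW/(le_lt_trans _ (truncnS_gt _)).
by rewrite (bigD1 i)//= lerDl sumr_ge0.
Qed.

Lemma lebesgue_sigma_finite : sigma_finite [set: Rd] lam.
Proof.
exists (fun n => cube n%:R) => [|n]; first by rewrite bigcup_cube.
by split; [exact: measurable_cbox|exact: lebesgue_cbox_lty].
Qed.

End lebesgue_Rd.

(** Boxes form a pi-system generating the Borel sets, and cubes of finite measure exhaust the space.
    A measure known only through [is_lebesgue] thus inherits what is proved for a concrete product
    measure. *)
Lemma is_lebesgue_unique (R : realType) (d : nat)
  (lam lam' : {measure set (Rd R d) -> \bar R}) :
  is_lebesgue lam -> is_lebesgue lam' ->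
  forall A, measurable A -> lam A = lam' A.
Proof.
move=> l l' A mA.
pose G : set (set (Rd R d)) := [set A | exists a b, A = cbox a b].
have mG : measurable = <<s G >> by exact: measurable_RdE.
have GI : setI_closed G.
  by move=> _ _ [a [b ->]] [a' [b' ->]]; rewrite cboxI; do 2 eexists.
have Gg n : G (cube n%:R) by do 2 eexists.
have gT : \bigcup_n (cube n%:R : set (Rd R d)) = setT by exact: bigcup_cube.
have ll B : G B -> lam B = lam' B.
  move=> [a [b ->]].
  have [ab|nab] := pselect (forall i, a 0 i <= b 0 i).
    by rewrite (lebesgue_cbox l)// (lebesgue_cbox l').
  rewrite (_ : cbox a b = set0) ?measure0//.
  apply/seteqP; split=> // x h; apply: nab => i.
  by have /andP[] := h i; exact: le_trans.
have lfin n : (lam (cube n%:R) < +oo)%E by exact: lebesgue_cbox_lty.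
have h1 := @measure_unique _ R (Rd R d) G (fun n => cube n%:R : set (Rd R d)) mG GI Gg gT.
have h2 := h1 lam lam' ll.
have h3 := h2 lfin.
exact: h3.
Qed.

(** * Oscillatory integrals of products of one-variable functions *)

Section product_formula.
Context (R : realType).

(* The phase [c] makes the formula stable under integrating out one coordinate. *)
Definition product_formula (d : nat) (mu : {measure set (Rd R d) -> \bar R}) :=
  forall (f : 'I_d -> R -> R) (F : 'I_d -> R) (xi : 'rV[R]_d),
  (forall i, (@lebesgue_measure R).-integrable setT (EFin \o f i)) ->
  (forall i c, \int[@lebesgue_measure R]_t (f i t * cos (c + 2 * pi * (t * xi 0 i)))
     = cos c * F i) ->
  mu.-integrable setT (EFin \o (fun x : 'rV[R]_d => \prod_i f i (x 0 i))) /\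
  forall c, \int[mu]_x (\prod_i f i ((x : 'rV[R]_d) 0 i) * cos (c + 2 * pi * dotv x xi))
    = cos c * \prod_i F i.

Definition consv (d : nat) (z : R * 'rV[R]_d) : 'rV[R]_d.+1 :=
  \row_i (if unlift ord0 i is Some j then z.2 0 j else z.1).

Lemma consv0 d (z : R * 'rV[R]_d) : consv z 0 ord0 = z.1.
Proof. by rewrite mxE unlift_none. Qed.

Lemma consvS d (z : R * 'rV[R]_d) j : consv z 0 (lift ord0 j) = z.2 0 j.
Proof. by rewrite mxE liftK. Qed.

Lemma consv_preimage d (a b : 'rV[R]_d.+1) : @consv d @^-1` (cbox a b) =
  `[a 0 ord0, b 0 ord0]%classic `*`
  cbox (\row_j a 0 (lift ord0 j)) (\row_j b 0 (lift ord0 j)).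
Proof.
apply/seteqP; split=> [z h|z [h0 h] i].
  split=> [|j]; first by have := h ord0; rewrite consv0 /= in_itv.
  by have := h (lift ord0 j); rewrite consvS !mxE.
case: (unliftP ord0 i) => [j|] ->.
  by have := h j; rewrite consvS !mxE.
by move: h0; rewrite consv0 /= in_itv.
Qed.

Lemma measurable_consv d :
  measurable_fun [set: measurableTypeR R * Rd R d] (@consv d : _ -> Rd R d.+1).
Proof.
apply: (@measurability _ _ _ (Rd R d.+1) _ _ [set A | exists a b, A = cbox a b]) => [|_ [_ [a [b ->]] <-]].
  exact: measurable_RdE.
rewrite setTI consv_preimage; have m1 : measurable (`[a 0 ord0, b 0 ord0]%classic : set (measurableTypeR R)).
  exact: measurable_itv.
exact: (measurableX m1 (measurable_cbox _ _)).
Qed.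

Lemma measurable_prod_coord d (f : 'I_d -> R -> R) :
  (forall i, measurable_fun [set: measurableTypeR R] (f i)) ->
  measurable_fun [set: Rd R d] (fun x : 'rV[R]_d => \prod_i f i (x 0 i)).
Proof.
move=> mf; apply: measurable_prod => i _.
exact: (measurableT_comp (mf i) (@measurable_coord R d i)).
Qed.

Lemma measurable_dotv d (xi : 'rV[R]_d) :
  measurable_fun [set: Rd R d] (fun x : 'rV[R]_d => dotv x xi).
Proof.
apply: measurable_sum => i; apply: measurable_funM => //; exact: measurable_coord.
Qed.

Lemma measurable_cos_comp d0 (T : measurableType d0) (f : T -> R) :
  measurable_fun setT f -> measurable_fun setT (fun x => cos (f x)).
Proof. by move=> mf; exact: (measurableT_comp (continuous_measurable_fun (@continuous_cos R)) mf). Qed.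

(** By induction on the dimension: the new measure is the image under [consv] of the product of the
    line with the previous one. Integrating out the tail at fixed [t] uses the induction hypothesis
    at the phase [c + 2 * pi * (t * xi 0 ord0)], and the integral over [t] is then the one-variable
    hypothesis. Dimension 0 carries a Dirac mass, the empty product being 1. *)
Lemma exists_lebesgue d : exists mu : {measure set (Rd R d) -> \bar R},
  is_lebesgue mu /\ product_formula mu.
Proof.
elim: d => [|d [mu [muP muF]]].
  exists (@dirac _ (Rd R 0) (0 : 'rV[R]_0) R); split.
    move=> a b _; rewrite big_ord0 /= diracE mem_set// => -[].
    by case.
  move=> f F xi fi fF.
  have mP : measurable_fun [set: Rd R 0] (fun x : 'rV[R]_0 => \prod_i f i (x 0 i)).
    by apply: measurable_prod_coord => i; exact: integrable_measurable (fi i).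
  split.
    apply/integrableP; split; first exact/measurable_EFinP.
    rewrite integral_dirac//; last first.
      by apply/measurable_EFinP; exact: measurableT_comp.
    by rewrite diracT mul1e /= ltry.
  move=> c; rewrite /Rintegral integral_dirac//; last first.
    apply/measurable_EFinP; apply: measurable_funM => //.
    apply: measurable_cos_comp; apply: measurable_funD => //.
    by apply: measurable_funM => //; exact: measurable_dotv.
  by rewrite diracT mul1e /= /dotv !big_ord0 mulr0 addr0 mulr1 mul1r.
have sf := lebesgue_sigma_finite muP.
pose mu' : {sigma_finite_measure set (Rd R d) -> \bar R} := sfin_measure sf.
pose nu := product_measure1 (@lebesgue_measure R) mu'.
exists (image_measure nu (@measurable_consv d)); split.
  move=> a b ab; rewrite image_measureE consv_preimage.
  have mitv : measurable (`[a 0 ord0, b 0 ord0]%classic : set (measurableTypeR R)).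
    exact: measurable_itv.
  rewrite [LHS](product_measure1E (@lebesgue_measure R) mu' mitv (measurable_cbox _ _)).
  rewrite big_ord_recl EFinM; congr (_ * _)%E.
    rewrite [LHS](lebesgue_measure_itv `[a 0 ord0, b 0 ord0]) /= lte_fin; case: ltP => [_|ba]; first by rewrite EFinB.
    by rewrite (@le_anti _ _ (a 0 ord0) (b 0 ord0)) ?subrr// ab.
  rewrite [LHS](lebesgue_cbox muP); last by move=> j; rewrite !mxE.
  by congr EFin; apply: eq_bigr => j _; rewrite !mxE.
move=> f F xi fi fF.
pose xi' : 'rV[R]_d := \row_j xi 0 (lift ord0 j).
have [iP iF] := muF (fun j => f (lift ord0 j)) (fun j => F (lift ord0 j)) xi'
  (fun j => fi _) (fun j => ltac:(by rewrite mxE; exact: fF)).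
pose P (y : Rd R d) := \prod_j f (lift ord0 j) ((y : 'rV[R]_d) 0 j).
have mPc : measurable_fun [set: Rd R d.+1] (fun x : 'rV[R]_d.+1 => \prod_i f i (x 0 i)).
  by apply: measurable_prod_coord => i; exact: integrable_measurable (fi i).
have iA := integrable_abse (fi ord0); have iB := integrable_abse iP.
have bnd (h : Rd R d.+1 -> R) : (forall x, `|h x| <= 1) -> forall t y,
    `|\prod_i f i (consv (t, y) 0 i) * h (consv (t, y))| <= `|f ord0 t| * `|P y|.
  move=> h1 t y; rewrite big_ord_recl consv0 /=.
  under eq_bigr do rewrite consvS /=.
  by rewrite !normrM -mulrA ler_wpM2l// ler_piMr.
(* The bounded factor [h] is 1 for the integrability claim and the cosine for the formula. *)
have mI (h : Rd R d.+1 -> R) : measurable_fun setT h -> (forall x, `|h x| <= 1) ->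
    (image_measure nu (@measurable_consv d)).-integrable setT
      (EFin \o (fun x : 'rV[R]_d.+1 => \prod_i f i (x 0 i) * h x)) /\
    \int[image_measure nu (@measurable_consv d)]_x (\prod_i f i ((x : 'rV[R]_d.+1) 0 i) * h x) =
    \int[@lebesgue_measure R]_t \int[mu]_y (f ord0 t * (P y * h (consv (t, y)))).
  move=> mh h1.
  have mhc : measurable_fun [set: Rd R d.+1] (fun x : 'rV[R]_d.+1 => \prod_i f i (x 0 i) * h x).
    exact: measurable_funM.
  have [i1 e1] := Rintegral_prod (@sigma_finiteT _ _ _ (@lebesgue_measure R)) sf
    (measurableT_comp mhc (@measurable_consv d)) iA iB (bnd h h1)
    (nu := nu) (fun _ _ => erefl).
  have [-> ->] := Rintegral_image (@measurable_consv d) mhc i1; split=> //.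
  rewrite e1; apply: eq_Rintegral => t _; apply: eq_Rintegral => y _ /=.
  rewrite big_ord_recl consv0 /=.
  by under eq_bigr do rewrite consvS /=; rewrite mulrA.
split.
  have [+ _] := mI (cst 1) (measurable_cst _) (fun _ => ltac:(by rewrite normr1)).
  by apply: eq_integrable => // x _ /=; rewrite mulr1.
move=> c.
have mc : measurable_fun [set: Rd R d.+1] (fun x : 'rV[R]_d.+1 => cos (c + 2 * pi * dotv x xi)).
  apply: measurable_cos_comp; apply: measurable_funD => //.
  by apply: measurable_funM => //; exact: measurable_dotv.
have [_ ->] := mI _ mc (fun x => cos_max _).
transitivity (\int[@lebesgue_measure R]_t (f ord0 t * cos (c + 2 * pi * (t * xi 0 ord0)) * \prod_j F (lift ord0 j))).
  apply: eq_Rintegral => t _; rewrite RintegralZl//.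
    rewrite -mulrA -iF; congr (_ * _); apply: eq_Rintegral => y _.
    congr (_ * cos _); rewrite /dotv big_ord_recl consv0 /= mulrDr addrA; congr (_ + _ * _).
    by apply: eq_bigr => j _; rewrite consvS !mxE.
  apply: (integrable_mulbdd (c := 1)) => //.
    exact: (measurableT_comp mc (measurableT_comp (@measurable_consv d) (pair1_measurable t))).
  by move=> y; exact: cos_max.
rewrite RintegralZr//; last first.
  apply: (integrable_mulbdd (c := 1)) => //; last by move=> y; exact: cos_max.
  apply: measurable_cos_comp; apply: measurable_funD => //.
  by apply: measurable_funM => //; exact: measurable_funM.
by rewrite fF big_ord_recl mulrA.
Qed.
End product_formula.

Lemma lebesgue_product_formula (R : realType) (d : nat)
  (lam : {measure set (Rd R d) -> \bar R}) :
  is_lebesgue lam -> product_formula lam.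
Proof.
move=> lamP f F xi fi fF; have [mu [muP muF]] := exists_lebesgue R d.
have ml A : measurable A -> mu A = lam A by exact: is_lebesgue_unique.
have [i e] := muF f F xi fi fF; split; first exact: eq_measure_integrable i.
by move=> c; rewrite -e; apply/esym/eq_measure_Rintegral.
Qed.

(** * Ingham's compactly supported functions on the line *)

Section affine.
Context (R : realType).
Local Notation mu := (@lebesgue_measure R).

Lemma measurable_affine (a b : R) :
  measurable_fun [set: measurableTypeR R] (fun x : measurableTypeR R => a * x + b : measurableTypeR R).
Proof. by apply: measurable_funD => //; apply: measurable_funM. Qed.

(** By uniqueness of Lebesgue measure it suffices to compare lengths of intervals open on the left
    and closed on the right. For [a < 0] their preimages are closed on the left and open on the
    right. *)
Lemma lebesgue_affine (a b : R) (A : set (measurableTypeR R)) : a != 0 -> measurable A ->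
  (`|a|%:E * mu ((fun x => (a * x + b)%R) @^-1` A))%E = mu A.
Proof.
move=> a0 mA; have na0 : 0 < `|a| by rewrite normr_gt0.
pose nu : {measure set (measurableTypeR R) -> \bar R} := mscale (NngNum (ltW na0)) (image_measure mu (measurable_affine a b)).
suff nuE X : ocitv X -> lebesgue_measure X = nu X.
  by rewrite (lebesgue_measure_unique nuE mA).
move=> [[x y] _ <-] /=; rewrite /mscale/= /pushforward.
have [agt0|] := ltP 0 a; last rewrite le_eqVlt (negPf a0)/= => alt0.
- rewrite (_ : _ @^-1` _ = `](x - b) / a, (y - b) / a]%classic); last first.
    apply/seteqP; split=> z /=; rewrite !in_itv/= ltr_pdivrMr// ler_pdivlMr//; lra.
  rewrite !lebesgue_measure_itv/= !lte_fin ltr_pM2r ?invr_gt0// ltrD2r.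
  case: ifPn; rewrite ?mule0// => xy.
  rewrite -!EFinB -EFinM gtr0_norm//; congr EFin; field.
  by rewrite gt_eqF.
- rewrite (_ : _ @^-1` _ = `[(y - b) / a, (x - b) / a[%classic); last first.
    apply/seteqP; split=> z /=; rewrite !in_itv/= ltr_ndivlMr// ler_ndivrMr//; lra.
  rewrite !lebesgue_measure_itv/= !lte_fin ltr_nM2r ?invr_lt0// ltrD2r.
  case: ifPn; rewrite ?mule0// => xy.
  rewrite -!EFinB -EFinM ltr0_norm//; congr EFin; field.
  by rewrite lt_eqF.
Qed.

Lemma Rintegral_isometry (a b : R) (h : R -> R) : `|a| = 1 ->
  mu.-integrable setT (EFin \o h) ->
  mu.-integrable setT (EFin \o (fun x => h (a * x + b))) /\
  \int[mu]_x h (a * x + b) = \int[mu]_x h x.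
Proof.
move=> a1 ih; have a0 : a != 0 by rewrite -normr_gt0 a1.
have mh := integrable_measurable ih.
have e A : measurable A -> mu A = image_measure mu (measurable_affine a b) A.
  by move=> mA; rewrite image_measureE -(lebesgue_affine b a0 mA) a1 mul1e.
have mhc : measurable_fun [set: measurableTypeR R] (h \o (fun x => a * x + b)).
  exact: (measurableT_comp mh (measurable_affine a b)).
have ic : mu.-integrable setT (EFin \o (h \o (fun x => a * x + b))).
  have /integrableP[_ hoo] := eq_measure_integrable e ih.
  apply/integrableP; split; first exact/measurable_EFinP.
  move: hoo; rewrite (ge0_integral_pushforward (measurable_affine a b))//.
  by apply: measurableT_comp => //; exact/measurable_EFinP.
split=> //.
by have [_ <-] := Rintegral_image (measurable_affine a b) mh ic; exact/esym/eq_measure_Rintegral.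
Qed.

Lemma ge0_integral_affine (a b : R) (h : R -> R) : a != 0 ->
  measurable_fun setT h -> (forall x, 0 <= h x) ->
  (\int[mu]_x (h x)%:E = `|a|%:E * \int[mu]_x (h (a * x + b)%R)%:E)%E.
Proof.
move=> a0 mh h0; have na0 : 0 < `|a| by rewrite normr_gt0.
pose nu : {measure set (measurableTypeR R) -> \bar R} := mscale (NngNum (ltW na0)) (image_measure mu (measurable_affine a b)).
have e A : measurable A -> A `<=` setT -> mu A = nu A.
  by move=> mA _; rewrite -(lebesgue_affine b a0 mA).
have mhE : measurable_fun [set: R] (EFin \o h) by exact/measurable_EFinP.
rewrite (eq_measure_integral nu)// ge0_integral_mscale//; last by move=> x _; rewrite lee_fin.
rewrite (ge0_integral_pushforward (measurable_affine a b))//.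
by move=> x _; rewrite lee_fin.
Qed.

End affine.

Lemma lebesgue_itvcc (R : realType) (a b : R) : a <= b ->
  lebesgue_measure (`[a, b]%classic : set R) = (b - a)%:E.
Proof.
rewrite le_eqVlt => /predU1P[->|ab]; rewrite lebesgue_measure_itv/= lte_fin.
  by rewrite ltxx subrr.
by rewrite ab -EFinB.
Qed.

Lemma measurable_invr (R : realType) : measurable_fun [set: R] (@GRing.inv R).
Proof.
rewrite -(setUv [set 0 : R]); apply/measurable_funU => //; first exact: measurableC.
split; first exact: measurable_fun_set1.
apply: open_continuous_measurable_fun; first exact/closed_openC/closed_eq.
by move=> x; rewrite inE => /= /eqP x0; exact: inv_continuous.
Qed.

(** * The function sinc as transform of an interval *)

Section sinc.
Context (R : realType).
Local Notation mu := (@lebesgue_measure R).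

Definition sinc (u : R) := if u == 0 then 1 else sin u / u.

Lemma sinc0 : sinc 0 = 1. Proof. by rewrite /sinc eqxx. Qed.

Lemma mul_sinc (u : R) : u * sinc u = sin u.
Proof.
rewrite /sinc; case: eqVneq => [->|u0]; first by rewrite mul0r sin0.
by field.
Qed.

(** By parity the phase contributes only [cos c]. The case [w = 0] is separate because the primitive
    divides by [w]. *)
Lemma cos_box (a w c : R) : 0 < a ->
  \int[mu]_(t in `[(- a), a]) cos (c + w * t) = 2 * a * cos c * sinc (w * a).
Proof.
move=> a0; have [->|w0] := eqVneq w 0.
  under eq_Rintegral do rewrite mul0r addr0.
  rewrite Rintegral_cst//= lebesgue_itvcc; last by lra.
  by rewrite /= mul0r sinc0; ring.
have naa : - a < a by lra.
have cc : {within `[(- a), a], continuous (fun t => cos (c + w * t))}.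
  apply: continuous_subspaceT => x; apply: continuous_comp; last exact: continuous_cos.
  by apply: cvgD; [exact: cvg_cst|apply: cvgM; [exact: cvg_cst|exact: cvg_id]].
have dF (x : R) : is_derive x 1 (fun t : R => w^-1 * sin (c + w * t)) (cos (c + w * x)).
  have h1 : is_derive x 1 (fun t : R => c + w * t) w.
    by apply: is_derive_eq; rewrite /GRing.scale/=; ring.
  have h2 := @is_derive1_comp R (@sin R) (fun t => c + w * t) x _ _ (is_derive_sin _) h1.
  apply: (is_derive_eq (is_deriveZ (w^-1) h2)).
  by rewrite /GRing.scale/= mulrCA mulVf// mulr1.
have cF : continuous (fun t : R => w^-1 * sin (c + w * t)).
  by move=> x; apply: differentiable_continuous; exact/derivable1_diffP.
rewrite /Rintegral (continuous_FTC2 naa cc (F := fun t => w^-1 * sin (c + w * t))).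
- rewrite -EFinB /= mulrN sinB sinD.
  have -> : 2 * a * cos c * sinc (w * a) = 2 * w^-1 * cos c * (w * a * sinc (w * a)) by field.
  by rewrite mul_sinc; ring.
- split; [by move=> x _; exact: ex_derive|..].
  - exact: (cvg_at_right_filter (cF _)).
  - exact: (cvg_at_left_filter (cF _)).
- by move=> x _; rewrite derive1E; apply: derive_val.
Qed.

(** By [cos_box], [sinc u] is the mean of [cos (u * t)] over [[-1, 1]]. *)
Lemma normr_sinc_le1 (u : R) : `|sinc u| <= 1.
Proof.
have := cos_box u 0 (ltr01 : 0 < 1 :> R).
rewrite cos0 !mulr1 => h.
suff : `|2 * sinc u| <= 2 by rewrite normrM ger0_norm// -{2}[2]mulr1 ler_pM2l.
rewrite -h.
have ic (k : R) : mu.-integrable `[(-1), 1] (EFin \o (fun t => cos (0 + k * t))).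
  apply: continuous_compact_integrable; first exact: segment_compact.
  apply: continuous_subspaceT => x; apply: continuous_comp; last exact: continuous_cos.
  by apply: cvgD; [exact: cvg_cst|apply: cvgM; [exact: cvg_cst|exact: cvg_id]].
apply: le_trans (le_normr_Rintegral _ (ic u)) _ => //.
apply: le_trans (le_Rintegral (f2 := cst 1) _ _ _ _) _ => //.
- exact: integrable_abse (ic u).
- by have := ic 0; apply: eq_integrable => // x _ /=; rewrite mul0r addr0 cos0.
- by move=> x _; exact: cos_max.
- by rewrite Rintegral_cst//= lebesgue_itvcc /=; lra.
Qed.

Lemma mul_normr_sinc_le1 (u : R) : `|u| * `|sinc u| <= 1.
Proof. by rewrite -normrM mul_sinc sin_max. Qed.

Lemma sincN (u : R) : sinc (- u) = sinc u.
Proof.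
rewrite /sinc oppr_eq0; case: eqVneq => // u0.
by rewrite sinN; field.
Qed.

Lemma measurable_sinc : measurable_fun [set: R] sinc.
Proof.
rewrite (_ : sinc = fun u => \1_[set 0] u + sin u * u^-1); last first.
  apply/funext => u; rewrite /sinc indicE; case: eqVneq => [->|u0].
    by rewrite mem_set// sin0 mul0r addr0.
  by rewrite memNset ?add0r// => /eqP; exact/negP.
apply: measurable_funD; first exact: measurable_indic.
apply: measurable_funM; first exact: continuous_measurable_fun (@continuous_sin R).
exact: measurable_invr.
Qed.

End sinc.

(* [psi] has Fourier transform [Psi], while the inverse Fourier transform of
   [Psi] is [iota * psi]; both transforms carry an arbitrary phase [c], which
   encodes that the functions are even. The true value of [iota] is 1, but it is
   never needed. *)
Record fourier_pair (R : realType) (iota L : R) (psi Psi : R -> R) : Prop := {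
  fp_measurable : measurable_fun [set: R] psi ;
  fp_ge0 : forall x, 0 <= psi x ;
  fp_bounded : exists M, forall x, psi x <= M ;
  fp_support : forall x, L < `|x| -> psi x = 0 ;
  fp_integrable : (@lebesgue_measure R).-integrable setT (EFin \o Psi) ;
  fp_ft : forall c s, \int[@lebesgue_measure R]_x (psi x * cos (c + 2 * pi * (x * s))) =
    cos c * Psi s ;
  fp_inv : forall c x, \int[@lebesgue_measure R]_s (Psi s * cos (c + 2 * pi * (s * x))) =
    cos c * (iota * psi x) }.

Section average.
Context (R : realType).
Local Notation mu := (@lebesgue_measure R).
Implicit Types (a L M : R) (psi Psi : R -> R).

(** Convolution with the uniform probability density on [[-a, a]], whose transform at [s] is
    [sinc (2 * pi * (s * a))]. *)
Definition avg a psi (x : R) : R :=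
  (2 * a)^-1 * \int[mu]_t (\1_(`[(- a), a]%classic) t * psi (x + t)).

Lemma integrable_supported L M psi : measurable_fun [set: R] psi ->
  (forall x, `|psi x| <= M) -> (forall x, L < `|x| -> psi x = 0) ->
  mu.-integrable setT (EFin \o psi).
Proof.
move=> mpsi psiM psiL.
have iA := integrable_indic_itv (- L) L true false.
apply: (@integrable_le _ _ _ mu psi (fun x => M * \1_(`[(- L), L]%classic) x)) => //.
  exact: (integrable_Zl M iA).
move=> x; rewrite indicE; case: (leP `|x| L) => [xL|/psiL ->].
  by rewrite mem_set ?mulr1//= in_itv/= -ler_norml.
by rewrite normr0 mulr_ge0// (le_trans (normr_ge0 _) (psiM 0)).
Qed.

End average.

Section average.
Context (R : realType).
Local Notation mu := (@lebesgue_measure R).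
Implicit Types (a L M : R) (psi Psi : R -> R).

Lemma Rintegral_indicl (D : set R) (f : R -> R) :
  \int[mu]_t (\1_D t * f t) = \int[mu]_(t in D) f t.
Proof.
rewrite [RHS]Rintegral_mkcond; apply: eq_Rintegral => t _.
by rewrite /patch indicE; case: ifP; rewrite ?mul1r ?mul0r.
Qed.

Lemma integrable_itv_indic a : mu.-integrable setT (EFin \o \1_(`[(- a), a]%classic)).
Proof. exact: (integrable_indic_itv (- a) a true false). Qed.

Lemma measurable_itv_indic a : measurable_fun [set: R] (\1_(`[(- a), a]%classic) : R -> R).
Proof. exact: measurable_indic. Qed.

Lemma Rintegral_itv_indic a : 0 < a -> \int[mu]_t (\1_(`[(- a), a]%classic) t) = 2 * a.
Proof.
move=> a0; transitivity (\int[mu]_t (\1_(`[(- a), a]%classic) t * cst 1 t)).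
  by apply: eq_Rintegral => t _; rewrite mulr1.
rewrite Rintegral_indicl Rintegral_cst//= lebesgue_itvcc /=; lra.
Qed.

Lemma avg_ge0 a psi x : 0 < a -> (forall x, 0 <= psi x) -> 0 <= avg a psi x.
Proof.
move=> a0 psi0; rewrite mulr_ge0 ?invr_ge0 ?mulr_ge0 ?(ltW a0)//.
by apply: Rintegral_ge0 => t _; rewrite mulr_ge0// indicE.
Qed.

Lemma integrable_avg a psi M x : measurable_fun [set: R] psi -> (forall x, `|psi x| <= M) ->
  mu.-integrable setT (EFin \o (fun t => \1_(`[(- a), a]%classic) t * psi (x + t))).
Proof.
move=> mpsi psiM.
apply: (integrable_mulbdd (c := M) (integrable_itv_indic a)) => //.
by apply: (measurableT_comp mpsi); exact: measurable_funD.
Qed.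

Lemma avg_le a psi M x : 0 < a -> measurable_fun [set: R] psi ->
  (forall x, 0 <= psi x) -> (forall x, psi x <= M) -> avg a psi x <= M.
Proof.
move=> a0 mpsi psi0 psiM.
have psiM' y : `|psi y| <= M by rewrite ger0_norm.
rewrite /avg mulrC ler_pdivrMr ?mulr_gt0//.
rewrite -(Rintegral_itv_indic a0) -RintegralZl//; last exact: integrable_itv_indic.
apply: le_Rintegral => //.
- exact: integrable_avg mpsi psiM'.
- exact: (integrable_Zl M (integrable_itv_indic a)).
- by move=> t _; rewrite mulrC ler_wpM2r// indicE.
Qed.

Lemma avg_support a psi L x : (forall x, L < `|x| -> psi x = 0) ->
  L + a < `|x| -> avg a psi x = 0.
Proof.
move=> psiL xL; rewrite /avg (_ : Rintegral _ _ _ = 0) ?mulr0//.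
transitivity (\int[mu]_t (cst 0 t)); last by rewrite Rintegral_cst// mul0r.
apply: eq_Rintegral => t _; rewrite indicE.
have [|/eqP] := boolP (t \in _); last by rewrite mul0r.
rewrite inE/= in_itv/= -ler_norml => ta; rewrite psiL ?mulr0//.
rewrite -(opprK t); apply: lt_le_trans (lerB_dist _ _).
by rewrite normrN; lra.
Qed.

(** Prepares Fubini: from [|t| <= a] and [|x + t| <= L] follows [|x| <= L + a], which turns the
    dependence on [x + t] into a product of indicators. *)
Lemma avg_joint a psi L M (h : R -> R -> R) : measurable_fun [set: R] psi ->
  (forall x, `|psi x| <= M) -> (forall x, L < `|x| -> psi x = 0) -> 0 <= M ->
  measurable_fun [set: R * R] (fun z => h z.1 z.2) -> (forall x t, `|h x t| <= 1) ->
  [/\ measurable_fun [set: R * R]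
        (fun z => \1_(`[(- a), a]%classic) z.2 * psi (z.1 + z.2) * h z.1 z.2) &
      forall x t, `|\1_(`[(- a), a]%classic) t * psi (x + t) * h x t| <=
        M * \1_(`[(- (L + a)), L + a]%classic) x * \1_(`[(- a), a]%classic) t].
Proof.
move=> mpsi psiM psiL M0 mh h1; split.
  apply: measurable_funM => //; apply: measurable_funM.
    by apply: (measurableT_comp (measurable_itv_indic a)).
  by apply: (measurableT_comp mpsi); exact: measurable_funD.
move=> x t; rewrite !normrM; apply: le_trans (ler_piMr _ (h1 x t)) _ => //.
rewrite !indicE; have [ta|] := boolP (t \in _); last by rewrite normr0 mul0r mulr0.
rewrite normr1 mul1r mulr1; have [xa|xa] := leP `|x| (L + a).
  by rewrite mem_set/= ?mulr1// in_itv/= -ler_norml.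
rewrite psiL ?normr0 ?mulr_ge0//.
move: ta; rewrite inE/= in_itv/= -ler_norml => ta.
rewrite -(opprK t); apply: lt_le_trans (lerB_dist _ _).
by rewrite normrN; lra.
Qed.

Lemma sigma_finite_lebesgue : sigma_finite [set: measurableTypeR R] mu.
Proof. exact: sigma_finiteT. Qed.

(** After Fubini, translating [x] by [t] changes only the phase, by [- 2 * pi * s * t]; the
    hypothesis [ft] applies at that phase, and the integral left over [t] is [cos_box]. *)
Lemma avg_ft a psi Psi L M : 0 < a -> measurable_fun [set: R] psi ->
  (forall x, `|psi x| <= M) -> (forall x, L < `|x| -> psi x = 0) -> 0 <= M ->
  (forall c s, \int[mu]_x (psi x * cos (c + 2 * pi * (x * s))) = cos c * Psi s) ->
  measurable_fun [set: R] (avg a psi) /\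
  forall c s, \int[mu]_x (avg a psi x * cos (c + 2 * pi * (x * s))) =
    cos c * (Psi s * sinc (2 * pi * (s * a))).
Proof.
move=> a0 mpsi psiM psiL M0 ft.
have iA := integrable_Zl M (integrable_itv_indic (L + a)).
have iB := integrable_itv_indic a.
have sf := sigma_finite_lebesgue.
split.
  apply: measurable_funM => //.
  have [mj bj] := @avg_joint a psi L M (fun _ _ => 1) mpsi psiM psiL M0
    (measurable_cst _) (fun _ _ => ltac:(by rewrite normr1)).
  have := Rintegral_fubini_measurable1 sf sf mj iA iB bj.
  by apply: eq_measurable_fun => x _; apply: eq_Rintegral => t _; rewrite /= mulr1.
move=> c s.
have mcos : measurable_fun [set: R * R] (fun z => cos (c + 2 * pi * (z.1 * s))).
  apply: measurable_cos_comp; apply: measurable_funD => //.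
  by apply: measurable_funM => //; exact: measurable_funM.
have [mj bj] := @avg_joint a psi L M (fun x _ => cos (c + 2 * pi * (x * s)))
  mpsi psiM psiL M0 mcos (fun _ _ => cos_max _).
have ipsi := integrable_supported mpsi psiM psiL.
transitivity ((2 * a)^-1 * \int[mu]_x \int[mu]_t
    (\1_(`[(- a), a]%classic) t * psi (x + t) * cos (c + 2 * pi * (x * s)))).
  rewrite -RintegralZl//; last exact: (Rintegral_fubini_integrable1 sf sf mj iA iB bj).
  apply: eq_Rintegral => x _; rewrite RintegralZr ?mulrA//.
  exact: integrable_avg mpsi psiM.
rewrite (Rintegral_fubini sf sf mj iA iB bj).
transitivity ((2 * a)^-1 * \int[mu]_t
    (\1_(`[(- a), a]%classic) t * cos (c + (- (2 * pi * s)) * t) * Psi s)).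
  congr (_ * _); apply: eq_Rintegral => t _.
  rewrite -mulrA -ft.
  have mc : measurable_fun [set: R] (fun x : R => cos (c - 2 * pi * s * t + 2 * pi * (x * s))).
    apply: measurable_cos_comp; apply: measurable_funD => //.
    by apply: measurable_funM => //; exact: measurable_funM.
  have ih := integrable_mulbdd ipsi mc (fun _ => cos_max _).
  have [ic e] := Rintegral_isometry t (normr1 _) ih.
  rewrite mulNr -e -RintegralZl//.
  apply: eq_Rintegral => x _; rewrite mul1r -mulrA; congr (_ * (_ * cos _)); rewrite /=; ring.
rewrite RintegralZr//; last first.
  apply: (integrable_mulbdd (c := 1) iB) => //; last by move=> x; exact: cos_max.
  by apply: measurable_cos_comp; apply: measurable_funD => //; exact: measurable_funM.
rewrite Rintegral_indicl cos_box// (_ : - (2 * pi * s) * a = - (2 * pi * (s * a))) ?sincN; last by ring.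
by field; rewrite gt_eqF.
Qed.

(** The same computation backwards: the [sinc] factor is written as a mean of waves over [[-a, a]],
    and integrating in [s] first evaluates the inversion formula of [Psi] at [x + t]. *)
Lemma avg_inv a psi Psi iota : 0 < a ->
  mu.-integrable setT (EFin \o Psi) ->
  (forall c x, \int[mu]_s (Psi s * cos (c + 2 * pi * (s * x))) = cos c * (iota * psi x)) ->
  measurable_fun [set: R] psi -> (exists M, forall x, `|psi x| <= M) ->
  mu.-integrable setT (EFin \o (fun s => Psi s * sinc (2 * pi * (s * a)))) /\
  forall c x, \int[mu]_s (Psi s * sinc (2 * pi * (s * a)) * cos (c + 2 * pi * (s * x))) =
    cos c * (iota * avg a psi x).
Proof.
move=> a0 iPsi inv mpsi [M psiM].
have iB := integrable_itv_indic a.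
have iA := integrable_abse iPsi.
have sf := sigma_finite_lebesgue.
have msinc : measurable_fun [set: R] (fun s => sinc (2 * pi * (s * a))).
  apply: (measurableT_comp (@measurable_sinc R)).
  by apply: measurable_funM => //; exact: measurable_funM.
split; first by apply: (integrable_mulbdd (c := 1)) => // s; exact: normr_sinc_le1.
move=> c x.
pose f z := Psi z.1 * (\1_(`[(- a), a]%classic) z.2 * cos (c + 2 * pi * (z.1 * x) + (2 * pi * z.1) * z.2)).
have mf : measurable_fun [set: R * R] f.
  apply: measurable_funM.
    by apply: (measurableT_comp (integrable_measurable iPsi)).
  apply: measurable_funM.
    by apply: (measurableT_comp (measurable_itv_indic a)).
  apply: measurable_cos_comp; apply: measurable_funD => //.
    apply: measurable_funD => //; apply: measurable_funM => //; exact: measurable_funM.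
  by apply: measurable_funM => //; exact: measurable_funM.
have bf s t : `|f (s, t)| <= `|Psi s| * \1_(`[(- a), a]%classic) t.
  rewrite !normrM ler_wpM2l//; apply: le_trans (ler_piMr _ (cos_max _)) _ => //.
  by rewrite indicE ger0_norm.
transitivity ((2 * a)^-1 * \int[mu]_s \int[mu]_t f (s, t)).
  rewrite -RintegralZl//; last exact: (Rintegral_fubini_integrable1 sf sf mf iA iB bf).
  apply: eq_Rintegral => s _; rewrite /f/= RintegralZl//; last first.
    apply: (integrable_mulbdd (c := 1) iB) => //; last by move=> ?; exact: cos_max.
    by apply: measurable_cos_comp; apply: measurable_funD => //; exact: measurable_funM.
  rewrite Rintegral_indicl cos_box// (_ : 2 * pi * s * a = 2 * pi * (s * a)); last by ring.
  by field; rewrite gt_eqF.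
rewrite (Rintegral_fubini sf sf mf iA iB bf) /avg.
rewrite (_ : cos c * _ = (2 * a)^-1 * (cos c * iota * \int[mu]_t (\1_(`[(- a), a]%classic) t * psi (x + t)))); last by ring.
congr (_ * _); rewrite -RintegralZl//; last exact: integrable_avg mpsi psiM.
apply: eq_Rintegral => t _; rewrite /f/=.
rewrite (_ : cos c * _ * _ = \1_(`[(- a), a]%classic) t * (cos c * (iota * psi (x + t)))); last by ring.
rewrite -inv -RintegralZl//; last first.
  apply: (integrable_mulbdd (c := 1)) => //; last by move=> ?; exact: cos_max.
  apply: measurable_cos_comp; apply: measurable_funD => //.
  by apply: measurable_funM => //; exact: measurable_funM.
apply: eq_Rintegral => s _; rewrite mulrCA; congr (_ * (_ * cos _)); rewrite /=; ring.
Qed.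

Lemma fourier_pair_avg a iota L psi Psi : 0 < a -> fourier_pair iota L psi Psi ->
  fourier_pair iota (L + a) (avg a psi) (fun s => Psi s * sinc (2 * pi * (s * a))).
Proof.
move=> a0 [mpsi psi0 [M psiM] psiL iPsi ft inv].
have psiM' x : `|psi x| <= M by rewrite ger0_norm.
have M0 : 0 <= M := le_trans (psi0 0) (psiM 0).
have [m1 ft'] := avg_ft a0 mpsi psiM' psiL M0 ft.
have [i' inv'] := avg_inv a0 iPsi inv mpsi (ex_intro _ M psiM').
split=> //.
- by move=> x; exact: avg_ge0.
- by exists M => x; exact: avg_le.
- by move=> x; exact: avg_support.
Qed.

End average.

(** * The triangle function, starting point of the construction *)

Section triangle.
Context (R : realType).
Local Notation mu := (@lebesgue_measure R).

Lemma integrable_oneDsqrV : mu.-integrable setT (EFin \o (fun x : R => (1 + x ^+ 2)^-1)).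
Proof.
have c1 : continuous (fun x : R => (1 + x ^+ 2)^-1).
  exact: (@continuous_oneDsqrV R).
apply: integrable_ge0_lty => //.
- exact: continuous_measurable_fun.
- by move=> x; rewrite invr_ge0 addr_ge0// sqr_ge0.
rewrite ge0_symfun_integralT//.
- rewrite -set_itvcy.
  by rewrite integral0y_oneDsqr -EFinM ltry.
- by move=> x; rewrite invr_ge0 addr_ge0// sqr_ge0.
- by move=> x /=; rewrite sqrrN.
Qed.

Lemma sinc2_le (u : R) : sinc u ^+ 2 <= 2 * (1 + u ^+ 2)^-1.
Proof.
rewrite ler_pdivlMr ?ltr_wpDr ?sqr_ge0// mulrDr mulr1.
have h1 : sinc u ^+ 2 <= 1.
  by rewrite -real_normK ?num_real// expr_le1// normr_sinc_le1.
have h2 : sinc u ^+ 2 * u ^+ 2 <= 1.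
  rewrite -exprMn mulrC mul_sinc -real_normK ?num_real// expr_le1// sin_max.
  by [].
lra.
Qed.

Lemma integrable_sinc2 : mu.-integrable setT (EFin \o (fun u : R => sinc u ^+ 2)).
Proof.
apply: (integrable_le _ (integrable_Zl 2 integrable_oneDsqrV)).
  by apply: measurable_funX; exact: measurable_sinc.
by move=> x; rewrite ger0_norm ?sqr_ge0//; exact: sinc2_le.
Qed.

Definition sincK : R := \int[mu]_u (sinc u ^+ 2).

(** Bounded below by the integral over [[pi / 4, pi / 2]], where [sinc] is at least
    [sin (pi / 4) / (pi / 2)]. Positivity makes the inversion constant [sincK R / pi] invertible. *)
Lemma sincK_gt0 : 0 < sincK.
Proof.
have p0 := @pi_gt0 R.
pose k : R := (sin (pi / 4) / (pi / 2)) ^+ 2.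
have s4 : 0 < sin (pi / 4) :> R by apply: sin_gt0_pihalf; apply/andP; split; lra.
have k0 : 0 < k by rewrite exprn_gt0// divr_gt0//; lra.
apply: (@lt_le_trans _ _ (k * (pi / 4))); first by rewrite mulr_gt0//; lra.
have -> : k * (pi / 4) = \int[mu]_(u in `[(pi / 4), (pi / 2)]) (cst k u).
  by rewrite Rintegral_cst//= lebesgue_itvcc /=; [congr (_ * _); lra|lra].
rewrite -Rintegral_indicl; apply: le_Rintegral => //.
- have i1 := integrable_indic_itv (pi / 4) (pi / 2 : R) true false.
  apply: (integrable_mulbdd (c := k) i1) => // x; by rewrite ger0_norm ?(ltW k0).
- exact: integrable_sinc2.
move=> u _; rewrite indicE; have [|_] := boolP (u \in _); last by rewrite mul0r sqr_ge0.
rewrite inE/= in_itv/= mul1r => /andP[u1 u2].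
have u0 : 0 < u by lra.
have su : sin (pi / 4) <= sin u.
  have [->//|u1'] := eqVneq u (pi / 4).
  by apply/ltW; rewrite ltr_sin ?in_itv/= ?lt_neqAle 1?eq_sym ?u1'//; apply/andP; split; lra.
have su0 : sin (pi / 4) / (pi / 2) <= sinc u.
  rewrite /sinc gt_eqF//; apply: ler_pM => //; first exact: ltW.
  by rewrite invr_ge0; lra.
  by rewrite lef_pV2 ?posrE//; lra.
have s0 : 0 <= sin (pi / 4) / (pi / 2) :> R by rewrite divr_ge0 ?(ltW s4)//; lra.
by rewrite /k /cst ler_pXn2r ?nnegrE//; exact: le_trans su0.
Qed.

Lemma Rintegral_sinc2_scale (a : R) :
  mu.-integrable setT (EFin \o (fun s => a ^+ 2 * sinc (a * s) ^+ 2)) /\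
  \int[mu]_s (a ^+ 2 * sinc (a * s) ^+ 2) = `|a| * sincK.
Proof.
have [->|a0] := eqVneq a 0.
  have e : (fun s : R => 0 ^+ 2 * sinc (0 * s) ^+ 2) = cst 0.
    by apply/funext => s; rewrite expr2 !mul0r.
  rewrite e; split; first exact: integrable0.
  by rewrite Rintegral_cst// normr0 !mul0r.
have m2 : measurable_fun [set: R] (fun u : R => sinc u ^+ 2).
  by apply: measurable_funX; exact: measurable_sinc.
have g0 (u : R) : 0 <= sinc u ^+ 2 by exact: sqr_ge0.
have m3 : measurable_fun [set: R] (fun u : R => sinc (a * u) ^+ 2).
  by apply: (measurableT_comp m2); exact: measurable_funM.
have := ge0_integral_affine 0 a0 m2 g0.
under [X in _ = (_ * X)%E]eq_integral do rewrite addr0.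
move=> e.
have e1 : (\int[mu]_s (sinc (a * s) ^+ 2)%:E = (`|a|^-1 * sincK)%:E)%E.
  rewrite EFinM /sincK /Rintegral fineK; last exact: (integrable_fin_num _ integrable_sinc2).
  by rewrite e muleA -EFinM mulVf ?mul1e// normr_eq0.
have i1 : mu.-integrable setT (EFin \o (fun s => sinc (a * s) ^+ 2)).
  by apply: integrable_ge0_lty => //; rewrite e1 ltry.
split; first exact: integrable_Zl.
rewrite RintegralZl// /Rintegral e1 /= -real_normK ?num_real//.
by field; rewrite normr_eq0.
Qed.

(* [q al s = (1 - cos (al * s)) / s^2], extended by continuity to [s = 0]. *)
Let q (al s : R) : R := 2 * ((al / 2) ^+ 2 * sinc (al / 2 * s) ^+ 2).

Let q_sqr (al s : R) : q al s * s ^+ 2 = 1 - cos (al * s).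
Proof.
rewrite /q (_ : _ * _ = 2 * (al / 2 * s * sinc (al / 2 * s)) ^+ 2); last by ring.
rewrite mul_sinc sin2cos2 (_ : al * s = (al / 2 * s) *+ 2) ?cos_mulr2n; last first.
  by rewrite mulr2n; field.
by rewrite -mulr_natr; ring.
Qed.

Let q_integral (al : R) : mu.-integrable setT (EFin \o q al) /\
  \int[mu]_s q al s = `|al| * sincK.
Proof.
have [i e] := Rintegral_sinc2_scale (al / 2); split; first exact: integrable_Zl.
by rewrite (RintegralZl _ measurableT i) e normrM normfV [ `|2|]ger0_norm//; field.
Qed.

(** The left side is [q w s * cos (y * s)], and [2 cos y cos w = cos (y + w) + cos (y - w)]. As the
    integral of [q al] is proportional to [|al|], the transform of [sinc^2] becomes a second
    difference of the absolute value, that is, a triangle. *)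
Let q_combine (w y s : R) :
  w ^+ 2 / 2 * (sinc (w / 2 * s) ^+ 2 * cos (y * s)) =
  2^-1 * q (y + w) s + 2^-1 * q (y - w) s - q y s.
Proof.
have [->|s0] := eqVneq s 0.
  by rewrite /q !mulr0 sinc0 cos0; field.
have s20 : s ^+ 2 != 0 by rewrite expf_neq0.
apply: (mulIf s20).
transitivity (q w s * s ^+ 2 * cos (y * s)); first by rewrite /q; field.
transitivity (2^-1 * (q (y + w) s * s ^+ 2) + 2^-1 * (q (y - w) s * s ^+ 2) - q y s * s ^+ 2).
  by rewrite !q_sqr (mulrDl y w s) (mulrBl s y w) cosD cosB; field.
by ring.
Qed.

(** The sine part of the phase integrates to 0, since it changes sign under [s |-> - s]. *)
Let cos_even_vanish (f : R -> R) (c x : R) : mu.-integrable setT (EFin \o f) ->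
  (forall s, f (- s) = f s) ->
  \int[mu]_s (f s * cos (c + 2 * pi * (s * x))) =
  cos c * \int[mu]_s (f s * cos (2 * pi * x * s)).
Proof.
move=> fi fe.
have mc (b : R) : measurable_fun [set: R] (fun s : R => cos (b + 2 * pi * x * s)).
  by apply: measurable_cos_comp; apply: measurable_funD => //; exact: measurable_funM.
have icos : mu.-integrable setT (EFin \o (fun s => f s * cos (2 * pi * x * s))).
  apply: (integrable_mulbdd (c := 1) fi) => [|s]; last exact: cos_max.
  by have := mc 0; under eq_fun do rewrite add0r.
have isin : mu.-integrable setT (EFin \o (fun s => f s * sin (2 * pi * x * s))).
  apply: (integrable_mulbdd (c := 1) fi) => [|s]; last exact: sin_max.
  have := mc (- (pi / 2)); apply: eq_measurable_fun => s _.
  by rewrite addrC cosBpihalf.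
have [_] := Rintegral_isometry 0 (normrN1 _) isin.
under eq_Rintegral do rewrite addr0 mulN1r fe mulrN sinN mulrN -mulN1r.
rewrite RintegralZl// mulN1r => sin0'.
rewrite -RintegralZl// -[RHS]addr0.
have s0 : \int[mu]_s (f s * sin (2 * pi * x * s)) = 0 by lra.
rewrite -(mulr0 (- sin c)) -s0 -RintegralZl// -RintegralD//.
- apply: eq_Rintegral => s _; rewrite (_ : 2 * pi * (s * x) = 2 * pi * x * s); last by ring.
  by rewrite cosD; ring.
- exact: integrable_Zl.
- exact: integrable_Zl.
Qed.

Definition box_density (a x : R) : R := (2 * a)^-1 * \1_(`[(- a), a]%classic) x.

(** The triangle function, written as a second difference of the absolute value to match the
    integrals of [q_combine]. *)
Lemma avg_box_density (a x : R) : 0 < a ->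
  avg a (box_density a) x = (2 * a)^-1 ^+ 2 * (2^-1 * `|x + 2 * a| + 2^-1 * `|x - 2 * a| - `|x|).
Proof.
move=> a0; rewrite /avg expr2 -mulrA; congr (_ * _).
(* [lo] and [hi] delimit the overlap of [[-a, a]] with its translate by [- x], empty when
   [hi < lo]. *)
pose lo := Num.max (- a) (- a - x); pose hi := Num.min a (a - x).
transitivity (\int[mu]_t ((2 * a)^-1 * \1_(`[lo, hi]%classic) t)).
  apply: eq_Rintegral => t _; rewrite /box_density mulrCA; congr (_ * _).
  rewrite !indicE -natrM mulnb; congr (_%:R); congr nat_of_bool.
  apply/andP/idP; rewrite !inE/= !in_itv/= /lo /hi ge_max le_min.
    by move=> [/andP[h1 h2] /andP[h3 h4]]; apply/andP; split; apply/andP; split; lra.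
  by move=> /andP[/andP[h1 h2] /andP[h3 h4]]; split; apply/andP; split; lra.
rewrite RintegralZl//; last exact: (integrable_indic_itv lo hi true false).
congr (_ * _).
transitivity (\int[mu]_t (\1_(`[lo, hi]%classic) t * cst 1 t)).
  by apply: eq_Rintegral => t _; rewrite mulr1.
rewrite Rintegral_indicl Rintegral_cst//= mul1r.
have [lh|hl] := leP lo hi.
  rewrite lebesgue_itvcc//=; move: lh; rewrite /lo /hi !maxEle !minEle.
  by case: (leP (- a) (- a - x)) => h1; case: (leP a (a - x)) => h2 h3; case: (ger0P (x + 2 * a)) => h4; case: (ger0P (x - 2 * a)) => h5; case: (ger0P x) => h6; lra.
rewrite lebesgue_measure_itv/= lte_fin ltNge (ltW hl)/=.
move: hl; rewrite /lo /hi !maxEle !minEle.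
by case: (leP (- a) (- a - x)) => h1; case: (leP a (a - x)) => h2 h3; case: (ger0P (x + 2 * a)) => h4; case: (ger0P (x - 2 * a)) => h5; case: (ger0P x) => h6; lra.
Qed.

(** The forward formula is [avg_ft] applied to a box. For the inverse, the integrals of [q] at
    [2 pi x] and [2 pi (x +- 2 a)] give [2 pi sincK] times the second difference; dividing by
    [w^2 / 2 = 8 pi^2 a^2] leaves the triangle with the factor [sincK R / pi]. *)
Lemma fourier_pair_triangle (a : R) : 0 < a ->
  fourier_pair (sincK / pi) (2 * a) (avg a (box_density a))
    (fun s => sinc (2 * pi * (s * a)) ^+ 2).
Proof.
move=> a0; have p0 := @pi_gt0 R.
have iB := integrable_itv_indic a.
have mb : measurable_fun [set: R] (box_density a).
  by apply: measurable_funM => //; exact: measurable_itv_indic.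
have b0 x : 0 <= box_density a x.
  by rewrite mulr_ge0 ?invr_ge0 ?mulr_ge0 ?(ltW a0)// indicE.
have bM x : box_density a x <= (2 * a)^-1.
  by rewrite ler_piMr ?invr_ge0 ?mulr_ge0 ?(ltW a0)// indicE lern1 leq_b1.
have bM' x : `|box_density a x| <= (2 * a)^-1 by rewrite ger0_norm.
have bL x : a < `|x| -> box_density a x = 0.
  move=> ax; rewrite /box_density indicE memNset ?mulr0//= in_itv/= -ler_norml.
  by apply/negP; rewrite -ltNge.
have bft c s : \int[mu]_x (box_density a x * cos (c + 2 * pi * (x * s))) =
    cos c * sinc (2 * pi * (s * a)).
  transitivity ((2 * a)^-1 * \int[mu]_x (\1_(`[(- a), a]%classic) x * cos (c + (2 * pi * s) * x))).
    rewrite -RintegralZl//; last first.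
      apply: (integrable_mulbdd (c := 1) iB) => [|x]; last exact: cos_max.
      by apply: measurable_cos_comp; apply: measurable_funD => //; exact: measurable_funM.
    apply: eq_Rintegral => x _; rewrite /box_density -!mulrA; congr (_ * (_ * cos _)).
    by rewrite /=; ring.
  rewrite Rintegral_indicl cos_box// -!mulrA.
  by field; rewrite gt_eqF.
have M0 : 0 <= (2 * a)^-1 by rewrite invr_ge0 mulr_ge0 ?(ltW a0).
have [m1 ft1] := avg_ft a0 mb bM' bL M0 bft.
have [i1 _] := Rintegral_sinc2_scale (2 * pi * a).
have wne : 2 * pi * a != 0 by rewrite !mulf_neq0 ?gt_eqF.
have i2 : mu.-integrable setT (EFin \o (fun s => sinc (2 * pi * (s * a)) ^+ 2)).
  have := integrable_Zl ((2 * pi * a) ^- 2) i1; apply: (eq_integrable measurableT) => s _ /=.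
  by congr EFin; rewrite mulrA mulVf ?expf_neq0// mul1r; congr (sinc _ ^+ 2); ring.
split=> //.
- by move=> x; exact: avg_ge0.
- by exists (2 * a)^-1 => x; exact: avg_le.
- by move=> x; rewrite (_ : 2 * a = a + a); [exact: avg_support|ring].
move=> c x; rewrite cos_even_vanish//; last by move=> s; rewrite mulNr mulrN sincN.
congr (_ * _).
pose w : R := 4 * pi * a; have w0 : 0 < w by rewrite !mulr_gt0.
have [[iq1 q1] [iq2 q2] [iq3 q3]] := And3 (q_integral (2 * pi * x + w))
  (q_integral (2 * pi * x - w)) (q_integral (2 * pi * x)).
have w2 : w ^+ 2 / 2 != 0 by rewrite mulf_neq0 ?expf_neq0 ?gt_eqF.
apply: (mulfI w2); rewrite -RintegralZl//; last first.
  apply: (integrable_mulbdd (c := 1) i2) => [|s]; last exact: cos_max.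
  by apply: measurable_cos_comp; exact: measurable_funM.
transitivity (\int[mu]_s (2^-1 * q (2 * pi * x + w) s + 2^-1 * q (2 * pi * x - w) s - q (2 * pi * x) s)).
  apply: eq_Rintegral => s _; rewrite -q_combine; congr (_ * (sinc _ ^+ 2 * _)).
  by rewrite /w; field.
rewrite RintegralB//; last first.
  by apply: (integrableD measurableT (integrable_Zl 2^-1 iq1) (integrable_Zl 2^-1 iq2)).
rewrite RintegralD//; [|exact: integrable_Zl|exact: integrable_Zl].
rewrite (RintegralZl _ measurableT iq1) (RintegralZl _ measurableT iq2) q1 q2 q3 avg_box_density//.
rewrite (_ : 2 * pi * x + w = 2 * pi * (x + 2 * a)); last by rewrite /w; ring.
rewrite (_ : 2 * pi * x - w = 2 * pi * (x - 2 * a)); last by rewrite /w; ring.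
rewrite !normrM [ `|2|]ger0_norm// (ger0_norm (ltW p0)) /w.
move: (@pi R) p0 => P p0; field.
by rewrite !gt_eqF.
Qed.

End triangle.

Lemma cvgn_ge (R : realType) (u : nat -> R) (l x : R) :
  u n @[n --> \oo] --> l -> (forall n, x <= u n) -> x <= l.
Proof.
move=> c h; rewrite -(cvg_lim _ c)//; apply: limr_ge; first by apply/cvg_ex; exists l.
exact: nearW.
Qed.

Lemma cvgn_le (R : realType) (u : nat -> R) (l x : R) :
  u n @[n --> \oo] --> l -> (forall n, u n <= x) -> l <= x.
Proof.
move=> c h; rewrite -(cvg_lim _ c)//; apply: limr_le; first by apply/cvg_ex; exists l.
exact: nearW.
Qed.

(** * Dominated limits of Fourier pairs *)

Section limit.
Context (R : realType).
Local Notation mu := (@lebesgue_measure R).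

Lemma fourier_pair_widen (iota L L' : R) (psi Psi : R -> R) : L <= L' ->
  fourier_pair iota L psi Psi -> fourier_pair iota L' psi Psi.
Proof. by move=> LL' [? ? ? psiL ? ? ?]; split=> // x /(le_lt_trans LL')/psiL. Qed.

Let dominated := @Rintegral_dominated _ (measurableTypeR R) R mu.

Let measurable_wave (c x : R) : measurable_fun [set: R] (fun s : R => cos (c + 2 * pi * (s * x))).
Proof.
apply: measurable_cos_comp; apply: measurable_funD => //.
by apply: measurable_funM => //; exact: measurable_funM.
Qed.

(** The limit [psi] is defined by the inversion formula at phase 0, which passes to the limit under
    the majorant [G]. Then [psi_ n] tends to [psi] pointwise, with common bound [M] and common
    support, so the forward formula passes to the limit too. *)
Lemma fourier_pair_limit (iota L : R) (psi_ Psi_ : nat -> R -> R) (Psi G : R -> R) :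
  0 < iota -> (forall n, fourier_pair iota L (psi_ n) (Psi_ n)) ->
  (forall s, Psi_ n s @[n --> \oo] --> Psi s) ->
  mu.-integrable setT (EFin \o G) -> (forall n s, `|Psi_ n s| <= G s) ->
  exists psi, fourier_pair iota L psi Psi.
Proof.
move=> i0 fp PsiC iG PsiG.
have mPsi_ n : measurable_fun [set: R] (Psi_ n) := integrable_measurable (fp_integrable (fp n)).
have [iPsi _] := dominated mPsi_ PsiC iG PsiG.
have invC c x : \int[mu]_s (Psi_ n s * cos (c + 2 * pi * (s * x))) @[n --> \oo] -->
    \int[mu]_s (Psi s * cos (c + 2 * pi * (s * x))).
  apply: (dominated _ _ iG _).2 => [n|s|n s].
  - exact: (measurable_funM (mPsi_ n) (measurable_wave c x)).
  - by apply: cvgM => //; exact: cvg_cst.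
  - by rewrite normrM (le_trans (ler_piMr _ (cos_max _))).
pose psi x := iota^-1 * \int[mu]_s (Psi s * cos (0 + 2 * pi * (s * x))).
have psiE n x : psi_ n x = iota^-1 * \int[mu]_s (Psi_ n s * cos (0 + 2 * pi * (s * x))).
  by rewrite (fp_inv (fp n)) cos0 mul1r mulKf ?gt_eqF.
have psiC x : psi_ n x @[n --> \oo] --> psi x.
  rewrite (_ : (fun n => psi_ n x) = fun n => iota^-1 * \int[mu]_s (Psi_ n s * cos (0 + 2 * pi * (s * x)))).
    exact: (cvgM (cvg_cst _) (invC 0 x)).
  by apply/funext => n; exact: psiE.
have psi0 n x := fp_ge0 (fp n) x.
pose M := iota^-1 * \int[mu]_s G s.
have psiM n x : psi_ n x <= M.
  rewrite psiE ler_pM2l ?invr_gt0//; apply: le_trans (ler_norm _) _.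
  apply: normr_Rintegral_le => //.
    exact: (integrable_mulbdd (c := 1) (fp_integrable (fp n)) (measurable_wave _ _) (fun _ => cos_max _)).
  by move=> s; rewrite normrM (le_trans (ler_piMr _ (cos_max _))).
have mpsi : measurable_fun [set: R] psi.
  by apply: (measurable_fun_cvg (fun n => fp_measurable (fp n))) => x _; exact: psiC.
have psiL x : L < `|x| -> psi x = 0.
  move=> xL; have := psiC x.
  rewrite (_ : (fun n => psi_ n x) = cst 0); last by apply/funext => n; exact: fp_support (fp n) _ xL.
  by move/cvg_unique; apply => //; exact: cvg_cst.
exists psi; split => //.
- by move=> x; exact: (cvgn_ge (psiC x)).
- by exists M => x; exact: (cvgn_le (psiC x)).
- move=> c s.
  have M0 : 0 <= M := le_trans (psi0 0 0) (psiM 0 0).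
  have iA := integrable_Zl M (integrable_itv_indic L).
  have ftC : \int[mu]_x (psi_ n x * cos (c + 2 * pi * (x * s))) @[n --> \oo] -->
      \int[mu]_x (psi x * cos (c + 2 * pi * (x * s))).
    apply: (dominated _ _ iA _).2 => [n|x|n x].
    + exact: (measurable_funM (fp_measurable (fp n)) (measurable_wave c s)).
    + by apply: cvgM => //; exact: cvg_cst.
    + rewrite normrM (le_trans (ler_piMr _ (cos_max _)))//.
      have [xL|/(fp_support (fp n)) ->] := leP `|x| L; last by rewrite normr0 mulr_ge0// indicE.
      by rewrite indicE mem_set/= ?mulr1 ?in_itv/= -?ler_norml// ger0_norm.
  apply: (cvg_unique _ ftC) => //.
  rewrite (_ : (fun n => _) = fun n => cos c * Psi_ n s); last first.
    by apply/funext => n; exact: (fp_ft (fp n)).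
  by apply: cvgM => //; exact: cvg_cst.
- move=> c x; apply: (cvg_unique _ (invC c x)) => //.
  rewrite (_ : (fun n => _) = fun n => cos c * (iota * psi_ n x)); last first.
    by apply/funext => n; exact: (fp_inv (fp n)).
  by apply: cvgM; [exact: cvg_cst|apply: cvgM; [exact: cvg_cst|exact: psiC]].
Qed.

End limit.

(** * Ingham's infinite product *)

Section ingham.
Context (R : realType).
Local Notation mu := (@lebesgue_measure R).

(** Each [b m] is used twice so that its [sinc] appears squared: the transform stays nonnegative and
    the partial products decrease. *)
Fixpoint avg_iter (a : R) (b : nat -> R) (n : nat) : R -> R :=
  if n is m.+1 then avg (b m) (avg (b m) (avg_iter a b m)) else avg a (box_density a).

Definition sinc_prod (a : R) (b : nat -> R) (n : nat) (s : R) : R :=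
  sinc (2 * pi * (s * a)) ^+ 2 * \prod_(k < n) sinc (2 * pi * (s * b k)) ^+ 2.

Lemma fourier_pair_iter (a : R) (b : nat -> R) (n : nat) : 0 < a -> (forall k, 0 < b k) ->
  fourier_pair (sincK R / pi) (2 * a + 2 * \sum_(k < n) b k) (avg_iter a b n) (sinc_prod a b n).
Proof.
move=> a0 b0; elim: n => [|n IH].
  rewrite big_ord0 mulr0 addr0 /= (_ : sinc_prod a b 0 = fun s => sinc (2 * pi * (s * a)) ^+ 2).
    exact: fourier_pair_triangle.
  by apply/funext => s; rewrite /sinc_prod big_ord0 mulr1.
have := fourier_pair_avg (b0 n) (fourier_pair_avg (b0 n) IH).
rewrite (_ : _ + b n + b n = 2 * a + 2 * \sum_(k < n.+1) b k); last by rewrite big_ord_recr/=; ring.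
rewrite (_ : (fun s => _) = sinc_prod a b n.+1)//.
by apply/funext => s; rewrite /sinc_prod big_ord_recr /= expr2 -!mulrA.
Qed.

Lemma sinc2_01 (u : R) : 0 <= sinc u ^+ 2 <= 1.
Proof. by rewrite sqr_ge0 -real_normK ?num_real// expr_le1// normr_sinc_le1. Qed.

Lemma prod_01 (n m : nat) (f : nat -> R) : (forall k, 0 <= f k <= 1) -> (n <= m)%N ->
  0 <= \prod_(k < m) f k <= \prod_(k < n) f k.
Proof.
move=> f01; elim: m => [|m IH] nm.
  by move: nm; rewrite leqn0 => /eqP ->; rewrite big_ord0 ler01 lexx.
move: nm; rewrite leq_eqVlt => /predU1P[->|].
  by rewrite lexx andbT prodr_ge0// => i _; have /andP[] := f01 i.
rewrite ltnS => /IH /andP[h0 h1]; rewrite big_ord_recr/=; have /andP[g0 g1] := f01 m.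
by rewrite mulr_ge0//= (le_trans _ h1)// ler_piMr.
Qed.

Lemma expRN1_ge : (16 : R)^-1 <= expR (- 1).
Proof.
have h : 2^-1 <= expR (- 2^-1) :> R by apply: le_trans (expR_ge1Dx _); lra.
rewrite (_ : - 1 = - 2^-1 + - 2^-1 :> R); last by field.
rewrite expRD; apply: (@le_trans _ _ (2^-1 * 2^-1)); first by lra.
by apply: ler_pM => //; lra.
Qed.

(** [|sinc u| <= 1 / |u| <= 1 / 4], and [1 / 16] is below [1 / e]. The threshold 4 is chosen to be
    met by [2 * pi]. *)
Lemma sinc2_small (u : R) : 4 <= `|u| -> sinc u ^+ 2 <= expR (- 1).
Proof.
move=> u4; apply: le_trans expRN1_ge.
have h := mul_normr_sinc_le1 u.
have h4 : `|sinc u| <= 4^-1.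
  rewrite -[4^-1]mul1r ler_pdivlMr// mulrC; apply: le_trans h.
  by rewrite ler_wpM2r.
rewrite -real_normK ?num_real// (_ : 16^-1 = 4^-1 ^+ 2 :> R); last by field.
by rewrite ler_pXn2r ?nnegrE.
Qed.

(* Ingham's construction: the factor sinc(2 pi s b_k)^2 with b_k = eta(k)/k is at
   most 1/e as soon as k <= eta(s) s, and there are about eta(s) s such k. *)
Lemma ingham_pair (eta : R -> R) (S s1 L : R) : 0 < L ->
  (forall s, 0 <= s -> 0 < eta s) ->
  (forall s t, 0 <= s -> s <= t -> eta t <= eta s) ->
  (forall s, s1 <= s -> eta s <= 1) ->
  (forall n, \sum_(k < n) eta k.+1%:R / k.+1%:R <= S) ->
  exists psi Psi C, [/\ fourier_pair (sincK R / pi) L psi Psi, Psi 0 = 1 &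
    forall s, 0 <= Psi s <= C * (1 + s ^+ 2)^-1 * expR (- (eta `|s| * `|s|))].
Proof.
move=> L0 eta0 eta_dec eta1 etaS.
pose e k := eta k.+1%:R / k.+1%:R.
pose u n := \sum_(k < n) e k.
have e0 k : 0 < e k by rewrite divr_gt0 ?eta0.
(* The terms are summable, so beyond some [k0] they add up to at most [L / 8]. With [a = L / 4] the
   support [2 a + 2 sum b_k] stays within [L]; the dropped factors cost only a constant. *)
have [k0 hk0] : exists k0, forall n, \sum_(k < n) e (k0 + k)%N <= L / 8.
  have hs : has_sup (range u).
    by split; [exists (u 0%N); exists 0%N|exists S => _ [n _ <-]; exact: etaS].
  have [_ [k0 _ <-] hk0] := sup_adherent (divr_gt0 L0 (ltr0n R 8)) hs.
  exists k0 => n; have : u (k0 + n)%N <= sup (range u) by apply: sup_upper_bound => //; exists (k0 + n)%N.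
  rewrite /u big_split_ord/=; move: hk0; rewrite -/(u k0) -/(u _); lra.
pose b k := e (k0 + k)%N; pose a := L / 4.
have a0 : 0 < a by rewrite divr_gt0.
have b0 k : 0 < b k by exact: e0.
have p0 := @pi_gt0 R.
have i0 : 0 < sincK R / pi by rewrite divr_gt0// sincK_gt0.
have fp n : fourier_pair (sincK R / pi) L (avg_iter a b n) (sinc_prod a b n).
  apply: fourier_pair_widen (fourier_pair_iter n a0 b0).
  by have := hk0 n; rewrite -/b /a; lra.
have P01 s n m : (n <= m)%N -> 0 <= sinc_prod a b m s <= sinc_prod a b n s.
  move=> nm; have /andP[h0 h1] := prod_01 (fun k => sinc2_01 (2 * pi * (s * b k))) nm.
  by rewrite /sinc_prod mulr_ge0 ?sqr_ge0//= ler_wpM2l ?sqr_ge0.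
pose Psi s := limn (fun n => sinc_prod a b n s).
have Pc s : sinc_prod a b n s @[n --> \oo] --> Psi s.
  apply: nonincreasing_is_cvgn.
    by move=> n m nm; have /andP[] := P01 s n m nm.
  by exists 0 => _ [n _ <-]; have /andP[] := P01 s n n (leqnn _).
have i2 := fp_integrable (fp 0%N).
have P0 n s : `|sinc_prod a b n s| <= sinc_prod a b 0 s.
  by have /andP[h h'] := P01 s 0%N n (leq0n _); rewrite ger0_norm.
have [psi fpsi] := fourier_pair_limit i0 fp Pc i2 P0.
have Ple s n : Psi s <= sinc_prod a b n s.
  apply: (nonincreasing_cvgn_ge (u_ := fun m => sinc_prod a b m s)) => //.
  by move=> m m' mm; have /andP[] := P01 s m m' mm.
have Pge s : 0 <= Psi s.
  by apply: (cvgn_ge (Pc s)) => n; have /andP[] := P01 s n n (leqnn _).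
pose w : R := 2 * pi * a; have w0 : 0 < w by rewrite !mulr_gt0.
pose C0 : R := 2 * (1 + w ^- 2).
have C00 : 0 <= C0 by rewrite mulr_ge0// addr_ge0// invr_ge0 sqr_ge0.
have base s : sinc_prod a b 0 s <= C0 * (1 + s ^+ 2)^-1.
  rewrite /sinc_prod big_ord0 mulr1 (_ : 2 * pi * (s * a) = w * s); last by rewrite /w; ring.
  apply: (le_trans (sinc2_le _)); rewrite /C0 -[leRHS]mulrA ler_pM2l//.
  have p1 : 0 < 1 + s ^+ 2 by rewrite ltr_wpDr ?sqr_ge0.
  have p2 : 0 < 1 + (w * s) ^+ 2 by rewrite ltr_wpDr ?sqr_ge0.
  rewrite ler_pdivlMr// mulrC ler_pdivrMr//.
  have -> : (1 + w ^- 2) * (1 + (w * s) ^+ 2) = 1 + (w * s) ^+ 2 + w ^- 2 + s ^+ 2.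
    by field; rewrite gt_eqF.
  have : 0 <= w ^- 2 by rewrite invr_ge0 sqr_ge0.
  have : 0 <= (w * s) ^+ 2 by rewrite sqr_ge0.
  lra.
(* [C1] serves two purposes: for [|s| <= s2] the exponent is at most [eta 0 * s2], and for larger
   [|s|] at most [k0 + 1] units of it are lost to the dropped factors and to truncation. *)
pose s2 := Num.max 0 s1.
pose C1 := expR (Num.max (eta 0 * s2) k0.+1%:R).
exists psi, Psi, (C0 * C1); split => //.
  apply: (cvg_unique _ (Pc 0)) => //.
  rewrite (_ : (fun n => _) = cst 1); first exact: cvg_cst.
  apply/funext => n; rewrite /sinc_prod mul0r mulr0 sinc0 expr1n mul1r.
  by rewrite big1// => k _; rewrite mul0r mulr0 sinc0 expr1n.
move=> s; rewrite Pge/=; set t := `|s|; have t0 : 0 <= t by exact: normr_ge0.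
have et0 := eta0 t t0.
suff [n hn] : exists n, sinc_prod a b n s <= sinc_prod a b 0 s * (C1 * expR (- (eta t * t))).
  apply: (le_trans (Ple s n)); apply: (le_trans hn).
  rewrite (_ : C0 * C1 * _ * _ = C0 * (1 + s ^+ 2)^-1 * (C1 * expR (- (eta t * t)))); last by ring.
  by rewrite ler_wpM2r// mulr_ge0 ?expR_ge0.
have [ts|ts] := leP t s2.
  exists 0%N; rewrite ler_peMr//; first by have /andP[] := P01 s 0%N 0%N (leqnn _).
  rewrite /C1 -expRD -[leLHS]expR0 ler_expR subr_ge0 le_max; apply/orP; left.
  by apply: ler_pM => //; [exact: ltW|exact: eta_dec].
have et1 : eta t <= 1 by apply: eta1; move: ts; rewrite /s2 gt_max => /andP[_ /ltW].
(* An index with [k0 + k + 1 <= m] is at most [eta t * t], hence at most [t] because [eta t <= 1],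
   so its [eta] is at least [eta t] and the argument of its [sinc] is at least [2 * pi]. There are
   [m - k0] such [k], none when [m <= k0]. *)
pose m := Num.truncn (eta t * t).
have m1 : m%:R <= eta t * t by rewrite -truncn_ge_nat // mulr_ge0// ltW.
have m2 : eta t * t < m.+1%:R by exact: truncnS_gt.
exists (m - k0)%N.
rewrite /sinc_prod big_ord0 mulr1 ler_wpM2l ?sqr_ge0//.
apply: (@le_trans _ _ (expR (- 1) ^+ (m - k0))).
  have -> : expR (- 1) ^+ (m - k0) = \prod_(k < m - k0) expR (- 1) :> R by rewrite prodr_const card_ord.
  apply: ler_prod => k _; rewrite sqr_ge0/=; apply: sinc2_small.
  have km : ((k0 + k).+1 <= m)%N by have := ltn_ord k; lia.
  have kt : (k0 + k).+1%:R <= eta t * t by apply: le_trans m1; rewrite ler_nat.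
  have kt' : (k0 + k).+1%:R <= t by apply: (le_trans kt); rewrite ler_piMl.
  have ek : eta t * t <= eta (k0 + k).+1%:R * t by rewrite ler_wpM2r// eta_dec.
  rewrite /b /e !normrM -/t normfV !ger0_norm ?(ltW p0) ?(ltW (eta0 _ _))//.
  have h1 : 1 <= t * (eta (k0 + k).+1%:R / (k0 + k).+1%:R).
    by rewrite mulrA ler_pdivlMr// mul1r mulrC; exact: le_trans ek.
  have p2 := @pi_ge2 R; apply: (@le_trans _ _ (2 * pi * 1)); first by lra.
  by rewrite ler_pM2l ?mulr_gt0.
rewrite -expRM_natl /C1 -expRD ler_expR.
have : (m%:R : R) <= (m - k0)%:R + k0%:R by rewrite -natrD ler_nat; lia.
have : k0.+1%:R <= Num.max (eta 0 * s2) k0.+1%:R by rewrite le_max lexx orbT.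
move: m2; rewrite -!(natr1 _); lra.
Qed.
End ingham.

(** * Extra decay of square-root type *)

Section ingham_sqrt.
Context (R : realType).

(** Adding [5 / sqrt (1 + s)] to [th] keeps the series bounded. As
    [x^-1 - y^-1 = 1 / (x y (x + y))], the claim reduces to [x + y <= 3 x]. *)
Lemma sqrt_telescope (k : nat) :
  5 / Num.sqrt (1 + k.+1%:R) / k.+1%:R <=
  15 * ((Num.sqrt k.+1%:R)^-1 - (Num.sqrt k.+2%:R)^-1) :> R.
Proof.
rewrite nat1r.
set x := Num.sqrt k.+1%:R; set y := Num.sqrt k.+2%:R.
have x0 : 0 < x by rewrite sqrtr_gt0.
have y0 : 0 < y by rewrite sqrtr_gt0.
have x2 : x ^+ 2 = k.+1%:R by rewrite sqr_sqrtr.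
have y2 : y ^+ 2 = k.+2%:R by rewrite sqr_sqrtr.
have x1 : 1 <= x ^+ 2 by rewrite x2 ler1n.
have yx2 : y ^+ 2 = x ^+ 2 + 1 by rewrite y2 x2 natr1.
have yx : y <= 2 * x.
  by rewrite -ler_sqr ?nnegrE ?mulr_ge0 ?ltW//; nra.
have d : (y - x) * (y + x) = 1 by rewrite -subr_sqr yx2; ring.
rewrite -x2.
have -> : x^-1 - y^-1 = (x * y * (x + y))^-1.
  have xy0 : x * y * (x + y) != 0 by rewrite gt_eqF// mulr_gt0 ?addr_gt0 ?mulr_gt0.
  apply: (mulIf xy0); rewrite mulVf//.
  by rewrite -[RHS]d; field; rewrite !gt_eqF.
rewrite -mulrA -invfM (_ : 15 = 5 * 3); last by ring.
rewrite -mulrA ler_pM2l// ler_pdivlMr ?mulr_gt0 ?addr_gt0//.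
rewrite mulrC ler_pdivrMr ?mulr_gt0 ?exprn_gt0//.
have : 0 <= x * y * (2 * x - y) by apply: mulr_ge0; [apply/ltW; exact: mulr_gt0|rewrite subr_ge0].
lra.
Qed.

(** The summand [5 / sqrt (1 + s)] buys the decay [exp(- 5 sqrt s)] up to the constant [exp 5]. *)
Lemma sqrt_decay (s : R) : 0 <= s -> 5 * Num.sqrt s - 5 <= 5 / Num.sqrt (1 + s) * s.
Proof.
move=> s0; set x := Num.sqrt s; set y := Num.sqrt (1 + s).
have x0 : 0 <= x by exact: sqrtr_ge0.
have y0 : 0 < y by rewrite sqrtr_gt0 ltr_wpDr.
have x2 : x ^+ 2 = s by rewrite sqr_sqrtr.
have y2 : y ^+ 2 = 1 + s by rewrite sqr_sqrtr// addr_ge0.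
have xy : x <= y by rewrite ler_sqrt ?addr_ge0// lerDr.
have yx1 : y <= x + 1.
  by rewrite -ler_sqr ?nnegrE ?addr_ge0 ?(ltW y0)// y2 -x2; nra.
rewrite mulrAC ler_pdivlMr// -x2.
have [x1|x1] := leP x 1; first by nra.
have : 0 <= (x - 1) * (x + 1 - y) by apply: mulr_ge0; lra.
lra.
Qed.

(** This is [ingham_pair] for [th s + 5 / sqrt (1 + s)]. The added term also makes the weight
    strictly positive, so that [th] itself may vanish, even identically. *)
Lemma ingham_pair_sqrt (th : R -> R) (S s1 L : R) : 0 < L ->
  (forall s, 0 <= s -> 0 <= th s) ->
  (forall s t, 0 <= s -> s <= t -> th t <= th s) ->
  (forall s, s1 <= s -> th s <= 2^-1) ->
  (forall n, \sum_(k < n) th k.+1%:R / k.+1%:R <= S) ->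
  exists psi Psi C, [/\ fourier_pair (sincK R / pi) L psi Psi, Psi 0 = 1 &
    forall s, 0 <= Psi s <=
      C * ((1 + s ^+ 2)^-1 * expR (- (th `|s| * `|s|) - 5 * Num.sqrt `|s|))].
Proof.
move=> L0 th0 th_dec th1 thS.
pose eta s := th s + 5 / Num.sqrt (1 + s).
have sq0 s : 0 <= s -> 0 < Num.sqrt (1 + s) by move=> s0; rewrite sqrtr_gt0 ltr_wpDr.
have e0 s : 0 <= s -> 0 < eta s.
  by move=> s0; rewrite ltr_wpDl ?th0// divr_gt0// sq0.
have ed s t : 0 <= s -> s <= t -> eta t <= eta s.
  move=> s0 st; have t0 := le_trans s0 st.
  rewrite lerD ?th_dec// ler_pM2l// lef_pV2 ?posrE ?sq0//.
  by rewrite ler_sqrt ?lerD2l// addr_ge0.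
(* Both summands are at most [1 / 2]; beyond 100 one has [sqrt (1 + s) >= 10]. *)
have e1 s : Num.max s1 100 <= s -> eta s <= 1.
  rewrite ge_max => /andP[ss1 s100]; have := th1 s ss1.
  suff : 5 / Num.sqrt (1 + s) <= 2^-1 by rewrite /eta; lra.
  have s0 : 0 <= s by lra.
  rewrite ler_pdivrMr ?sq0//.
  suff : 10 <= Num.sqrt (1 + s) by lra.
  rewrite -ler_sqr ?nnegrE ?sqrtr_ge0// sqr_sqrtr ?addr_ge0//; lra.
have eS n : \sum_(k < n) eta k.+1%:R / k.+1%:R <= S + 15.
  under eq_bigr do rewrite mulrDl.
  rewrite big_split/=; apply: lerD; first exact: thS.
  apply: (@le_trans _ _ (\sum_(k < n) (15 * ((Num.sqrt k.+1%:R)^-1 - (Num.sqrt k.+2%:R)^-1)))).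
    by apply: ler_sum => k _; exact: sqrt_telescope.
  rewrite -mulr_sumr (_ : \sum_(k < n) _ = 1 - (Num.sqrt n.+1%:R)^-1).
    by rewrite ler_piMr// gerBl invr_ge0 sqrtr_ge0.
  elim: n => [|n IH]; first by rewrite big_ord0 sqrtr1 invr1 subrr.
  by rewrite big_ord_recr/= IH; ring.
have [psi [Psi [C [fp P1 PC]]]] := ingham_pair L0 e0 ed e1 eS.
exists psi, Psi, (C * expR 5); split=> // s.
have /andP[-> h] := PC s; rewrite /=; apply: (le_trans h).
have C0 : 0 <= C.
  have := le_trans (fst (andP (PC 0))) (snd (andP (PC 0))).
  by rewrite pmulr_lge0 ?expR_gt0// pmulr_lge0// invr_gt0 ltr_wpDr ?sqr_ge0.
rewrite -!mulrA ler_wpM2l// mulrCA ler_wpM2l ?invr_ge0 ?addr_ge0 ?sqr_ge0//.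
rewrite -expRD ler_expR /eta mulrDl.
have := sqrt_decay (normr_ge0 s); lra.
Qed.

(** Take [1 + y^2 / 2 <= exp y] at [y = sqrt r / (N + 1)] and raise it to the power [N]: the
    exponent is [N / (N + 1)] times [sqrt r]. *)
Lemma poly_exp_sqrt (N : nat) (r : R) : 0 <= r ->
  (1 + r) ^+ N <= (2 * N.+1%:R ^+ 2) ^+ N * expR (Num.sqrt r).
Proof.
move=> r0; set x := Num.sqrt r; have x0 : 0 <= x by exact: sqrtr_ge0.
have x2 : x ^+ 2 = r by rewrite sqr_sqrtr.
have M0 : 0 < N.+1%:R :> R by [].
have h1 := expR_ge1Dxn 1 (divr_ge0 x0 (ltW M0)).
have h2 : 1 + r <= 2 * N.+1%:R ^+ 2 * expR (x / N.+1%:R).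
  apply: (@le_trans _ _ (2 * N.+1%:R ^+ 2 * (1 + (x / N.+1%:R) ^+ 2 / 2))).
    rewrite mulrDr mulr1 (_ : _ * (_ / _) = r); last by rewrite -x2; field; rewrite gt_eqF.
    rewrite lerD2r; have : 1 <= N.+1%:R ^+ 2 :> R by rewrite -natrX ler1n expn_gt0.
    lra.
  by rewrite ler_wpM2l// mulr_ge0// sqr_ge0.
apply: (@le_trans _ _ ((2 * N.+1%:R ^+ 2 * expR (x / N.+1%:R)) ^+ N)).
  by rewrite lerXn2r ?nnegrE ?addr_ge0// ltW// (lt_le_trans _ h2)// ltr_wpDr.
rewrite exprMn ler_wpM2l ?exprn_ge0 ?mulr_ge0 ?sqr_ge0//.
rewrite -expRM_natl ler_expR mulrCA -[leRHS]mulr1 ler_wpM2l// ler_pdivrMr// mul1r ler_nat//.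
Qed.

End ingham_sqrt.

(** * Products of one-dimensional Fourier pairs *)

Section euclidean.
Context (R : realType) (d : nat).
Implicit Types x y : 'rV[R]_d.

Lemma sum_sqr_le (f : 'I_d -> R) : (forall i, 0 <= f i) ->
  \sum_i f i ^+ 2 <= (\sum_i f i) ^+ 2.
Proof.
move=> f0; suff : 0 <= \sum_i f i /\ \sum_i f i ^+ 2 <= (\sum_i f i) ^+ 2 by case.
elim/big_rec2: _ => [|i y z _ [z0 yz]]; first by rewrite expr2 mul0r.
split; first by rewrite addr_ge0.
by have := mulr_ge0 (f0 i) z0; nra.
Qed.

Lemma enorm_ge0 x : 0 <= enorm x. Proof. exact: sqrtr_ge0. Qed.

Lemma enorm_sqr x : enorm x ^+ 2 = \sum_i x 0 i ^+ 2.
Proof.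
rewrite /enorm sqr_sqrtr; first by apply: eq_bigr => i _; rewrite expr2.
by apply: sumr_ge0 => i _; rewrite -expr2 sqr_ge0.
Qed.

Lemma enorm_le_sum x : enorm x <= \sum_i `|x 0 i|.
Proof.
rewrite -ler_sqr ?nnegrE ?enorm_ge0 ?sumr_ge0// enorm_sqr.
under eq_bigr do rewrite -real_normK ?num_real//.
exact: sum_sqr_le.
Qed.

Lemma coord_le_enorm x i : `|x 0 i| <= enorm x.
Proof.
rewrite -ler_sqr ?nnegrE ?enorm_ge0// enorm_sqr real_normK ?num_real//.
by rewrite (bigD1 i)//= lerDl sumr_ge0// => j _; rewrite sqr_ge0.
Qed.

(** Subadditivity of the square root: decay [exp(- 5 sqrt |xi_i|)] in each coordinate multiplies up
    to decay in the norm. *)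
Lemma sqrt_enorm_le x : Num.sqrt (enorm x) <= \sum_i Num.sqrt `|x 0 i|.
Proof.
rewrite -ler_sqr ?nnegrE ?sqrtr_ge0 ?sumr_ge0// ?sqr_sqrtr ?enorm_ge0//.
apply: le_trans (enorm_le_sum x) _.
apply: le_trans (sum_sqr_le _) => [|i]; last exact: sqrtr_ge0.
by apply: ler_sum => i _; rewrite sqr_sqrtr.
Qed.

Lemma dotv_le x y : `|dotv x y| <= (\sum_i `|x 0 i|) * enorm y.
Proof.
rewrite /dotv (le_trans (ler_norm_sum _ _ _))// mulr_suml; apply: ler_sum => i _.
by rewrite normrM ler_wpM2l// coord_le_enorm.
Qed.

Lemma dotvC x y : dotv x y = dotv y x.
Proof. by apply: eq_bigr => i _; rewrite mulrC. Qed.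

Lemma dotvDl x y z : dotv (x + y) z = dotv x z + dotv y z.
Proof. by rewrite /dotv -big_split; apply: eq_bigr => i _; rewrite mxE mulrDl. Qed.

Lemma dotvZl (a : R) x z : dotv (a *: x) z = a * dotv x z.
Proof. by rewrite /dotv mulr_sumr; apply: eq_bigr => i _; rewrite mxE mulrA. Qed.

Lemma dotvNl x z : dotv (- x) z = - dotv x z.
Proof. by rewrite -scaleN1r dotvZl mulN1r. Qed.

Lemma measurable_sqrt : measurable_fun [set: R] (@Num.sqrt R).
Proof. by apply: continuous_measurable_fun; exact: sqrt_continuous. Qed.

Lemma measurable_enorm : measurable_fun [set: Rd R d] (@enorm R d).
Proof.
apply: (measurableT_comp measurable_sqrt); apply: measurable_sum => i.
by apply: measurable_funM; exact: measurable_coord.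
Qed.

Lemma measurable_sqrt_enorm : measurable_fun [set: Rd R d] (fun x => Num.sqrt (@enorm R d x)).
Proof. exact: (measurableT_comp measurable_sqrt measurable_enorm). Qed.

End euclidean.

Section product_pair.
Context (R : realType) (d : nat).
Variable lam : {measure set (Rd R d) -> \bar R}.
Hypothesis lamP : is_lebesgue lam.
Local Notation mu := (@lebesgue_measure R).

Definition prodf (f : 'I_d -> R -> R) (x : 'rV[R]_d) : R := \prod_i f i (x 0 i).

Lemma integrable_prodf (f : 'I_d -> R -> R) :
  (forall i, mu.-integrable setT (EFin \o f i)) -> lam.-integrable setT (EFin \o prodf f).
Proof.
move=> fi.
have [i1 _] := lebesgue_product_formula lamP (f := f) (F := fun i => \int[mu]_t f i t) (xi := 0) fi
  (fun i c => ltac:(rewrite mxE; under eq_Rintegral do rewrite !mulr0 addr0;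
     rewrite RintegralZr// mulrC//)).
by [].
Qed.

Variables (iota L : R) (psi Psi : 'I_d -> R -> R).
Hypothesis fp : forall i, fourier_pair iota L (psi i) (Psi i).

Let ipsi i : mu.-integrable setT (EFin \o psi i).
Proof.
have [M psiM] := fp_bounded (fp i).
apply: (integrable_supported (M := M) (fp_measurable (fp i)) _ (fp_support (fp i))).
by move=> x; rewrite ger0_norm// (fp_ge0 (fp i)).
Qed.

Lemma prodf_integrable_ft : lam.-integrable setT (EFin \o prodf Psi).
Proof. by apply: integrable_prodf => i; exact: fp_integrable (fp i). Qed.

Lemma prodf_ft c xi :
  \int[lam]_x (prodf psi x * cos (c + 2 * pi * dotv x xi)) = cos c * prodf Psi xi.
Proof.
have [_ ->//] := lebesgue_product_formula lamP (f := psi) (F := fun i => Psi i (xi 0 i)) (xi := xi) ipsi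
  (fun i c => fp_ft (fp i) c _).
Qed.

Lemma prodf_inv c x :
  \int[lam]_xi (prodf Psi xi * cos (c + 2 * pi * dotv xi x)) = cos c * (iota ^+ d * prodf psi x).
Proof.
have [_ ->] := lebesgue_product_formula lamP (f := Psi) (F := fun i => iota * psi i (x 0 i)) (xi := x)
  (fun i => fp_integrable (fp i)) (fun i c => fp_inv (fp i) c _).
by rewrite big_split/= prodr_const card_ord.
Qed.

Definition cauchy_weight (xi : 'rV[R]_d) : R := prodf (fun _ s => (1 + s ^+ 2)^-1) xi.

Lemma integrable_cauchy_weight : lam.-integrable setT (EFin \o cauchy_weight).
Proof. by apply: integrable_prodf => i; exact: integrable_oneDsqrV. Qed.

Lemma cauchy_weight_ge0 xi : 0 <= cauchy_weight xi.
Proof. by apply: prodr_ge0 => i _; rewrite invr_ge0 addr_ge0 ?sqr_ge0. Qed.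

Lemma cauchy_weight_le1 xi : cauchy_weight xi <= 1.
Proof.
rewrite /cauchy_weight /prodf.
apply: (@le_trans _ _ (\prod_(i < d) (1 : R))); last by rewrite big1.
apply: ler_prod => i _; rewrite invr_ge0 addr_ge0 ?sqr_ge0//= invf_le1 ?ltr_wpDr ?sqr_ge0//.
by rewrite lerDl sqr_ge0.
Qed.

(** Since [th] decreases and [|xi_i| <= |xi| <= sum |xi_i|], the value [th |xi| * |xi|] is at most
    the sum of the [th |xi_i| * |xi_i|]: the one-dimensional exponents add up to at least the radial
    one. *)
Lemma prodf_decay (th : R -> R) (C : R) xi :
  (forall s, 0 <= s -> 0 <= th s) ->
  (forall s t, 0 <= s -> s <= t -> th t <= th s) ->
  (forall i s, 0 <= Psi i s <=
      C * ((1 + s ^+ 2)^-1 * expR (- (th `|s| * `|s|) - 5 * Num.sqrt `|s|))) ->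
  0 <= prodf Psi xi <= C ^+ d * (cauchy_weight xi *
     expR (- (th (enorm xi) * enorm xi) - 5 * Num.sqrt (enorm xi))).
Proof.
move=> th0 th_dec PsiC.
rewrite prodr_ge0/=; last by move=> i _; have /andP[] := PsiC i (xi 0 i).
apply: (@le_trans _ _ (\prod_(i < d) (C * ((1 + xi 0 i ^+ 2)^-1 *
    expR (- (th `|xi 0 i| * `|xi 0 i|) - 5 * Num.sqrt `|xi 0 i|))))).
  by apply: ler_prod => i _; exact: PsiC.
rewrite big_split/= prodr_const card_ord big_split/= -expR_sum.
have C0 : 0 <= C ^+ d.
  have [->|d0] := posnP d; first by rewrite expr0.
  apply: exprn_ge0; have i : 'I_d := Ordinal d0.
  have /andP[h0 h1] := PsiC i 0; have := le_trans h0 h1.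
  by rewrite pmulr_lge0// mulr_gt0 ?expR_gt0// invr_gt0 ltr_wpDr ?sqr_ge0.
rewrite ler_wpM2l// -/(cauchy_weight xi) ler_wpM2l ?cauchy_weight_ge0// ler_expR.
rewrite big_split/= sumrN sumrN -!mulr_sumr.
have h1 : th (enorm xi) * enorm xi <= \sum_i th `|xi 0 i| * `|xi 0 i|.
  apply: (le_trans (ler_wpM2l (th0 _ (enorm_ge0 _)) (enorm_le_sum xi))).
  rewrite mulr_sumr; apply: ler_sum => i _; rewrite ler_wpM2r//.
  by apply: th_dec => //; exact: coord_le_enorm.
have := sqrt_enorm_le xi; lra.
Qed.

End product_pair.

(** * Taylor estimates for the cosine *)

Section taylor.
Context (R : realType).

(** The j-th derivative of the cosine is written as a phase shift by [j * (pi / 2)]; differentiating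
    in [s] then replaces [a] by [a + pi / 2] and lowers [m]. *)
Definition cos_taylor (m : nat) (a s : R) : R :=
  \sum_(j < m) cos (a + j%:R * (pi / 2)) * s ^+ j / j`!%:R.

Lemma is_derive_cos_shift (a x : R) :
  is_derive x 1 (fun y : R => cos (a + y)) (cos (a + pi / 2 + x)).
Proof.
have h1 : is_derive x 1 (fun t : R => a + t) 1 by apply: is_derive_eq; rewrite add0r mulr1.
have h2 := @is_derive1_comp R (@cos R) (fun t => a + t) x _ _ (is_derive_cos _) h1.
by apply: (is_derive_eq h2); rewrite mulr1 addrAC cosDpihalf.
Qed.

Lemma is_derive_monomial (m : nat) (c x : R) :
  is_derive x 1 (fun y : R => c * y ^+ m.+1 / m.+1`!%:R) (c * x ^+ m / m`!%:R).
Proof.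
have h := is_deriveX m.+1 (is_derive_id x (1 : R)).
have := is_deriveZ (c / m.+1`!%:R) h.
rewrite (_ : (_ \*: _) = fun y : R => c * y ^+ m.+1 / m.+1`!%:R); last first.
  by apply/funext => y; rewrite /= /GRing.scale/= exprfctE mulrAC.
move=> h'; apply: (is_derive_eq h').
rewrite /GRing.scale/= mulr1 -mulr_natr factS natrM.
by field; rewrite nat1r !pnatr_eq0 -!lt0n fact_gt0.
Qed.

Lemma is_derive_cos_taylor (m : nat) (a x : R) :
  is_derive x 1 (cos_taylor m.+1 a) (cos_taylor m (a + pi / 2) x).
Proof.
elim: m => [|m IH].
  rewrite /cos_taylor big_ord0 (_ : (fun _ => _) = cst (cos (a + 0 * (pi / 2)))).
    exact: is_derive_cst.
  by apply/funext => y; rewrite big_ord1 expr0 mulr1 fact0 divr1.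
rewrite (_ : cos_taylor m.+2 a = cos_taylor m.+1 a +
    (fun y : R => cos (a + m.+1%:R * (pi / 2)) * y ^+ m.+1 / m.+1`!%:R)); last first.
  by apply/funext => y; rewrite {1}/cos_taylor big_ord_recr.
apply: (is_derive_eq (is_deriveD IH (is_derive_monomial m (cos (a + m.+1%:R * (pi / 2))) x))).
rewrite [RHS]/cos_taylor big_ord_recr /=; congr (_ + cos _ * _ / _).
by rewrite -natr1; ring.
Qed.

Lemma cos_taylor0 (m : nat) (a : R) : cos_taylor m.+1 a 0 = cos a.
Proof.
rewrite /cos_taylor big_ord_recl big1 ?addr0; last by move=> i _; rewrite exprS mul0r mulr0 mul0r.
by rewrite mul0r addr0 expr0 fact0 mulr1 divr1.
Qed.

(** Induction on [m]: for each sign [e], the bound minus [e] times the error vanishes at 0, and its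
    derivative is the same expression one order lower at the phase [a + pi / 2], hence
    nonnegative. *)
Lemma cos_taylor_ge0 (m : nat) (a s : R) : 0 <= s ->
  `|cos (a + s) - cos_taylor m a s| <= s ^+ m / m`!%:R.
Proof.
elim: m a s => [|m IH] a s s0.
  by rewrite /cos_taylor big_ord0 subr0 expr0 fact0 divr1 cos_max.
have key (e : R) : `|e| = 1 ->
    0 <= s ^+ m.+1 / m.+1`!%:R - e * (cos (a + s) - cos_taylor m.+1 a s).
  move=> e1.
  pose g := fun x : R => 1 * x ^+ m.+1 / m.+1`!%:R - e * (cos (a + x) - cos_taylor m.+1 a x).
  pose g' := fun x : R => 1 * x ^+ m / m`!%:R - e * (cos (a + pi / 2 + x) - cos_taylor m (a + pi / 2) x).
  have dg (x : R) : is_derive x 1 g (g' x).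
    exact: (is_deriveB (is_derive_monomial m 1 x) (is_deriveZ e (is_deriveB (is_derive_cos_shift a x) (is_derive_cos_taylor m a x)))).
  have cg : {within `[0, s], continuous g}.
    apply: continuous_subspaceT => x; apply: differentiable_continuous.
    by apply/derivable1_diffP; exact: ex_derive.
  have [c] := @MVT_segment R g g' 0 s s0 (fun x _ => dg x) cg.
  rewrite in_itv/= subr0 => /andP[c0 cs] gs.
  have g0 : g 0 = 0 by rewrite /g expr0n/= mulr0 mul0r addr0 cos_taylor0 subrr mulr0 subrr.
  move: gs; rewrite g0 subr0 {1}/g mul1r => ->.
  rewrite mulr_ge0// /g' mul1r subr_ge0.
  by rewrite (le_trans (ler_norm _))// normrM e1 mul1r IH.
have := key 1 (normr1 _); have := key (-1) (normrN1 _).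
by rewrite ler_norml; lra.
Qed.

Lemma cos_taylorN (m : nat) (a s : R) : cos_taylor m a (- s) = cos_taylor m (- a) s.
Proof.
apply: eq_bigr => j _; rewrite exprNn (mulrA (cos _)); congr (_ * _ / _).
have -> : a + j%:R * (pi / 2) = - (- a + j%:R * (pi / 2)) + pi *+ j.
  by rewrite -mulr_natl; field.
by rewrite (alternatingn (@cosDpi R)) mulrAC -exprMn mulrN1 opprK expr1n mul1r cosN.
Qed.

Lemma cos_taylor_le (m : nat) (a s : R) :
  `|cos (a + s) - cos_taylor m a s| <= `|s| ^+ m / m`!%:R.
Proof.
have [s0|s0] := leP 0 s; first by rewrite (ger0_norm s0); exact: cos_taylor_ge0.
have ns0 : 0 <= - s by rewrite oppr_ge0 ltW.
have := cos_taylor_ge0 m (- a) ns0.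
by rewrite -cos_taylorN opprK -opprD cosN (ltr0_norm s0).
Qed.

End taylor.

Lemma differentiable_quadratic (R : realType) (V W : normedModType R)
    (f : V -> W) (df : {linear V -> W}) (x : V) (C : R) :
  continuous df -> (forall h, `|f (h + x) - f x - df h| <= C * `|h| ^+ 2) ->
  differentiable f x /\ 'd f x = df :> (V -> W).
Proof.
move=> cdf fC.
have C0 : 0 < Num.max C 1 by rewrite lt_max ltr01 orbT.
have e : f \o shift x = cst (f x) + df +o_ 0 id.
  apply/eqaddoP => _/posnumP[eps]; near=> h.
  rewrite !fctE /= opprD addrA (le_trans (fC h))// expr2 mulrA ler_wpM2r//.
  apply: (@le_trans _ _ (Num.max C 1 * `|h|)); first by rewrite ler_wpM2r// le_max lexx.
  rewrite mulrC -ler_pdivlMr//; near: h.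
  by apply: nbhs0_le; rewrite divr_gt0.
have dE := diff_unique cdf e; split=> //.
by apply/diff_locallyP; rewrite dE.
Unshelve. all: by end_near. Qed.

(** * Smoothness of inverse transforms *)

Section wave.
Context (R : realType) (d : nat).
Local Notation V := 'rV[R]_d.
Variable lam : {measure set (Rd R d) -> \bar R}.

(** With [rapid] weights this family is closed under directional derivatives: ['D_v] multiplies the
    weight by [2 * pi * dotv xi v] and adds [pi / 2] to the phase. Smoothness thus reduces to
    first-order differentiability of all its members. *)
Definition wave (w : V -> R) (c : R) (x : V) : R :=
  \int[lam]_xi (w xi * cos (c + 2 * pi * dotv xi x)).

Definition rapid (w : V -> R) : Prop := measurable_fun [set: Rd R d] w /\
  forall n, lam.-integrable setT (EFin \o (fun xi => `|w xi| * (1 + enorm xi) ^+ n)).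

Lemma sum_coord_le_norm (h : V) : \sum_i `|h 0 i| <= d%:R * `|h|.
Proof.
apply: (@le_trans _ _ (\sum_(i < d) `|h|)); last by rewrite sumr_const card_ord mulr_natl.
apply: ler_sum => i _; have -> : `|h| = mx_norm h by [].
by rewrite mx_normrE; exact: (le_bigmax _ (fun ij : 'I_1 * 'I_d => `|h ij.1 ij.2|) (ord0, i)).
Qed.

Lemma normr_phase_le (xi h : V) :
  `|2 * pi * dotv xi h| <= 2 * pi * d%:R * `|h| * (1 + enorm xi).
Proof.
have p0 := @pi_gt0 R.
rewrite normrM ger0_norm ?mulr_ge0 ?(ltW p0)// -!mulrA ler_pM2l// ler_pM2l// mulrA dotvC.
apply: (le_trans (dotv_le _ _)); apply: ler_pM => //; rewrite ?sumr_ge0 ?enorm_ge0//.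
  exact: sum_coord_le_norm.
by rewrite lerDr.
Qed.

Lemma measurable_phase (c : R) (x : V) :
  measurable_fun [set: Rd R d] (fun xi : V => cos (c + 2 * pi * dotv xi x)).
Proof.
apply: measurable_cos_comp; apply: measurable_funD => //.
by apply: measurable_funM => //; exact: measurable_dotv.
Qed.

Lemma rapid_integrable w : rapid w -> lam.-integrable setT (EFin \o w).
Proof.
move=> [mw /(_ 0%N) iw]; apply: (integrable_le mw iw) => xi.
by rewrite expr0 mulr1.
Qed.

Lemma rapid_phase w v : rapid w -> rapid (fun xi => w xi * (2 * pi * dotv xi v)).
Proof.
move=> [mw iw]; have mv : measurable_fun [set: Rd R d] (fun xi : V => w xi * (2 * pi * dotv xi v)).
  by apply: measurable_funM => //; apply: measurable_funM => //; exact: measurable_dotv.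
have me n : measurable_fun [set: Rd R d] (fun xi : V => (1 + enorm xi) ^+ n).
  by apply: measurable_funX; apply: measurable_funD => //; exact: measurable_enorm.
split=> // n; apply: (integrable_le _ (integrable_Zl (2 * pi * d%:R * `|v|) (iw n.+1))).
  by apply: measurable_funM => //; exact: measurableT_comp.
move=> xi; have e0 : 0 <= 1 + enorm xi by rewrite addr_ge0// enorm_ge0.
rewrite normrM normr_id [X in _ * X <= _]ger0_norm ?exprn_ge0// normrM.
rewrite (_ : _ * (`|w xi| * _) = `|w xi| * (2 * pi * d%:R * `|v| * (1 + enorm xi)) * (1 + enorm xi) ^+ n).
  by rewrite ler_wpM2r ?exprn_ge0// ler_wpM2l// normr_phase_le.
by rewrite exprS; ring.
Qed.

(** Integrating the second-order Taylor bound of the cosine against [w] leaves a remainder quadratic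
    in [h], with the second moment of [w] in the constant. *)
Lemma wave_diff w c x : rapid w -> differentiable (wave w c) x /\
  forall v, 'D_v (wave w c) x = wave (fun xi => w xi * (2 * pi * dotv xi v)) (c + pi / 2) x.
Proof.
move=> rw; pose df v := wave (fun xi => w xi * (2 * pi * dotv xi v)) (c + pi / 2) x.
have iw := rapid_integrable rw.
have iwc (c' : R) y : lam.-integrable setT (EFin \o (fun xi => w xi * cos (c' + 2 * pi * dotv xi y))).
  apply: (integrable_mulbdd (c := 1) iw); first exact: measurable_phase.
  by move=> xi; exact: cos_max.
have idf v : lam.-integrable setT (EFin \o (fun xi => w xi * (2 * pi * dotv xi v) * cos (c + pi / 2 + 2 * pi * dotv xi x))).
  apply: (integrable_mulbdd (c := 1) (rapid_integrable (rapid_phase v rw))); first exact: measurable_phase.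
  by move=> xi; exact: cos_max.
have dflin : linear df.
  move=> a u v; rewrite /df /wave /= /GRing.scale/= -RintegralZl// -RintegralD//; last exact: integrable_Zl.
  by apply: eq_Rintegral => xi _; rewrite !(dotvC xi) dotvDl dotvZl; ring.
pose dfM := GRing.isLinear.Build _ _ _ _ _ dflin.
pose dfL : {linear V -> R} := HB.pack df dfM.
have i1 := rw.2 1%N; have i2 := rw.2 2%N.
have cdf : continuous dfL.
  apply/bounded_linear_continuous/linear_boundedP.
  near=> r => v; rewrite /= /df /wave.
  apply: (@le_trans _ _ ((2 * pi * d%:R * \int[lam]_xi (`|w xi| * (1 + enorm xi) ^+ 1)) * `|v|)).
    rewrite mulrAC -RintegralZl//; apply: normr_Rintegral_le => //; first exact: integrable_Zl.
    move=> xi; rewrite normrM (le_trans (ler_piMr _ (cos_max _)))// normrM expr1 mulrCA.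
    by rewrite ler_wpM2l// normr_phase_le.
  by rewrite ler_wpM2r//; near: r; apply: nbhs_pinfty_ge; rewrite num_real.
pose C := (2 * pi * d%:R) ^+ 2 * \int[lam]_xi (`|w xi| * (1 + enorm xi) ^+ 2).
have key h : `|wave w c (h + x) - wave w c x - dfL h| <= C * `|h| ^+ 2.
  rewrite /= /df /wave -RintegralB// -RintegralB//; last exact: (integrableB measurableT (iwc _ _) (iwc _ _)).
  rewrite /C mulrAC -exprMn -RintegralZl//; apply: normr_Rintegral_le.
  - exact: (integrableB measurableT (integrableB measurableT (iwc _ _) (iwc _ _)) (idf _)).
  - exact: integrable_Zl.
  move=> xi; set a := c + 2 * pi * dotv xi x; set s := 2 * pi * dotv xi h.
  have -> : c + 2 * pi * dotv xi (h + x) = a + s by rewrite dotvC dotvDl !(dotvC _ xi) /a /s; ring.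
  have -> : c + pi / 2 + 2 * pi * dotv xi x = a + pi / 2 by rewrite /a; ring.
  rewrite -mulrBr -mulrA -mulrBr normrM mulrCA ler_wpM2l//.
  have := cos_taylor_le 2 a s; rewrite /cos_taylor 2!big_ord_recl big_ord0 /=.
  rewrite !mul0r addr0 mul1r expr0 expr1 fact0 !divr1 mulr1 addr0 /bump/= => h1.
  rewrite (mulrC s) -addrA -opprD; apply: (le_trans h1); rewrite -exprMn.
  have f2 : 1 <= 2`!%:R :> R by rewrite ler1n.
  apply: (@le_trans _ _ (`|s| ^+ 2)); first by rewrite ler_pdivrMr ?(lt_le_trans _ f2)// ler_peMr.
  by rewrite lerXn2r ?nnegrE//; [exact: le_trans (normr_phase_le _ _)|exact: normr_phase_le].
have [df1 df2] := differentiable_quadratic cdf key.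
by split=> // v; rewrite deriveE// df2.
Unshelve. all: by end_near. Qed.

Lemma iter_dir_wave (vs : seq V) w c : rapid w ->
  exists w' c', rapid w' /\ iter_dir vs (wave w c) = wave w' c'.
Proof.
move=> rw; elim: vs => [|v vs [w' [c' [rw' e]]]]; first by exists w, c.
exists (fun xi => w' xi * (2 * pi * dotv xi v)), (c' + pi / 2); split; first exact: rapid_phase.
by apply/funext => x /=; rewrite e; have [_ ->] := wave_diff c' x rw'.
Qed.

Lemma smooth_wave w c : rapid w -> smooth (wave w c).
Proof.
move=> rw vs x; have [w' [c' [rw' ->]]] := iter_dir_wave vs c rw.
by have [] := wave_diff c' x rw'.
Qed.

End wave.

(** * The integral [I] as a series *)

Section radial.
Context (R : realType) (d : nat).
Local Notation V := 'rV[R]_d.+1.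
Variable theta : V -> R.
Hypothesis theta0 : forall xi, 0 <= theta xi.
Hypothesis theta_rad : radially_decreasing theta.
Hypothesis theta_van : vanishes_at_infinity theta.

Definition axis (r : R) : V := \row_i (if i == ord0 then r else 0).

Lemma enorm_axis (r : R) : 0 <= r -> enorm (axis r) = r.
Proof.
move=> r0; apply/eqP; rewrite -(eqrXn2 (n := 2)) ?enorm_ge0// enorm_sqr big_ord_recl mxE eqxx.
by rewrite big1 ?addr0// => i _; rewrite mxE /= expr0n.
Qed.

(** [theta] read along the first coordinate axis, which exists because the dimension is [d.+1]. *)
Definition profile (r : R) : R := theta (axis r).

Lemma profileE x : theta x = profile (enorm x).
Proof. by apply: theta_rad.1; rewrite enorm_axis// enorm_ge0. Qed.

Lemma profile_ge0 r : 0 <= profile r. Proof. exact: theta0. Qed.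

Lemma profile_dec s t : 0 <= s -> s <= t -> profile t <= profile s.
Proof.
by move=> s0 st; apply: theta_rad.2; rewrite !enorm_axis// (le_trans s0 st).
Qed.

Lemma profile_half : exists s1, forall s, s1 <= s -> profile s <= 2^-1.
Proof.
have h2 : (0 : R) < 2^-1 by [].
have [M hM] := theta_van h2.
exists (Num.max M 0) => s; rewrite ge_max => /andP[sM s0].
by apply: (le_trans (ler_norm _)); apply: hM; rewrite enorm_axis.
Qed.

End radial.

(** * Finiteness of the integral bounds the series *)

Section Iint_bounds.
Context (R : realType) (d : nat).
Local Notation V := 'rV[R]_d.+1.
Variable lam : {measure set (Rd R d.+1) -> \bar R}.
Hypothesis lamP : is_lebesgue lam.
Variables (theta : V -> R) (th : R -> R).
Hypothesis mtheta : measurable_fun [set: Rd R d.+1] theta.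
Hypothesis thE : forall x, theta x = th (enorm x).
Hypothesis th0 : forall r, 0 <= th r.
Hypothesis th_dec : forall s t, 0 <= s -> s <= t -> th t <= th s.

Let D : set V := [set xi : V | 1 <= enorm xi].

Let mD : measurable (D : set (Rd R d.+1)).
Proof.
rewrite (_ : D = @enorm R d.+1 @^-1` `[1, +oo[%classic).
  by rewrite -[X in measurable X]setTI; apply: (@measurable_enorm R d.+1) => //; exact: measurable_itv.
by apply/seteqP; split=> x /=; rewrite in_itv/= andbT.
Qed.

Let f (xi : V) : R := theta xi / enorm xi ^+ d.+1.

Let mf : measurable_fun [set: Rd R d.+1] f.
Proof.
apply: measurable_funM => //.
apply: (measurableT_comp (@measurable_invr R)); apply: measurable_funX.
exact: measurable_enorm.
Qed.

Let IintE : Iint lam theta = (\int[lam]_xi ((\1_D xi * f xi)%R)%:E)%E.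
Proof.
rewrite /Iint integral_mkcond; apply: eq_integral => x _.
rewrite patchE indicE; case: ifP; rewrite ?mul1r ?mul0r//.
Qed.

Let f0 xi : 0 <= f xi.
Proof. by rewrite divr_ge0 ?exprn_ge0 ?enorm_ge0// thE. Qed.

(** Boxes of volume of order [k^d] along the first axis. Dividing by [d.+1] makes the sum of the
    coordinates, hence the norm, at most [k + 1/2]; the first coordinate covers only half a unit
    (before this division), so distinct slabs are disjoint. *)
Let slab (k : nat) : set V :=
  cbox (\row_i (if i == ord0 then k%:R / d.+1%:R else - (k%:R / d.+1%:R)))
       (\row_i (if i == ord0 then (k%:R + 2^-1) / d.+1%:R else k%:R / d.+1%:R)).

Let slab_vol (k : nat) :
  lam (slab k) = ((2 * d.+1%:R)^-1 * (2 * k%:R / d.+1%:R) ^+ d)%:E.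
Proof.
have n0 : (0 : R) < d.+1%:R by [].
have k0 : (0 : R) <= k%:R / d.+1%:R by rewrite divr_ge0.
rewrite (lebesgue_cbox lamP); last first.
  move=> i; rewrite !mxE; case: ifP => _; last by rewrite (le_trans _ k0)// oppr_le0.
  by rewrite ler_pM2r ?invr_gt0// lerDl.
rewrite big_ord_recl !mxE eqxx; congr (EFin (_ * _)); first by field; rewrite gt_eqF.
rewrite (eq_bigr (fun=> 2 * k%:R / d.+1%:R)) ?prodr_const ?card_ord//.
by move=> i _; rewrite !mxE /=; ring.
Qed.

Let slab_le (k : nat) (xi : V) : (d.+1 <= k)%N -> slab k xi ->
  th k.+1%:R / k.+1%:R ^+ d.+1 <= \1_D xi * f xi.
Proof.
move=> dk h; have n0 : (0 : R) < d.+1%:R by [].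
have k1 : 1 <= k%:R / d.+1%:R :> R by rewrite ler_pdivlMr// mul1r ler_nat.
have h0 : k%:R / d.+1%:R <= xi 0 ord0 <= (k%:R + 2^-1) / d.+1%:R.
  by have := h ord0; rewrite !mxE eqxx.
have hi i : `|xi 0 i| <= (k%:R + 2^-1) / d.+1%:R.
  have kk : k%:R / d.+1%:R <= (k%:R + 2^-1) / d.+1%:R :> R by rewrite ler_pM2r ?invr_gt0// lerDl.
  have := h i; rewrite !mxE; case: ifP => _ hh.
    by case/andP: hh => ha hb; rewrite ger0_norm// (le_trans _ ha)// divr_ge0.
  by rewrite (le_trans _ kk)// ler_norml.
have e1 : 1 <= enorm xi.
  apply: le_trans (coord_le_enorm xi ord0); apply: le_trans (ler_norm _).
  by case/andP: h0 => h0 _; exact: le_trans h0.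
have e2 : enorm xi <= k.+1%:R.
  apply: (le_trans (enorm_le_sum xi)).
  apply: (@le_trans _ _ (\sum_(i < d.+1) (k%:R + 2^-1) / d.+1%:R)); first exact: ler_sum.
  rewrite sumr_const card_ord -[leLHS]mulr_natr divfK ?gt_eqF// -[leRHS]natr1; lra.
have ep : 0 < enorm xi by lra.
rewrite indicE mem_set// mul1r /f thE; apply: ler_pM => //.
- by apply: th_dec => //; exact: ltW.
- by rewrite lef_pV2 ?posrE ?exprn_gt0// lerXn2r ?nnegrE// ltW.
Qed.

Let slab_disj (j k : nat) (xi : V) : slab j xi -> slab k xi -> j = k.
Proof.
have n0 : (0 : R) < d.+1%:R by [].
have aux (a b : nat) : slab a xi -> slab b xi -> (a <= b)%N.
  move=> /(_ ord0) + /(_ ord0); rewrite !mxE eqxx => /andP[h1 _] /andP[_ h2].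
  have := le_trans h1 h2; rewrite ler_pM2r ?invr_gt0// => ab.
  by rewrite -ltnS -(ltr_nat R) -natr1; lra.
by move=> hj hk; apply/eqP; rewrite eqn_leq !aux.
Qed.

Lemma Iint_lty_sum : (Iint lam theta < +oo)%E ->
  exists S, forall n, \sum_(k < n) th k.+1%:R / k.+1%:R <= S.
Proof.
move=> Ioo; have n0 : (0 : R) < d.+1%:R by [].
pose c k := th k.+1%:R / k.+1%:R ^+ d.+1.
have c0 k : 0 <= c k by rewrite divr_ge0 ?exprn_ge0.
have mg : measurable_fun [set: Rd R d.+1] (fun xi : V => \1_D xi * f xi).
  by apply: measurable_funM => //; exact: measurable_indic.
have g0 xi : 0 <= \1_D xi * f xi by rewrite mulr_ge0// indicE.
have ig : lam.-integrable setT (EFin \o (fun xi : V => \1_D xi * f xi)).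
  by apply: integrable_ge0_lty => //; rewrite -IintE.
have ms k : measurable (slab k : set (Rd R d.+1)) by exact: measurable_cbox.
have is_ k : lam.-integrable setT (EFin \o (fun xi : V => \1_(slab k) xi)).
  apply: integrable_ge0_lty; [exact: measurable_indic|by move=> x; rewrite indicE|].
  by rewrite (integral_indic _ measurableT (ms k)) setIT slab_vol ltry.
(* From index [d.+1] on, the slabs lie outside the open unit ball. *)
pose N := d.+1.
have bound n : \sum_(k < n) c (N + k)%N * fine (lam (slab (N + k)%N)) <= \int[lam]_xi (\1_D xi * f xi).
  apply: (@le_trans _ _ (\int[lam]_xi (\sum_(k < n) c (N + k)%N * \1_(slab (N + k)%N) xi))).
    rewrite (Rintegral_sum_seq _ (fun k : 'I_n => integrable_Zl (c (N + k)%N) (is_ (N + k)%N))).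
    apply: ler_sum => k _; rewrite RintegralZl//.
    by rewrite /Rintegral (integral_indic _ measurableT (ms _)) setIT.
  apply: le_Rintegral => //.
    exact: (integrable_sum_seq _ (fun k : 'I_n => integrable_Zl (c (N + k)%N) (is_ (N + k)%N))).
  move=> xi _.
  have [[k hk]|hn] := pselect (exists k : 'I_n, slab (N + k)%N xi).
    rewrite (bigD1 k)//= big1 ?addr0; last first.
      move=> j jk; rewrite indicE memNset ?mulr0// => hj.
      by move/eqP: jk; apply; apply/val_inj/(@addnI N); exact: slab_disj hj hk.
    rewrite [\1_(slab _) _]indicE mem_set// mulr1; apply: slab_le => //; exact: leq_addr.
  rewrite big1// => k _; rewrite indicE memNset ?mulr0// => hk.
  by apply: hn; exists k.
(* The constant left when [2 * k] is replaced by [k + 1] in the volume of the slab. *)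
pose q : R := 2^-1 * d.+1%:R ^- d.+1.
have q0 : 0 < q by rewrite mulr_gt0 ?invr_gt0 ?exprn_gt0.
have cq k : (0 < k)%N -> q * (th k.+1%:R / k.+1%:R) <= c k * fine (lam (slab k)).
  move=> k0; rewrite slab_vol /=.
  have hk : k.+1%:R <= 2 * k%:R :> R by rewrite -natrM ler_nat; lia.
  have h1 : (k.+1%:R / d.+1%:R) ^+ d <= (2 * k%:R / d.+1%:R) ^+ d :> R.
    by rewrite lerXn2r ?nnegrE ?divr_ge0 ?mulr_ge0// ler_pM2r ?invr_gt0.
  apply: (@le_trans _ _ (c k * ((2 * d.+1%:R)^-1 * (k.+1%:R / d.+1%:R) ^+ d))); last first.
    by rewrite ler_wpM2l// ler_wpM2l// invr_ge0 mulr_ge0.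
  rewrite le_eqVlt; apply/orP; left; apply/eqP; rewrite /q /c expr_div_n !exprS.
  by field; rewrite ?expf_neq0 ?pnatr_eq0// !gt_eqF.
exists (\sum_(k < N) th k.+1%:R / k.+1%:R + q^-1 * \int[lam]_xi (\1_D xi * f xi)) => n.
apply: (@le_trans _ _ (\sum_(k < N + n) th k.+1%:R / k.+1%:R)).
  rewrite addnC big_split_ord/= lerDl sumr_ge0// => k _; exact: divr_ge0.
rewrite big_split_ord/= lerD2l ler_pdivlMl// mulr_sumr.
apply: (le_trans _ (bound n)); apply: ler_sum => k _; exact: cq.
Qed.

End Iint_bounds.

(** * Boundedness of the series sampled at fourth powers bounds the integral *)

Section Iint_upper.
Context (R : realType) (d : nat).
Local Notation V := 'rV[R]_d.+1.
Variable lam : {measure set (Rd R d.+1) -> \bar R}.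
Hypothesis lamP : is_lebesgue lam.
Variables (theta : V -> R) (th : R -> R).
Hypothesis mtheta : measurable_fun [set: Rd R d.+1] theta.
Hypothesis thE : forall x, theta x = th (enorm x).
Hypothesis th0 : forall r, 0 <= th r.
Hypothesis th_dec : forall s t, 0 <= s -> s <= t -> th t <= th s.

Lemma in_cube (r : R) (x : V) : cube r x <-> forall i, `|x 0 i| <= r.
Proof.
by split=> h i; have := h i; rewrite !mxE ler_norml.
Qed.

Lemma cube_volume (r : R) : 0 <= r -> lam (cube r) = ((2 * r) ^+ d.+1)%:E.
Proof.
move=> r0; rewrite (lebesgue_cbox lamP); last by move=> i; rewrite !mxE; lra.
rewrite (eq_bigr (fun=> 2 * r)) ?prodr_const ?card_ord//.
by move=> i _; rewrite !mxE; ring.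
Qed.

Lemma expr_diff_le (a b : R) n : 0 <= b -> b <= a ->
  a ^+ n.+1 - b ^+ n.+1 <= n.+1%:R * a ^+ n * (a - b).
Proof.
move=> b0 ba; have a0 := le_trans b0 ba.
rewrite subrXX mulrC ler_wpM2r ?subr_ge0//.
apply: (@le_trans _ _ (\sum_(i < n.+1) a ^+ n)); last by rewrite sumr_const card_ord mulr_natl.
apply: ler_sum => i _; have ni : (n - i + i = n)%N by rewrite subnK// -ltnS.
rewrite -[leRHS](_ : a ^+ (n - i) * a ^+ i = _); last by rewrite -exprD ni.
by rewrite ler_wpM2l ?exprn_ge0// lerXn2r ?nnegrE.
Qed.

(** Cubes, because [is_lebesgue] gives their volume directly. Relative to the inner half-side to the
    power [d.+1], the volume is of order [1 / (k + 1)], like the increment of [log (k^4)]. *)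
Let shell (k : nat) : set V := cube (k.+2%:R ^+ 4) `\` cube (k.+1%:R ^+ 4).

(** With [B = (k+1)^4] and [A = (k+2)^4]: the factor 16 comes from [A <= 16 B], and
    [15 = 4 + 6 + 4 + 1] from expanding [A - B]. *)
Let K : R := 2 ^+ d.+1 * (d.+1%:R * (16 ^+ d * 15)).

Let shell_vol (k : nat) : (lam (shell k) <= (K * (k.+1%:R ^+ 4) ^+ d.+1 / k.+1%:R)%:E)%E.
Proof.
set A : R := k.+2%:R ^+ 4; set B : R := k.+1%:R ^+ 4.
have B0 : 0 <= B by rewrite exprn_ge0.
have AB : B <= A by rewrite lerXn2r ?nnegrE// ler_nat.
have A0 := le_trans B0 AB.
have sub : (cube B : set V) `<=` cube A.
  by move=> x hx; apply: (in_cube _ _).2 => i; exact: le_trans ((in_cube _ _).1 hx i) AB.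
have -> : (lam (shell k) = lam (cube A) - lam (cube B))%E.
  rewrite measureD; [|exact: measurable_cbox|exact: measurable_cbox|exact: lebesgue_cbox_lty].
  by rewrite setIidr.
rewrite !cube_volume// -EFinB lee_fin (exprMn d.+1 2 A) (exprMn d.+1 2 B) -mulrBr /K -!mulrA.
rewrite ler_pM2l ?exprn_gt0//; apply: (le_trans (expr_diff_le _ B0 AB)).
rewrite -!mulrA ler_pM2l// exprS.
have k0 : (0 : R) < k.+1%:R by [].
have A16 : A <= 16 * B.
  have -> : 16 * B = (2 * k.+1%:R) ^+ 4 by rewrite /B exprMn; ring.
  by rewrite lerXn2r ?nnegrE ?mulr_ge0// -natrM ler_nat; lia.
have ABd : A - B <= 15 * (B / k.+1%:R).
  have -> : B / k.+1%:R = k.+1%:R ^+ 3 by rewrite /B; field; rewrite gt_eqF.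
  have x1 : (1 : R) <= k.+1%:R by rewrite ler1n.
  rewrite /A /B -natr1; set x : R := k.+1%:R in x1 *.
  have -> : (x + 1) ^+ 4 - x ^+ 4 = 4 * x ^+ 3 + 6 * x ^+ 2 + 4 * x + 1 by ring.
  have h1 : x <= x ^+ 2 by rewrite expr2 ler_peMr// (le_trans _ x1).
  have h2 : x ^+ 2 <= x ^+ 3 by rewrite [leRHS]exprS ler_peMl// exprn_ge0// (le_trans _ x1).
  lra.
apply: (@le_trans _ _ ((16 * B) ^+ d * (15 * (B / k.+1%:R)))); last first.
  by rewrite exprMn le_eqVlt; apply/orP; left; apply/eqP; field; rewrite gt_eqF.
by apply: ler_pM; rewrite ?exprn_ge0 ?subr_ge0// lerXn2r ?nnegrE ?mulr_ge0.
Qed.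

Let D : set V := [set xi : V | 1 <= enorm xi].

Let c (k : nat) : R := th (k.+1%:R ^+ 4) / (k.+1%:R ^+ 4) ^+ d.+1.

Let c0 k : 0 <= c k. Proof. by rewrite divr_ge0 ?exprn_ge0. Qed.

Let pointwise (xi : V) : (((theta xi / enorm xi ^+ d.+1)%:E * (\1_D xi)%:E) <=
  (th 1 * \1_(cube 1) xi)%:E + \sum_(k <oo) (c k * \1_(shell k) xi)%:E)%E.
Proof.
have s0 : (0 <= \sum_(k <oo) (c k * \1_(shell k) xi)%:E)%E.
  by apply: nneseries_ge0 => k _ _; rewrite lee_fin mulr_ge0// indicE.
have [xiD|xiD] := pselect (D xi); last first.
  rewrite indicE memNset// mule0 adde_ge0// lee_fin mulr_ge0// indicE//.
rewrite [\1_D _]indicE mem_set// mule1.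
have ep : 0 < enorm xi by exact: lt_le_trans xiD.
have [h1|h1] := pselect (cube 1 xi).
  rewrite [\1_(cube _) _]indicE mem_set// mulr1.
  apply: le_trans (leeDl _ s0).
  rewrite lee_fin thE ler_pdivrMr ?exprn_gt0//.
  apply: (@le_trans _ _ (th 1)); first exact: th_dec.
  by rewrite ler_peMr// exprn_ege1.
apply: (@le_trans _ _ (\sum_(k <oo) (c k * \1_(shell k) xi)%:E)%E); last first.
  by rewrite leeDr// lee_fin mulr_ge0// indicE.
have [k hk] : exists k, shell k xi.
  (* The least such [m] is [k + 2] for some [k], since [xi] lies outside the cube of half-side 1. *)
  pose P m := `[< cube (m%:R ^+ 4) xi >].
  have exP : exists m, P m.
    exists (Num.truncn (enorm xi)).+1; apply/asboolP; apply: (in_cube _ _).2 => i.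
    apply: (le_trans (coord_le_enorm xi i)); apply: (le_trans (ltW (truncnS_gt _))).
    by rewrite exprS ler_peMr// exprn_ege1// ler1n.
  have /asboolP := ex_minnP exP; case: (ex_minnP exP) => m Pm mmin.
  case: m Pm mmin => [|[|k]] /asboolP Pm mmin _.
  - have : `|xi 0 ord0| <= 1.
      by move/(in_cube _ _).1/(_ ord0) : Pm; rewrite expr0n/= => /le_trans; apply.
    exfalso; apply: h1; apply: (in_cube _ _).2 => i.
    by move/(in_cube _ _).1/(_ i) : Pm; rewrite expr0n/= => /le_trans; apply.
  - by exfalso; apply: h1; move: Pm; rewrite expr1n.
  - exists k; split=> // hk; have /mmin : P k.+1 by apply/asboolP.
    by rewrite ltnn.
apply: (@le_trans _ _ (c k * \1_(shell k) xi)%:E).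
  rewrite indicE mem_set// mulr1 lee_fin thE.
  have ke : k.+1%:R ^+ 4 <= enorm xi.
    rewrite leNgt; apply/negP => lt; apply: hk.2; apply: (in_cube _ _).2 => i.
    exact: le_trans (coord_le_enorm xi i) (ltW lt).
  have kp : (0 : R) < k.+1%:R ^+ 4 by rewrite exprn_gt0.
  apply: ler_pM => //; first by rewrite invr_ge0 exprn_ge0// ltW.
    by apply: th_dec => //; exact: ltW.
  by rewrite lef_pV2 ?posrE ?exprn_gt0// lerXn2r ?nnegrE// ltW.
rewrite (nneseriesD1 (n := k))//; last by move=> n; rewrite lee_fin mulr_ge0// indicE.
by rewrite leeDl//; apply: nneseries_ge0 => n _ _; rewrite lee_fin mulr_ge0// indicE.
Qed.

Lemma sum_Iint_lty S : (forall n, \sum_(k < n) th (k.+1%:R ^+ 4) / k.+1%:R <= S) ->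
  (Iint lam theta < +oo)%E.
Proof.
move=> thS.
have mshell k : measurable (shell k : set (Rd R d.+1)).
  by apply: measurableD; exact: measurable_cbox.
have K0 : 0 <= K by rewrite mulr_ge0 ?exprn_ge0// mulr_ge0// mulr_ge0 ?exprn_ge0.
have mD : measurable (D : set (Rd R d.+1)).
  rewrite (_ : D = @enorm R d.+1 @^-1` `[1, +oo[%classic).
    by rewrite -[X in measurable X]setTI; apply: (@measurable_enorm R d.+1) => //; exact: measurable_itv.
  by apply/seteqP; split=> x /=; rewrite in_itv/= andbT.
have mq : measurable_fun [set: Rd R d.+1] (fun xi : V => theta xi / enorm xi ^+ d.+1).
  apply: measurable_funM => //.
  apply: (measurableT_comp (@measurable_invr R)); apply: measurable_funX.
  exact: measurable_enorm.
have mi (A : set V) (r : R) : measurable (A : set (Rd R d.+1)) ->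
    measurable_fun [set: Rd R d.+1] (fun xi : V => (r * \1_A xi)%:E).
  by move=> mA; apply/measurable_EFinP; apply: measurable_funM => //; exact: measurable_indic.
have intI (A : set V) (r : R) : measurable (A : set (Rd R d.+1)) -> 0 <= r ->
    (\int[lam]_xi (r * \1_A xi)%:E = r%:E * lam A)%E.
  move=> mA r0; under eq_integral do rewrite EFinM.
  rewrite ge0_integralZl//; first by rewrite (integral_indic _ measurableT mA) setIT.
    by apply/measurable_EFinP; exact: measurable_indic.
have mcube : measurable (cube 1 : set (Rd R d.+1)) by exact: measurable_cbox.
apply: (@le_lt_trans _ _ (\int[lam]_xi ((th 1 * \1_(cube 1) xi)%:E +
    \sum_(k <oo) (c k * \1_(shell k) xi)%:E))%E).
  rewrite /Iint integral_mkcond; apply: ge0_le_integral => //.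
  - by move=> x _; rewrite patchE; case: ifP => // _; rewrite lee_fin divr_ge0 ?exprn_ge0 ?enorm_ge0// thE.
  - apply/(measurable_restrictT _ mD)/measurable_funTS/measurable_EFinP; exact: mq.
  - apply: emeasurable_funD; first exact: mi.
    by apply: ge0_emeasurable_sum => [k x _ _|k _]; [rewrite lee_fin mulr_ge0// indicE|exact: mi].
  - move=> x _; apply: le_trans (pointwise x); rewrite patchE indicE.
    by case: ifP; rewrite ?mule1 ?mule0.
rewrite ge0_integralD//; last 4 first.
- by move=> x _; rewrite lee_fin mulr_ge0// indicE.
- exact: mi.
- by move=> x _; apply: nneseries_ge0 => k _ _; rewrite lee_fin mulr_ge0// indicE.
- by apply: ge0_emeasurable_sum => [k x _ _|k _]; [rewrite lee_fin mulr_ge0// indicE|exact: mi].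
rewrite intI// cube_volume// -EFinM integral_nneseries//; last 2 first.
- by move=> k; exact: mi.
- by move=> k x _; rewrite lee_fin mulr_ge0// indicE.
apply: (@le_lt_trans _ _ ((th 1 * (2 * 1) ^+ d.+1)%:E + (K * S)%:E)%E); last by rewrite -EFinD ltry.
apply: leeD2l; apply: lime_le.
  by apply: is_cvg_nneseries => k _ _; apply: integral_ge0 => x _; rewrite lee_fin mulr_ge0// indicE.
apply: nearW => n; rewrite big_mkord.
apply: (@le_trans _ _ (\sum_(k < n) (K * (th (k.+1%:R ^+ 4) / k.+1%:R))%:E)%E).
  apply: lee_sum => k _; rewrite intI//.
  apply: (le_trans (lee_wpmul2l _ (shell_vol k))); first by rewrite lee_fin.
  rewrite -EFinM lee_fin le_eqVlt; apply/orP; left; apply/eqP; rewrite /c.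
  by field; rewrite ?expf_neq0 ?pnatr_eq0// !gt_eqF.
by rewrite sumEFin lee_fin -mulr_sumr ler_wpM2l.
Qed.

End Iint_upper.

(** * Existence of the test functions *)

(* No measurability is required: the integral of a nonnegative function is
   defined as a supremum over the simple functions below it. *)
Lemma ge0_le_integral_sup d (T : measurableType d) (R : realType)
    (mu : {measure set T -> \bar R}) (f g : T -> \bar R) :
  (forall x, (0 <= f x)%E) -> (forall x, (f x <= g x)%E) ->
  (\int[mu]_x f x <= \int[mu]_x g x)%E.
Proof.
move=> f0 fg; have g0 x : (0 <= g x)%E by exact: le_trans (fg x).
rewrite !ge0_integralTE//; apply: le_ereal_sup => _ [h hf <-]; exists h => // x.
exact: le_trans (fg x).
Qed.

Section test_functions.
Context (R : realType) (d : nat).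
Local Notation V := 'rV[R]_d.+1.
Variable lam : {measure set (Rd R d.+1) -> \bar R}.
Hypothesis lamP : is_lebesgue lam.

Lemma cabs_ge0 (z : R * R) : 0 <= cabs z. Proof. exact: sqrtr_ge0. Qed.

Lemma cabs_real (a : R) : cabs (a, 0) = `|a|.
Proof. by rewrite /cabs /= expr0n addr0 sqrtr_sqr. Qed.

Lemma rapid_decay (w : V -> R) (C : R) : measurable_fun [set: Rd R d.+1] w ->
  (forall xi, `|w xi| <= C * (cauchy_weight xi * expR (- Num.sqrt (enorm xi)))) -> rapid lam w.
Proof.
move=> mw wC; split=> // n.
have iw := integrable_cauchy_weight lamP.
have C0 : 0 <= C.
  have := le_trans (normr_ge0 _) (wC 0); rewrite pmulr_lge0// mulr_gt0 ?expR_gt0//.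
  by apply: prodr_gt0 => i _; rewrite invr_gt0 ltr_wpDr ?sqr_ge0.
apply: (integrable_le _ (integrable_Zl (C * (2 * n.+1%:R ^+ 2) ^+ n) iw)).
  apply: measurable_funM; first exact: measurableT_comp.
  by apply: measurable_funX; apply: measurable_funD => //; exact: measurable_enorm.
move=> xi; have e0 := enorm_ge0 xi.
rewrite ger0_norm; last by rewrite mulr_ge0// exprn_ge0 ?addr_ge0.
apply: (le_trans (ler_wpM2r (exprn_ge0 _ (addr_ge0 ler01 e0)) (wC xi))).
apply: (le_trans (ler_wpM2l _ (poly_exp_sqrt n e0))).
  by rewrite mulr_ge0// mulr_ge0 ?cauchy_weight_ge0 ?expR_ge0.
rewrite [leLHS](_ : _ = C * (2 * n.+1%:R ^+ 2) ^+ n * cauchy_weight xi *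
  (expR (- Num.sqrt (enorm xi)) * expR (Num.sqrt (enorm xi)))); last by ring.
by rewrite -expRD addNr expR0 mulr1.
Qed.

Variables (iota L : R) (psi Psi : R -> R).
Hypothesis iota0 : 0 < iota.
Hypothesis fp : fourier_pair iota L psi Psi.
Hypothesis Psi0 : Psi 0 = 1.
Let phi : V -> R := prodf (fun=> psi).
Let Phi : V -> R := prodf (fun=> Psi).

Let iPhi : lam.-integrable setT (EFin \o Phi).
Proof. exact: (@prodf_integrable_ft _ _ _ lamP iota L (fun=> psi) (fun=> Psi) (fun=> fp)). Qed.

Let ftE c xi : \int[lam]_x (phi x * cos (c + 2 * pi * dotv x xi)) = cos c * Phi xi.
Proof. exact: (@prodf_ft _ _ _ lamP iota L (fun=> psi) (fun=> Psi) (fun=> fp)). Qed.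

Let invE c x : \int[lam]_xi (Phi xi * cos (c + 2 * pi * dotv xi x)) = cos c * (iota ^+ d.+1 * phi x).
Proof. exact: (@prodf_inv _ _ _ lamP iota L (fun=> psi) (fun=> Psi) (fun=> fp)). Qed.

(** The inversion formula exhibits [phi] as a [wave] with rapid weight. *)
Lemma test_smooth : rapid lam Phi -> smooth phi.
Proof.
move=> rPhi; have -> : phi = wave lam (fun xi => iota ^- d.+1 * Phi xi) 0.
  apply/funext => x; rewrite /wave; under eq_Rintegral do rewrite -(mulrA _ (Phi _)).
  rewrite RintegralZl//; last first.
    apply: (integrable_mulbdd (c := 1)) => //; first exact: measurable_phase.
    by move=> xi; exact: cos_max.
  rewrite invE cos0 mul1r mulKf// expf_neq0// gt_eqF//.
apply: smooth_wave; case: rPhi => m i; split; first exact: measurable_funM.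
move=> n; have := integrable_Zl `|iota ^- d.+1| (i n).
by apply: (eq_integrable measurableT) => xi _ /=; rewrite normrM mulrA.
Qed.

Lemma smooth_zero : smooth (fun _ : V => 0 : R).
Proof.
have -> : (fun _ : V => 0 : R) = wave lam (cst 0) 0.
  apply/funext => x; rewrite /wave; under eq_Rintegral do rewrite mul0r.
  by rewrite Rintegral_cst// mul0r.
apply: smooth_wave; split=> // n.
have := @integrable0 _ _ _ lam setT; apply: (eq_integrable measurableT) => xi _ /=.
by rewrite normr0 mul0r.
Qed.

Lemma test_support x : phi x != 0 -> cube L x.
Proof.
move=> px; apply: (in_cube _ _).2 => i; rewrite leNgt; apply/negP => /(fp_support fp) p0.
by move/eqP: px; apply; rewrite /phi /prodf (bigD1 i)//= p0 mul0r.
Qed.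

Lemma test_compact : compact (closure [set x : V | (phi x, 0 : R) != (0, 0)]).
Proof.
have cL : closed (cube L : set V).
  rewrite (_ : (cube L : set V) = \bigcap_(i : 'I_d.+1) ((fun x : V => x 0 i) @^-1` `[- L, L]%classic)).
    apply: closed_bigI => i _; apply: closed_comp; last exact: itv_closed.
    by move=> x _; exact: coord_continuous.
  apply/seteqP; split=> [x h i _ /=|x h]; first by rewrite in_itv/= -ler_norml; exact: (in_cube _ _).1 h i.
  by apply: (in_cube _ _).2 => i; have := h i I; rewrite /= in_itv/= -ler_norml.
have sub : closure [set x : V | (phi x, 0 : R) != (0, 0)] `<=` cube L.
  rewrite [X in _ `<=` X](closure_id _).1//; apply: closureS => x /= hx; apply: test_support.
  by apply: contra hx => /eqP ->.
apply: bounded_closed_compact; last exact: closed_closure.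
exists L; split; first by rewrite num_real.
move=> M LM x /sub hx; suff : mx_norm x <= M by [].
rewrite mx_normrE.
apply/bigmax_leP; split=> [|[i j] _ /=].
  apply: le_trans (ltW LM); apply: le_trans ((in_cube _ _).1 hx ord0); exact: normr_ge0.
by rewrite ord1 (le_trans ((in_cube _ _).1 hx j))// ltW.
Qed.

(** The integral of [phi] is [Phi 0 = 1]. *)
Lemma test_nonzero : exists x, (phi x, 0 : R) != (0, 0).
Proof.
apply/not_existsP => h.
have := ftE 0 0.
rewrite (_ : Rintegral _ _ _ = 0); last first.
  transitivity (\int[lam]_x (cst 0 x)); last by rewrite Rintegral_cst// mul0r.
  apply: eq_Rintegral => x _; rewrite (_ : phi x = 0) ?mul0r//.
  by apply/eqP/negPn/negP => hx; apply: (h x); apply: contra hx => /eqP[->].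
rewrite cos0 mul1r /Phi /prodf big1; last by move=> i _; rewrite mxE.
by move/eqP; rewrite eq_sym oner_eq0.
Qed.

Lemma test_ft xi : ftL1 lam (fun x => (phi x, 0)) xi = (Phi xi, 0).
Proof.
congr pair => /=.
  transitivity (\int[lam]_x (phi x * cos (0 + 2 * pi * dotv x xi))).
    by congr fine; apply: eq_integral => x _; rewrite add0r mul0r addr0.
  by rewrite ftE cos0 mul1r.
transitivity (\int[lam]_x (phi x * cos (pi / 2 + 2 * pi * dotv x xi))).
  by congr fine; apply: eq_integral => x _; rewrite mul0r sub0r addrC cosDpihalf mulrN.
by rewrite ftE cos_pihalf mul0r.
Qed.

End test_functions.

Section existence.
Context (R : realType) (d : nat).
Local Notation V := 'rV[R]_d.+1.
Variable lam : {measure set (Rd R d.+1) -> \bar R}.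
Hypothesis lamP : is_lebesgue lam.
Variable theta : V -> R.
Hypothesis theta0 : forall xi, 0 <= theta xi.
Hypothesis theta_rad : radially_decreasing theta.
Hypothesis mtheta : measurable_fun [set: Rd R d.+1] theta.
Hypothesis theta_van : vanishes_at_infinity theta.
Hypothesis Ioo : (Iint lam theta < +oo)%E.

(** One function serves all [q], [N] and the pointwise bound: the Cauchy weight remaining beside the
    exponential provides integrability. *)
Lemma test_function_exists : exists (phi Phi : V -> R) (C : R),
  [/\ Cc_infty (fun x => (phi x, 0)), exists x, (phi x, 0 : R) != (0, 0),
      forall xi, ftL1 lam (fun x => (phi x, 0)) xi = (Phi xi, 0), 0 <= C &
      forall xi, 0 <= Phi xi <= C * (cauchy_weight xi * expR (- (theta xi * enorm xi)))].
Proof.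
have [S hS] := Iint_lty_sum lamP mtheta (profileE theta_rad) (profile_ge0 theta0)
  (profile_dec theta_rad) Ioo.
have [s1 hs1] := profile_half theta_van.
have [psi [Psi [C [fp Psi0 PsiC]]]] := ingham_pair_sqrt ltr01 (fun s _ => profile_ge0 theta0 s)
  (profile_dec theta_rad) hs1 hS.
have i0 : 0 < sincK R / pi by rewrite divr_gt0 ?sincK_gt0 ?pi_gt0.
have dec (xi : V) := prodf_decay (Psi := fun=> Psi) xi (fun s _ => profile_ge0 theta0 s)
  (profile_dec theta_rad) (fun=> PsiC).
have mPhi : measurable_fun [set: Rd R d.+1] (prodf (fun _ : 'I_d.+1 => Psi)).
  by apply: measurable_prod_coord => i; exact: integrable_measurable (fp_integrable fp).
have C0 : 0 <= C ^+ d.+1.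
  have /andP[h0 h1] := dec 0; have := le_trans h0 h1; rewrite pmulr_lge0//.
  rewrite mulr_gt0 ?expR_gt0//.
  by apply: prodr_gt0 => i _; rewrite invr_gt0 ltr_wpDr ?sqr_ge0.
have rPhi : rapid lam (prodf (fun _ : 'I_d.+1 => Psi)).
  apply: (rapid_decay lamP (C := C ^+ d.+1)) => // xi.
  have /andP[h0 h1] := dec xi; rewrite ger0_norm// (le_trans h1)// ler_wpM2l//.
  rewrite ler_wpM2l ?cauchy_weight_ge0// ler_expR.
  have : 0 <= Num.sqrt (enorm xi) by exact: sqrtr_ge0.
  have : 0 <= profile theta (enorm xi) * enorm xi by rewrite mulr_ge0 ?enorm_ge0 ?profile_ge0.
  lra.
exists (prodf (fun=> psi)), (prodf (fun=> Psi)), (C ^+ d.+1); split=> //.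
- split; first exact: (test_smooth lamP i0 fp rPhi).
  split; first exact: (smooth_zero lam).
  exact: (test_compact fp).
- exact: (test_nonzero lamP fp Psi0).
- exact: (test_ft lamP fp).
move=> xi; have /andP[-> h1] := dec xi; rewrite /= (le_trans h1)// ler_wpM2l//.
rewrite ler_wpM2l ?cauchy_weight_ge0// ler_expR -(profileE theta_rad).
by have : 0 <= Num.sqrt (enorm xi) by [exact: sqrtr_ge0]; lra.
Qed.

Lemma exists_test_function_growth (q N : R) : 1 <= q -> 0 <= N ->
  exists f : V -> R * R,
    Cc_infty f /\ (exists x, f x != (0, 0)) /\ growth_int lam theta q N (ftL1 lam f).
Proof.
move=> q1 N0; have [phi [Phi [C [ccphi nz ft C0 PhiC]]]] := test_function_exists.
have q0 : 0 <= q by exact: le_trans q1.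
exists (fun x => (phi x, 0)); split=> //; split=> //; rewrite /growth_int.
apply: (@le_lt_trans _ _ (\int[lam]_xi (C `^ q * cauchy_weight xi)%:E)%E); last first.
  have /integrableP[_] := integrable_Zl (C `^ q) (integrable_cauchy_weight lamP).
  apply: le_lt_trans; apply: ge0_le_integral_sup => xi.
    by rewrite lee_fin mulr_ge0 ?powR_ge0 ?cauchy_weight_ge0.
  by rewrite /= lee_fin ler_norm.
apply: ge0_le_integral_sup => xi.
  by rewrite lee_fin divr_ge0 ?powR_ge0// mulr_ge0 ?powR_ge0 ?expR_ge0.
have e0 := enorm_ge0 xi; have /andP[P0 P1] := PhiC xi.
have w0 := cauchy_weight_ge0 xi.
rewrite lee_fin ft cabs_real ger0_norm//.
have N1 : 1 <= (1 + enorm xi) `^ N by rewrite -[leLHS](powRr0 (1 + enorm xi)) ler_powR// lerDl.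
rewrite ler_pdivrMr; last exact: lt_le_trans N1.
apply: (@le_trans _ _ (C `^ q * cauchy_weight xi)); last first.
  by rewrite ler_peMr// mulr_ge0 ?powR_ge0.
apply: (@le_trans _ _ ((C * (cauchy_weight xi * expR (- (theta xi * enorm xi)))) `^ q *
    expR (q * theta xi * enorm xi))).
  by rewrite ler_wpM2r ?expR_ge0// ge0_ler_powR ?nnegrE// (le_trans P0).
rewrite !powRM ?mulr_ge0 ?expR_ge0// -mulrA ler_wpM2l ?powR_ge0//.
rewrite -expRM -mulrA -expRD (_ : _ + _ = 0); last by ring.
rewrite expR0 mulr1.
(* For [q >= 1] a number in [[0, 1]] dominates its [q]-th power; [ge1r_powR] covers only positive
   numbers. *)
have w1 := cauchy_weight_le1 xi.
have [->|wn] := eqVneq (cauchy_weight xi) 0.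
  by rewrite powR0// gt_eqF// (lt_le_trans ltr01).
by apply: ge1r_powR => //; rewrite w1 lt_neqAle eq_sym wn w0.
Qed.

Lemma exists_test_function_poly_bound : exists (f : V -> R * R) (C : R) (P1 P2 : mpoly.mpoly d.+1 R),
  Cc_infty f /\ (exists x, f x != (0, 0)) /\ poly_bound lam theta C P1 P2 (ftL1 lam f).
Proof.
have [phi [Phi [C [ccphi nz ft C0 PhiC]]]] := test_function_exists.
exists (fun x => (phi x, 0)), C, (mpoly.mpolyC d.+1 1), (mpoly.mpolyC d.+1 0); split=> //; split=> //.
apply: aeW => xi; rewrite ft !mpoly.mevalC !cabs_real normr1 mulr1.
have /andP[P0 P1] := PhiC xi; rewrite ger0_norm// (le_trans P1)// ler_wpM2l//.
by rewrite ler_piMl ?expR_ge0// cauchy_weight_le1.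
Qed.

End existence.

(** * Quasianalyticity *)

Section bang.
Context (R : realType).
Variables (h : nat -> R -> R) (mu : nat -> R) (C delta : R).
Hypothesis mu0 : forall j, 0 < mu j.
Hypothesis mu_mono : forall j k, (j <= k)%N -> mu j <= mu k.
Hypothesis mu_div : forall B, exists n, B <= \sum_(j < n) (mu j)^-1.
(** [h n] plays the n-th derivative of [h 0]. The link between them is the Taylor inequality with
    remainder governed by [M (n + m)], whose case [m = 0] bounds [h n] itself. *)
Let M (n : nat) : R := \prod_(j < n) mu j.
Hypothesis C0 : 0 <= C.
Hypothesis taylor : forall n m t s,
  `|h n (t + s) - \sum_(j < m) h (n + j)%N t * s ^+ j / j`!%:R| <=
  C * M (n + m)%N * `|s| ^+ m / m`!%:R.
Hypothesis delta0 : 0 < delta.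
Hypothesis flat : forall t, `|t| < delta -> h 0%N t = 0.

Let M0 n : 0 < M n. Proof. by apply: prodr_gt0. Qed.

Let h_le n t : `|h n t| <= C * M n.
Proof.
have := taylor n 0 t 0; rewrite big_ord0 subr0 addr0 addn0 expr0 fact0.
by rewrite mulr1 divr1.
Qed.

(** A second-order expansion with a step [s] inside the flat interval leaves
    [|h n.+1 t| * s <= K * s^2]; then [s] tends to 0. *)
Let flat_all n t : `|t| < delta -> h n t = 0.
Proof.
elim: n t => [|n IH] t tdelta; first exact: flat.
apply/eqP; rewrite -normr_le0; apply/ler_addgt0Pl => e e0; rewrite addr0.
pose K := C * M n.+2 + 1; have K0 : 0 < K by rewrite ltr_wpDl// mulr_ge0// ltW.
pose s := Num.min (e / K) ((delta - `|t|) / 2).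
have s0 : 0 < s by rewrite lt_min !divr_gt0// subr_gt0.
have sd : s <= (delta - `|t|) / 2 by rewrite ge_min lexx orbT.
have se : s * K <= e by rewrite -ler_pdivlMr// ge_min lexx.
have ts : `|t + s| < delta by apply: (le_lt_trans (ler_normD _ _)); rewrite (gtr0_norm s0); lra.
have := taylor n 2 t s.
rewrite 2!big_ord_recl big_ord0 /= /bump /= !addn0 !addn1 addn2 !IH//.
rewrite !mul0r sub0r add0r addr0 expr1 divr1 normrN normrM (gtr0_norm s0) => hs.
have hs2 : `|h n.+1 t| * s <= K * s * s.
  apply: (le_trans hs); rewrite -(mulrA K) -expr2 ler_pdivrMr ?ltr0n//.
  apply: (@le_trans _ _ (K * s ^+ 2)); first by rewrite ler_wpM2r ?sqr_ge0// lerDl.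
  by rewrite ler_peMr ?ler1n// mulr_ge0 ?sqr_ge0// ltW.
by move: hs2; rewrite ler_pM2r// mulrC => /le_trans; apply.
Qed.

(* [x] has Bang degree at least [k]; a step of length [1 / (4 mu_k)] lowers the
   degree by at most one, so a zero of infinite order spreads over the line. *)
Let deg (k : nat) (x : R) := forall n, `|h n x| <= C * M n * 2 ^+ n / 2 ^+ k.

Let deg_trivial k x n : (k <= n)%N -> `|h n x| <= C * M n * 2 ^+ n / 2 ^+ k.
Proof.
move=> kn; apply: (le_trans (h_le n x)); rewrite ler_pdivlMr ?exprn_gt0//.
by rewrite ler_wpM2l ?ler_eXn2l ?ltr1n// mulr_ge0// ltW.
Qed.

Let M_ratio n j k : (n + j <= k.+1)%N -> M (n + j)%N <= M n * mu k ^+ j.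
Proof.
elim: j => [|j IH] njk; first by rewrite addn0 expr0 mulr1.
rewrite addnS /M big_ord_recr /= exprSr mulrA.
apply: ler_pM; [exact: ltW (M0 _)|exact: ltW|apply: IH|apply: mu_mono]; lia.
Qed.

Let geom (q : R) m : 0 <= q <= 2^-1 -> \sum_(j < m) q ^+ j / j`!%:R <= 2 - q ^+ m *+ (m == 0%N).
Proof.
move=> /andP[q0 q1].
have : \sum_(j < m) (2^-1 : R) ^+ j = 2 - 2 * 2^-1 ^+ m.
  elim: m => [|m IH]; first by rewrite big_ord0 expr0; ring.
  by rewrite big_ord_recr /= IH exprS; field.
move=> e; case: m e => [|m] e; first by rewrite big_ord0 expr0 mulr1n; lra.
rewrite mulr0n subr0; apply: (@le_trans _ _ (\sum_(j < m.+1) (2^-1 : R) ^+ j)).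
  apply: ler_sum => j _; rewrite ler_pdivrMr ?ltr0n ?fact_gt0//.
  apply: (@le_trans _ _ (2^-1 ^+ j)); first by rewrite lerXn2r ?nnegrE.
  by rewrite ler_peMr ?exprn_ge0// ler1n fact_gt0.
by rewrite e gerBl mulr_ge0// exprn_ge0.
Qed.

(** For [n <= k], expand [h n] at [y] to order [k + 1 - n], so that the remainder carries [M k.+1],
    the first index at which the trivial bound already has the required form. With
    [q = 2 mu_k |x - y| <= 1/2] every term is at most [Z * q^j / j!], and the total [2 Z] costs one
    power of 2. *)
Let deg_step k y x : deg k.+1 y -> `|x - y| <= (4 * mu k)^-1 -> deg k x.
Proof.
move=> dy xy n; have [kn|nk] := leqP k.+1 n; first by apply: deg_trivial; exact: ltnW.
pose m := (k.+1 - n)%N; have nm : (n + m = k.+1)%N by rewrite /m; lia.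
have := taylor n m y (x - y); rewrite (addrC y) subrK nm => hT.
set s := `|x - y| in xy hT; set W := \sum_(j < m) _ in hT.
have s0 : 0 <= s by exact: normr_ge0.
have muk := mu0 k.
pose q := 2 * mu k * s; have q0 : 0 <= q by rewrite !mulr_ge0// ltW.
have q1 : q <= 2^-1.
  rewrite /q mulrC -ler_pdivlMr ?mulr_gt0// (le_trans xy)// le_eqVlt; apply/orP; left.
  by apply/eqP; field; rewrite gt_eqF.
pose Z := C * M n * 2 ^+ n / 2 ^+ k.+1.
have Z0 : 0 <= Z by rewrite divr_ge0 ?exprn_ge0// mulr_ge0 ?exprn_ge0// mulr_ge0// ltW.
have term j : (j <= m)%N -> C * M (n + j)%N * 2 ^+ (n + j) / 2 ^+ k.+1 * s ^+ j / j`!%:R <= Z * (q ^+ j / j`!%:R).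
  move=> jm; rewrite mulrA ler_pM2r ?invr_gt0 ?ltr0n ?fact_gt0//.
  have h1 : M (n + j)%N <= M n * mu k ^+ j by apply: M_ratio; lia.
  rewrite /q !exprMn /Z exprD.
  apply: (@le_trans _ _ (C * (M n * mu k ^+ j) * (2 ^+ n * 2 ^+ j) / 2 ^+ k.+1 * s ^+ j)).
    rewrite ler_wpM2r ?exprn_ge0// ler_wpM2r ?invr_ge0 ?exprn_ge0//.
    by rewrite ler_wpM2r ?mulr_ge0 ?exprn_ge0// ler_wpM2l.
  by rewrite le_eqVlt; apply/orP; left; apply/eqP; ring.
have hW : `|W| <= \sum_(j < m) Z * (q ^+ j / j`!%:R).
  apply: (le_trans (ler_norm_sum _ _ _)); apply: ler_sum => j _.
  apply: le_trans (term j (ltnW (ltn_ord j))).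
  rewrite !normrM normfV normrX [ `|j`!%:R|]ger0_norm// ler_pM2r ?invr_gt0 ?ltr0n ?fact_gt0//.
  by rewrite ler_wpM2r ?exprn_ge0// dy.
have hE : C * M k.+1 * s ^+ m / m`!%:R <= Z * (q ^+ m / m`!%:R).
  apply: le_trans (term m (leqnn _)); rewrite nm -(mulrA _ (2 ^+ k.+1)) divff ?mulr1//.
have : `|h n x| <= \sum_(j < m.+1) Z * (q ^+ j / j`!%:R).
  rewrite -(subrK W (h n x)) big_ord_recr/= addrC (le_trans (ler_normD _ _))//.
  by apply: lerD => //; exact: le_trans hE.
move=> /le_trans; apply; rewrite -mulr_sumr.
have := @geom q m.+1; rewrite q0 q1 mulr0n subr0 => /(_ isT) g.
apply: (le_trans (ler_wpM2l Z0 g)); rewrite /Z exprS le_eqVlt; apply/orP; left; apply/eqP.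
by field; rewrite expf_neq0.
Qed.

Let deg_reach N i x : (i <= N)%N ->
  `|x| <= \sum_((N - i)%N <= j < N) (4 * mu j)^-1 -> deg (N - i) x.
Proof.
elim: i x => [|i IH] x iN.
  rewrite subn0 big_geq// normr_le0 => /eqP -> n.
  rewrite flat_all ?normr0// divr_ge0 ?exprn_ge0// mulr_ge0 ?exprn_ge0// mulr_ge0// ltW//.
have -> : (N - i.+1)%N = (N - i).-1 by lia.
have : (0 < N - i)%N by lia.
case e : (N - i)%N => [//|k] _ /=; rewrite big_ltn; last by lia.
set T := \sum_(k.+1 <= j < N) _ => xT.
have T0 : 0 <= T by apply: sumr_ge0 => j _; rewrite invr_ge0 mulr_ge0// ltW.
have st0 : 0 <= (4 * mu k)^-1 by rewrite invr_ge0 mulr_ge0// ltW.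
(* [y] is [x] clamped to [[-T, T]]: the induction hypothesis reaches [y], and one more step reaches
   [x]. *)
have [y [yT xy]] : exists y, `|y| <= T /\ `|x - y| <= (4 * mu k)^-1.
  have [xT'|xT'] := leP `|x| T; first by exists x; rewrite subrr normr0.
  have [x0|x0] := ger0P x.
    exists T; rewrite ger0_norm//; split=> //.
    by move: xT xT'; rewrite (ger0_norm x0) => xT xT'; rewrite ger0_norm; lra.
  exists (- T); rewrite normrN ger0_norm//; split=> //.
  by move: xT xT'; rewrite (ltr0_norm x0) => xT xT'; rewrite opprK ler0_norm; lra.
apply: deg_step xy; rewrite -e; apply: IH; first exact: ltnW.
by rewrite e.
Qed.

(** By divergence, steps of indices at least [k] alone reach any [x]. So [x] has every degree, and
    [|h 0 x| <= C / 2^k] for all [k]. *)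
Lemma denjoy_carleman x : h 0%N x = 0.
Proof.
suff dx k : deg k x.
  apply/eqP; rewrite -normr_le0; apply/ler_addgt0Pl => e e0; rewrite addr0.
  have := dx (Num.truncn (C / e)) 0%N; rewrite /M big_ord0 expr0 !mulr1.
  move=> /le_trans; apply; rewrite ler_pdivrMr ?exprn_gt0// mulrC -ler_pdivrMr//.
  apply: (le_trans (ltW (truncnS_gt _))); rewrite -natrX ler_nat.
  exact: ltn_expl.
have [n0 hn0] := mu_div (4 * `|x| + \sum_(0 <= j < k) (mu j)^-1).
have im j : 0 <= (mu j)^-1 by rewrite invr_ge0 ltW.
pose n := maxn k n0; have kn : (k <= n)%N by rewrite leq_maxl.
have hn : 4 * `|x| + \sum_(0 <= j < k) (mu j)^-1 <= \sum_(0 <= j < n) (mu j)^-1.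
  apply: (le_trans hn0); rewrite -(big_mkord xpredT (fun j => (mu j)^-1)).
  by rewrite (big_cat_nat (leq0n n0) (leq_maxr k n0))//= lerDl sumr_ge0.
have := @deg_reach n (n - k)%N x (leq_subr _ _); rewrite subKn//; apply.
move: hn; rewrite (big_cat_nat (leq0n k) kn)//= [leRHS]addrC lerD2r => hn.
rewrite (eq_bigr (fun j => 4^-1 * (mu j)^-1)) => [|j _]; last by rewrite invfM.
by rewrite -mulr_sumr ler_pdivlMl.
Qed.

End bang.

(** * From the exponential weight to derivative bounds *)

Section weights.
Context (R : realType).
Variable th : R -> R.
Hypothesis th0 : forall r, 0 <= th r.
Hypothesis th_dec : forall s t, 0 <= s -> s <= t -> th t <= th s.

Lemma exprn_fact_le (x : R) n : 0 <= x -> x ^+ n / n`!%:R <= expR x.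
Proof.
move=> x0; case: n => [|n]; first by rewrite expr0 fact0 divr1 -expR0 ler_expR.
by apply: le_trans (expR_ge1Dxn n x0); rewrite lerDr ler01.
Qed.

Lemma natr_fact_prod n : n`!%:R = \prod_(j < n) j.+1%:R :> R.
Proof.
elim: n => [|n IH]; first by rewrite big_ord0 fact0.
by rewrite big_ord_recr/= -IH factS natrM mulrC.
Qed.

(* The factors with [j < r^(1/4)] cost at most [exp(4 sqrt r)], and in the
   remaining ones [th((j+1)^4)] is at most [th r]. *)
Lemma weight_prod_le n (r : R) : 0 <= r ->
  \prod_(j < n) (r * th (j.+1%:R ^+ 4) / j.+1%:R) <=
  expR (th 0) * expR (th r * r + 4 * Num.sqrt r).
Proof.
move=> r0; set x := Num.sqrt (Num.sqrt r).
have x0 : 0 <= x by exact: sqrtr_ge0.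
have x2 : x ^+ 2 = Num.sqrt r by rewrite sqr_sqrtr// sqrtr_ge0.
have x4 : x ^+ 4 = r by rewrite (exprM _ 2 2) x2 sqr_sqrtr.
pose f j : R := r * th (j.+1%:R ^+ 4) / j.+1%:R.
have f0 j : 0 <= f j by rewrite divr_ge0// mulr_ge0.
pose kk := Num.truncn x.
have kx : kk%:R <= x by rewrite truncn_le.
have xk : x < kk.+1%:R by exact: truncnS_gt.
have B0 : 0 <= th 0 := th0 0.
(* Here [x] is the fourth root of [r]. From [x <= exp x] one gets [r^m <= exp(4 x m)], and [m <= x]
   turns this into [exp(4 sqrt r)], the origin of the constant 4. The powers of [th 0] over [m!]
   give [exp(th 0)]. *)
have small m : (m <= kk)%N -> \prod_(j < m) f j <= expR (th 0) * expR (4 * Num.sqrt r).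
  move=> mk; apply: (@le_trans _ _ (r ^+ m * (th 0 ^+ m / m`!%:R))).
    have -> : r ^+ m * (th 0 ^+ m / m`!%:R) = \prod_(j < m) (r * th 0 / j.+1%:R).
      rewrite big_split/= prodr_const card_ord exprMn prodfV -natr_fact_prod; ring.
    apply: ler_prod => j _; rewrite f0/= ler_wpM2r ?invr_ge0// ler_wpM2l//.
    by apply: th_dec => //; exact: exprn_ge0.
  rewrite [leRHS]mulrC; apply: ler_pM; rewrite ?exprn_ge0 ?divr_ge0 ?exprn_ge0 ?exprn_fact_le//.
  apply: (@le_trans _ _ (expR (4 * x) ^+ m)).
    rewrite lerXn2r ?nnegrE ?expR_ge0// -x4 mulrC expRM_natr lerXn2r ?nnegrE ?expR_ge0//.
    by have := expR_ge1Dx x; lra.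
  rewrite -expRM_natr ler_expR -x2 -mulrA ler_wpM2l// expr2 ler_wpM2l//.
  by apply: le_trans kx; rewrite ler_nat.
have eT : 1 <= expR (th r * r) by rewrite -expR0 ler_expR mulr_ge0.
rewrite expRD [expR (th r * r) * _]mulrC mulrA.
have [nk|kn] := leqP n kk.
  apply: (le_trans (small n nk)); rewrite ler_peMr// mulr_ge0 ?expR_ge0//.
rewrite -(subnKC (ltnW kn)) big_split_ord/=; apply: ler_pM.
- by apply: prodr_ge0 => j _; exact: (f0 j).
- by apply: prodr_ge0 => j _; exact: (f0 (kk + j)%N).
- exact: small.
(* The remaining indices satisfy [x <= kk + j + 1], so their [th] is at most [th r]; lowering the
   denominators to [j + 1] gives a single term of the series of [exp(th r * r)]. *)
set i := (n - kk)%N; apply: le_trans (exprn_fact_le i (mulr_ge0 (th0 r) r0)).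
have -> : (th r * r) ^+ i / i`!%:R = \prod_(j < i) (th r * r / j.+1%:R).
  by rewrite big_split/= prodr_const card_ord prodfV -natr_fact_prod.
apply: ler_prod => j _; rewrite f0/= /f mulrC [leRHS]mulrC.
have xj : x <= (kk + j).+1%:R by rewrite (le_trans (ltW xk))// ler_nat ltnS leq_addr.
apply: ler_pM; rewrite ?invr_ge0 ?mulr_ge0//.
  by rewrite lef_pV2 ?posrE// ler_nat ltnS leq_addl.
rewrite mulrC ler_wpM2r//; apply: th_dec => //.
by rewrite -x4 lerXn2r ?nnegrE.
Qed.

Hypothesis th_gt0 : forall j : nat, 0 < th (j.+1%:R ^+ 4).

(** Each factor is split as [(r th_j / j) * (c j / th_j)]. The first product is paid for by the
    weight, the second is the sequence handed to [denjoy_carleman]. *)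
Lemma weight_power_le n (c r : R) : 0 <= c -> 0 <= r ->
  (c * r) ^+ n <= expR (th 0) * expR (th r * r + 4 * Num.sqrt r) *
                  \prod_(j < n) (c * j.+1%:R / th (j.+1%:R ^+ 4)).
Proof.
move=> c0 r0.
have -> : (c * r) ^+ n = \prod_(j < n) (r * th (j.+1%:R ^+ 4) / j.+1%:R) *
                         \prod_(j < n) (c * j.+1%:R / th (j.+1%:R ^+ 4)).
  rewrite -big_split/= -[n in LHS]card_ord -prodr_const; apply: eq_bigr => j _.
  by field; rewrite gt_eqF//= pnatr_eq0.
rewrite ler_wpM2r ?weight_prod_le// prodr_ge0// => j _.
by rewrite divr_ge0 ?mulr_ge0.
Qed.

End weights.

(** * Quasianalyticity of oscillatory integrals in one parameter *)

Section quasianalytic_integral.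
Context d (T : measurableType d) (R : realType) (mu : {measure set T -> \bar R}).
Variables (G1 G2 phi al Q : T -> R) (nu : nat -> R).
Hypothesis mG1 : measurable_fun [set: T] G1.
Hypothesis mG2 : measurable_fun [set: T] G2.
Hypothesis mphi : measurable_fun [set: T] phi.
Hypothesis mal : measurable_fun [set: T] al.
Hypothesis iQ : mu.-integrable setT (EFin \o Q).
Hypothesis Q0 : forall x, 0 <= Q x.
Hypothesis bound : forall n x,
  `|phi x| ^+ n * (`|G1 x| + `|G2 x|) <= (\prod_(j < n) nu j) * Q x.
Hypothesis nu0 : forall j, 0 < nu j.
Hypothesis nu_mono : forall j k, (j <= k)%N -> nu j <= nu k.
Hypothesis nu_div : forall B, exists n, B <= \sum_(j < n) (nu j)^-1.

(** The real part of [(G1 + i G2) * exp(i a)], with cosines only so that a single Taylor bound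
    covers both terms. *)
Let rot x a := G1 x * cos a + G2 x * cos (a + pi / 2).
Let a_ n t x := al x + t * phi x + n%:R * (pi / 2).
(** The n-th derivative in [t] of the integrand: each differentiation multiplies by [phi] and
    advances the phase by [pi / 2]. *)
Let k_ n t x := phi x ^+ n * rot x (a_ n t x).

Let mrot a : measurable_fun [set: T] a -> measurable_fun [set: T] (fun x => rot x (a x)).
Proof.
move=> ma; apply: measurable_funD; apply: measurable_funM => //.
  exact: measurable_cos_comp.
by apply: measurable_cos_comp; apply: measurable_funD.
Qed.

Let ma_ n t : measurable_fun [set: T] (a_ n t).
Proof.
apply: measurable_funD => //; apply: measurable_funD => //.
exact: measurable_funM.
Qed.

Let rot_le x a : `|rot x a| <= `|G1 x| + `|G2 x|.
Proof.
apply: (le_trans (ler_normD _ _)); rewrite !normrM.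
by apply: lerD; rewrite ler_piMr// ler_norml cos_geN1 cos_le1.
Qed.

Let ik n t : mu.-integrable setT (EFin \o k_ n t).
Proof.
apply: (@integrable_le _ _ _ mu (k_ n t) (fun x => (\prod_(j < n) nu j) * Q x)).
- by apply: measurable_funM; [exact: measurable_funX|exact/mrot/ma_].
- exact: integrable_Zl.
- move=> x; apply: le_trans (bound n x); rewrite normrM normrX.
  by rewrite ler_wpM2l ?exprn_ge0.
Qed.

Let rot_taylor m x a s :
  `|rot x (a + s) - \sum_(j < m) rot x (a + j%:R * (pi / 2)) * s ^+ j / j`!%:R| <=
  (`|G1 x| + `|G2 x|) * `|s| ^+ m / m`!%:R.
Proof.
have -> : rot x (a + s) - \sum_(j < m) rot x (a + j%:R * (pi / 2)) * s ^+ j / j`!%:R =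
   G1 x * (cos (a + s) - cos_taylor m a s) +
   G2 x * (cos (a + pi / 2 + s) - cos_taylor m (a + pi / 2) s).
  rewrite /cos_taylor !mulrBr !mulr_sumr addrACA -opprD -big_split/=; congr (_ - _).
    by rewrite /rot (addrAC a).
  apply: eq_bigr => j _; rewrite /rot (addrAC a (pi / 2)); ring.
apply: (le_trans (ler_normD _ _)); rewrite !normrM -[leRHS]mulrA [leRHS]mulrDl.
by apply: lerD; rewrite ler_wpM2l// cos_taylor_le.
Qed.

(** Integrating the pointwise Taylor inequality and applying [bound] at order [n + m] gives the
    hypothesis of [denjoy_carleman], with the integral of [Q] as constant. *)
Lemma quasianalytic_integral delta :
  0 < delta ->
  (forall t, `|t| < delta -> \int[mu]_x rot x (al x + t * phi x) = 0) ->
  forall t, \int[mu]_x rot x (al x + t * phi x) = 0.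
Proof.
move=> delta0 flat t.
pose h n t := \int[mu]_x k_ n t x.
have h0 s : h 0%N s = \int[mu]_x rot x (al x + s * phi x).
  by apply: eq_Rintegral => x _; rewrite /k_ /a_ expr0 mul1r mul0r addr0.
rewrite -h0; apply: (@denjoy_carleman R h nu (\int[mu]_x Q x) delta nu0 nu_mono nu_div) => //.
- by apply: Rintegral_ge0.
- move=> n m r s.
  have iS : mu.-integrable setT (EFin \o (fun x => \sum_(j < m) (s ^+ j / j`!%:R) * k_ (n + j)%N r x)).
    exact: (integrable_sum_seq _ (fun j : 'I_m => integrable_Zl (s ^+ j / j`!%:R) (ik (n + j)%N r))).
  have -> : \sum_(j < m) h (n + j)%N r * s ^+ j / j`!%:R =
      \int[mu]_x (\sum_(j < m) (s ^+ j / j`!%:R) * k_ (n + j)%N r x).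
    rewrite (Rintegral_sum_seq _ (fun j : 'I_m => integrable_Zl (s ^+ j / j`!%:R) (ik (n + j)%N r))).
    by apply: eq_bigr => j _; rewrite (RintegralZl _ measurableT (ik _ _)) /h; ring.
  rewrite /h -(RintegralB measurableT (ik _ _) iS).
  set N := \prod_(_ < _) _.
  have iN : mu.-integrable setT (EFin \o (fun x => (N * `|s| ^+ m / m`!%:R) * Q x)) by exact: integrable_Zl.
  have iB : mu.-integrable setT (EFin \o (fun x => k_ n (r + s) x - \sum_(j < m) (s ^+ j / j`!%:R) * k_ (n + j)%N r x)).
    have := integrableB measurableT (ik n (r + s)) iS; apply: eq_integrable => //.
  have -> : (\int[mu]_x Q x) * N * `|s| ^+ m / m`!%:R = \int[mu]_x ((N * `|s| ^+ m / m`!%:R) * Q x).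
    by rewrite (RintegralZl _ measurableT iQ); ring.
  apply: (normr_Rintegral_le iB iN) => x.
  have -> : k_ n (r + s) x - \sum_(j < m) (s ^+ j / j`!%:R) * k_ (n + j)%N r x =
     phi x ^+ n * (rot x (a_ n r x + s * phi x) -
        \sum_(j < m) rot x (a_ n r x + j%:R * (pi / 2)) * (s * phi x) ^+ j / j`!%:R).
    rewrite mulrBr; congr (_ - _); first by rewrite /k_ /a_; congr (_ * rot _ _); ring.
    rewrite mulr_sumr; apply: eq_bigr => j _; rewrite /k_ exprD exprMn.
    have -> : a_ (n + j)%N r x = a_ n r x + j%:R * (pi / 2) by rewrite /a_ natrD; ring.
    ring.
  rewrite normrM normrX (le_trans (ler_wpM2l _ (rot_taylor _ _ _ _))) ?exprn_ge0//.
  rewrite normrM exprMn.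
  have := bound (n + m)%N x; rewrite exprD -/N.
  set g := `|G1 x| + _; move=> hb.
  have -> : `|phi x| ^+ n * (g * (`|s| ^+ m * `|phi x| ^+ m) / m`!%:R) =
     (`|s| ^+ m / m`!%:R) * (`|phi x| ^+ n * `|phi x| ^+ m * g) by ring.
  rewrite [leRHS](_ : _ = (`|s| ^+ m / m`!%:R) * (N * Q x)); last by ring.
  by rewrite ler_wpM2l// divr_ge0 ?exprn_ge0.
- by move=> s sd; rewrite h0 flat.
Qed.

End quasianalytic_integral.

Section unique_continuation.
Context (R : realType) (d : nat).
Let V := 'rV[R]_d.+1.
Variable lam : {measure set (Rd R d.+1) -> \bar R}.
Hypothesis lamP : is_lebesgue lam.
Variables (theta : V -> R) (th : R -> R).
Hypothesis mtheta : measurable_fun [set: Rd R d.+1] theta.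
Hypothesis thE : forall x, theta x = th (enorm x).
Hypothesis th0 : forall r, 0 <= th r.
Hypothesis th_dec : forall s t, 0 <= s -> s <= t -> th t <= th s.
Hypothesis Ioo : Iint lam theta = +oo%E.

Let sum_unbounded B : exists n, B <= \sum_(k < n) th (k.+1%:R ^+ 4) / k.+1%:R.
Proof.
apply: contrapT => hB; have : (Iint lam theta < +oo)%E.
  apply: (sum_Iint_lty lamP mtheta thE th0 th_dec (S := B)) => n.
  by rewrite leNgt; apply/negP => /ltW hn; apply: hB; exists n.
by rewrite Ioo ltxx.
Qed.

(** A zero at [(j+1)^4] would persist from there on and bound the series. Positivity is what lets
    [nu] have [th] in its denominator. *)
Let th_gt0 (j : nat) : 0 < th (j.+1%:R ^+ 4).
Proof.
rewrite lt_neqAle th0 andbT; apply/eqP => hj.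
pose S := \sum_(k < j) th (k.+1%:R ^+ 4) / k.+1%:R.
have [n] := sum_unbounded (S + 1); apply/negP; rewrite -ltNge.
apply: (@le_lt_trans _ _ S); last by rewrite ltrDl.
have c0 k : 0 <= th (k.+1%:R ^+ 4) / k.+1%:R by rewrite divr_ge0.
rewrite /S -!(big_mkord xpredT (fun k => th (k.+1%:R ^+ 4) / k.+1%:R)).
have [nj|jn] := leqP n j; first by rewrite [leRHS](big_cat_nat (leq0n n) nj)//= lerDl sumr_ge0.
rewrite (big_cat_nat (leq0n j) (ltnW jn))//= gerDl big_nat big1// => k /andP[jk _].
have : th (k.+1%:R ^+ 4) <= th (j.+1%:R ^+ 4).
  by apply: th_dec; rewrite ?exprn_ge0// lerXn2r ?nnegrE// ler_nat.
by rewrite -hj le_eqVlt ltNge th0 orbF => /eqP ->; rewrite mul0r.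
Qed.

(** Restrict to the line through [x0] and [x], parametrized so that [x] is at [t = 1]. The phase is
    affine in [t] with slope [phi xi], and [|phi xi| <= c0 * enorm xi]; the 1 added in [c0] keeps it
    positive when [x = x0]. *)
Lemma unique_continuation (G1 G2 : V -> R) (c : R) (x0 : V) (rho : R) :
  measurable_fun [set: Rd R d.+1] G1 -> measurable_fun [set: Rd R d.+1] G2 ->
  lam.-integrable setT (EFin \o (fun xi : V => (`|G1 xi| + `|G2 xi|) *
     expR (theta xi * enorm xi + 4 * Num.sqrt (enorm xi)))) ->
  0 < rho ->
  (forall x : V, `|x - x0| < rho ->
     \int[lam]_xi (G1 xi * cos (c + 2 * pi * dotv xi x) +
                   G2 xi * cos (c + 2 * pi * dotv xi x + pi / 2)) = 0) ->
  forall x : V, \int[lam]_xi (G1 xi * cos (c + 2 * pi * dotv xi x) +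
                   G2 xi * cos (c + 2 * pi * dotv xi x + pi / 2)) = 0.
Proof.
move=> mG1 mG2 iG rho0 flat x.
pose u : V := x - x0.
pose phi (xi : V) := 2 * pi * dotv xi u.
pose al (xi : V) := c + 2 * pi * dotv xi x0.
have p0 : 0 < pi :> R := pi_gt0 R.
pose s := \sum_i `|u 0 i|; have s0 : 0 <= s by apply: sumr_ge0.
pose c0 := 2 * pi * s + 1; have c00 : 0 < c0 by rewrite ltr_wpDl// !mulr_ge0// ltW.
have phi_le xi : `|phi xi| <= c0 * enorm xi.
  have p2 : 0 <= 2 * pi :> R by rewrite mulr_ge0// ltW.
  rewrite /phi normrM (ger0_norm p2) dotvC.
  apply: (le_trans (ler_wpM2l p2 (dotv_le u xi))).
  by rewrite mulrA ler_wpM2r ?enorm_ge0// lerDl.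
pose nu (j : nat) := c0 * j.+1%:R / th (j.+1%:R ^+ 4).
have e (t : R) (y : V) (xi : V) : y = x0 + t *: u -> al xi + t * phi xi = c + 2 * pi * dotv xi y.
  by move=> ->; rewrite /al /phi !(dotvC xi) dotvDl dotvZl; ring.
pose Q (xi : V) := expR (th 0) * ((`|G1 xi| + `|G2 xi|) *
     expR (theta xi * enorm xi + 4 * Num.sqrt (enorm xi))).
have iQ : lam.-integrable setT (EFin \o Q) by exact: integrable_Zl.
have nu_gt0 j : 0 < nu j by rewrite divr_gt0// mulr_gt0.
have bound n (xi : V) : `|phi xi| ^+ n * (`|G1 xi| + `|G2 xi|) <= (\prod_(j < n) nu j) * Q xi.
  have h : `|phi xi| ^+ n <= expR (th 0) * expR (theta xi * enorm xi + 4 * Num.sqrt (enorm xi)) * \prod_(j < n) nu j.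
    rewrite thE; apply: le_trans (weight_power_le th0 th_dec th_gt0 n (ltW c00) (enorm_ge0 xi)).
    by rewrite lerXn2r ?nnegrE ?mulr_ge0 ?enorm_ge0// ltW.
  apply: (le_trans (ler_wpM2r _ h)); first by rewrite addr_ge0.
  by rewrite /Q le_eqVlt; apply/orP; left; apply/eqP; ring.
have nu_mono j k : (j <= k)%N -> nu j <= nu k.
  move=> jk; rewrite /nu; apply: ler_pM; rewrite ?mulr_ge0 ?invr_ge0// ?(ltW c00)//.
    by rewrite ler_wpM2l ?(ltW c00)// ler_nat.
  rewrite lef_pV2 ?posrE//; apply: th_dec; rewrite ?exprn_ge0//.
  by rewrite lerXn2r ?nnegrE// ler_nat.
have nu_div B : exists n, B <= \sum_(j < n) (nu j)^-1.
  have [n hn] := sum_unbounded (c0 * B); exists n; move: hn.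
  rewrite -ler_pdivlMl// mulr_sumr => /le_trans; apply; apply: ler_sum => j _.
  by rewrite /nu invf_div invfM le_eqVlt; apply/orP; left; apply/eqP; ring.
have delta0 : 0 < rho / (`|u| + 1) by rewrite divr_gt0// ltr_wpDl.
have := @quasianalytic_integral _ _ R lam G1 G2 phi al Q nu mG1 mG2 _ _ iQ _ bound nu_gt0 nu_mono nu_div _ delta0 _ 1.
have E t : (fun xi => G1 xi * cos (al xi + t * phi xi) + G2 xi * cos (al xi + t * phi xi + pi / 2)) =
  (fun xi => G1 xi * cos (c + 2 * pi * dotv xi (x0 + t *: u)) +
            G2 xi * cos (c + 2 * pi * dotv xi (x0 + t *: u) + pi / 2)).
  by apply/funext => xi; rewrite (e t _ xi erefl).
have xE : x0 + u = x by rewrite addrC subrK.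
rewrite E scale1r xE; apply => //.
- by apply: measurable_funM => //; exact: measurable_dotv.
- by apply: measurable_funD => //; apply: measurable_funM => //; exact: measurable_dotv.
- by move=> xi; rewrite !mulr_ge0 ?expR_ge0// addr_ge0.
- move=> t td; rewrite E; apply: flat; rewrite addrC addKr normrZ.
  move: td; rewrite ltr_pdivlMr ?ltr_wpDl// => td; apply: le_lt_trans td.
  by rewrite ler_wpM2l// lerDl.
Qed.

End unique_continuation.

(** * The Fourier transform on [L^p] *)

Section phase_shift.
Context (R : realType).
Implicit Types (w : R * R) (a : R).

(* The real part of [w * exp (i a)]. *)
Definition cyc w a : R := w.1 * cos a + w.2 * cos (a + pi / 2).

Lemma cycE w a : cyc w a = w.1 * cos a - w.2 * sin a.
Proof. by rewrite /cyc cosDpihalf mulrN. Qed.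

Lemma cyc0 w : cyc w 0 = w.1.
Proof. by rewrite cycE cos0 sin0 mulr1 mulr0 subr0. Qed.

Lemma cycNpihalf w : cyc w (- (pi / 2)) = w.2.
Proof. by rewrite cycE cosN cos_pihalf sinN sin_pihalf mulr0 add0r mulrN1 opprK. Qed.

Lemma cyc_norm_le w a : `|cyc w a| <= `|w.1| + `|w.2|.
Proof.
apply: (le_trans (ler_normD _ _)); rewrite !normrM.
by apply: lerD; rewrite ler_piMr// ler_norml cos_geN1 cos_le1.
Qed.

Lemma measurable_cyc d (T : measurableType d) (f : T -> R * R) (a : T -> R) :
  measurable_fun setT (fun x => (f x).1) -> measurable_fun setT (fun x => (f x).2) ->
  measurable_fun setT a -> measurable_fun setT (fun x => cyc (f x) (a x)).
Proof.
move=> m1 m2 ma; apply: measurable_funD; apply: measurable_funM => //.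
  exact: measurable_cos_comp.
by apply: measurable_cos_comp; apply: measurable_funD.
Qed.

End phase_shift.

(** * Parseval's formula for integrable functions *)

Section fourier_L1.
Context (R : realType) (d : nat).
Let V := 'rV[R]_d.
Variable lam : {measure set (Rd R d) -> \bar R}.
Hypothesis lamP : is_lebesgue lam.
Variable f : V -> R * R.
Hypothesis i1 : lam.-integrable setT (EFin \o (fun x : V => (f x).1)).
Hypothesis i2 : lam.-integrable setT (EFin \o (fun x : V => (f x).2)).

Let m1 : measurable_fun [set: Rd R d] (fun x : V => (f x).1) := integrable_measurable i1.
Let m2 : measurable_fun [set: Rd R d] (fun x : V => (f x).2) := integrable_measurable i2.

Let mph (xi : V) : measurable_fun [set: Rd R d] (fun y : V => 2 * pi * dotv y xi).
Proof. by apply: measurable_funM => //; exact: measurable_dotv. Qed.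

Let mulcos (g a : V -> R) : lam.-integrable setT (EFin \o g) ->
  measurable_fun [set: Rd R d] a -> lam.-integrable setT (EFin \o (fun y : V => g y * cos (a y))).
Proof.
move=> ig ma; apply: (integrable_mulbdd (c := 1) ig); first exact: measurable_cos_comp.
by move=> y; rewrite ler_norml cos_geN1 cos_le1.
Qed.

Let mulsin (g a : V -> R) : lam.-integrable setT (EFin \o g) ->
  measurable_fun [set: Rd R d] a -> lam.-integrable setT (EFin \o (fun y : V => g y * sin (a y))).
Proof.
move=> ig ma; apply: (integrable_mulbdd (c := 1) ig); last first.
  by move=> y; rewrite ler_norml sin_geN1 sin_le1.
exact: (measurableT_comp (continuous_measurable_fun (@continuous_sin R)) ma).
Qed.

Lemma ftL1_cyc (xi : V) a :
  cyc (ftL1 lam f xi) a = \int[lam]_y cyc (f y) (a - 2 * pi * dotv y xi).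
Proof.
pose A (y : V) := (f y).1 * cos (2 * pi * dotv y xi) + (f y).2 * sin (2 * pi * dotv y xi).
pose B (y : V) := (f y).2 * cos (2 * pi * dotv y xi) - (f y).1 * sin (2 * pi * dotv y xi).
have iA : lam.-integrable setT (EFin \o A).
  have h := integrableD measurableT (mulcos i1 (mph xi)) (mulsin i2 (mph xi)).
  by apply: (eq_integrable measurableT) h => y _ /=.
have iB : lam.-integrable setT (EFin \o B).
  have h := integrableB measurableT (mulcos i2 (mph xi)) (mulsin i1 (mph xi)).
  by apply: (eq_integrable measurableT) h => y _ /=.
rewrite /cyc /= -/(\int[lam]_y A y) -/(\int[lam]_y B y) mulrC [X in _ + X]mulrC.
rewrite -!(RintegralZl _ measurableT)// -RintegralD//; [|exact: integrable_Zl..].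
apply: eq_Rintegral => y _; rewrite -/(cyc (f y) _) cycE cosB sinB cosDpihalf /A /B; ring.
Qed.

Let jointly_measurable (Phi b : V -> R) :
  measurable_fun [set: Rd R d] Phi -> measurable_fun [set: Rd R d] b ->
  measurable_fun [set: Rd R d * Rd R d]
    (fun z => Phi z.1 * cyc (f z.2) (b z.1 - 2 * pi * dotv (z.2 : V) (z.1 : V))).
Proof.
move=> mP mb; apply: measurable_funM; first exact: (measurableT_comp mP).
apply: measurable_cyc; [exact: (measurableT_comp m1)|exact: (measurableT_comp m2)|].
apply: measurable_funB; first exact: (measurableT_comp mb).
apply: measurable_funM => //; apply: measurable_sum => i; apply: measurable_funM.
  exact: (measurableT_comp (measurable_coord i) measurable_snd).
exact: (measurableT_comp (measurable_coord i) measurable_fst).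
Qed.

Let iF : lam.-integrable setT (EFin \o (fun y : V => `|(f y).1| + `|(f y).2|)).
Proof.
have h := integrableD measurableT (integrable_abse i1) (integrable_abse i2).
by apply: (eq_integrable measurableT) h => y _ /=.
Qed.

Let icyc (a : V -> R) : measurable_fun [set: Rd R d] a ->
  lam.-integrable setT (EFin \o (fun y : V => cyc (f y) (a y))).
Proof.
move=> ma; apply: (@integrable_le _ _ _ lam (fun y : V => cyc (f y) (a y)) _ _ iF) => [|y].
  exact: measurable_cyc.
exact: cyc_norm_le.
Qed.

Let joint_le (Phi b : V -> R) (xi y : V) :
  `|Phi xi * cyc (f y) (b xi - 2 * pi * dotv y xi)| <= `|Phi xi| * (`|(f y).1| + `|(f y).2|).
Proof. by rewrite normrM ler_wpM2l// cyc_norm_le. Qed.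

Let sf := lebesgue_sigma_finite lamP.

(** Measurability of a parameter integral is obtained from Fubini, which asks for joint
    integrability; the positive integrable weight [w] is inserted for this and divided out. *)
Lemma measurable_cyc_ftL1 a : measurable_fun [set: Rd R d] (fun xi : V => cyc (ftL1 lam f xi) a).
Proof.
pose w := @cauchy_weight R d.
have iw : lam.-integrable setT (EFin \o w) := integrable_cauchy_weight lamP.
have mw := integrable_measurable iw.
have w0 xi : 0 < w xi by apply: prodr_gt0 => i _; rewrite invr_gt0 ltr_wpDr ?sqr_ge0.
have mm := @Rintegral_fubini_measurable1 _ _ _ _ R lam lam sf sf _ _ _
   (jointly_measurable mw (measurable_cst a)) (integrable_abse iw) iF (joint_le w (cst a)).
rewrite (_ : (fun xi => _) = fun xi => (w xi)^-1 * \int[lam]_y (w xi * cyc (f y) (a - 2 * pi * dotv y xi))).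
  by apply: measurable_funM mm; exact: (measurableT_comp (@measurable_invr R)).
apply/funext => xi; rewrite ftL1_cyc (RintegralZl _ measurableT) ?mulKf ?gt_eqF//.
by apply: icyc; apply: measurable_funB.
Qed.

Lemma cmeasurable_ftL1 : cmeasurable (ftL1 lam f).
Proof.
split; [have := measurable_cyc_ftL1 0|have := measurable_cyc_ftL1 (- (pi / 2))].
  by under eq_fun do rewrite cyc0.
by under eq_fun do rewrite cycNpihalf.
Qed.

(** After Fubini, the integral over [xi] is the inversion formula of [Phi] at [x - y], taken at the
    phases [c] and [c + pi / 2]. *)
Lemma parseval_L1 (phi Phi : V -> R) (kappa : R) (c : R) (x : V) :
  lam.-integrable setT (EFin \o Phi) ->
  (forall a (y : V), \int[lam]_xi (Phi xi * cos (a + 2 * pi * dotv xi y)) =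
                     cos a * (kappa * phi y)) ->
  lam.-integrable setT (EFin \o (fun y : V => phi (x - y) * cyc (f y) c)) ->
  \int[lam]_xi (Phi xi * cyc (ftL1 lam f xi) (c + 2 * pi * dotv xi x)) =
  kappa * \int[lam]_y (phi (x - y) * cyc (f y) c).
Proof.
move=> iP inv ip; have mP := integrable_measurable iP.
have mb : measurable_fun [set: Rd R d] (fun xi : V => c + 2 * pi * dotv xi x).
  by apply: measurable_funD => //; exact: mph.
transitivity (\int[lam]_xi \int[lam]_y
    (Phi xi * cyc (f y) (c + 2 * pi * dotv xi x - 2 * pi * dotv y xi))).
  apply: eq_Rintegral => xi _; rewrite ftL1_cyc (RintegralZl _ measurableT)//.
  by apply: icyc; apply: measurable_funB.
rewrite (@Rintegral_fubini _ _ _ _ R lam lam sf sf _ _ _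
   (jointly_measurable mP mb) (integrable_abse iP) iF (joint_le Phi _)) /=.
have icos a (y : V) : lam.-integrable setT (EFin \o (fun xi : V => Phi xi * cos (a + 2 * pi * dotv xi y))).
  by apply: mulcos => //; apply: measurable_funD => //; exact: mph.
have E (y : V) : \int[lam]_xi (Phi xi * cyc (f y) (c + 2 * pi * dotv xi x - 2 * pi * dotv y xi)) =
   kappa * (phi (x - y) * cyc (f y) c).
  transitivity (\int[lam]_xi ((f y).1 * (Phi xi * cos (c + 2 * pi * dotv xi (x - y))) +
                (f y).2 * (Phi xi * cos (c + pi / 2 + 2 * pi * dotv xi (x - y))))).
    apply: eq_Rintegral => xi _; rewrite /cyc.
    have -> : dotv xi (x - y) = dotv xi x - dotv y xi.
      by rewrite dotvC dotvDl dotvNl dotvC.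
    rewrite mulrDr; congr (_ + _); rewrite mulrCA; congr (_ * (_ * cos _)); ring.
  rewrite RintegralD//; [|exact: integrable_Zl..].
  rewrite (RintegralZl _ measurableT (icos _ _)) (RintegralZl _ measurableT (icos _ _)) !inv.
  by rewrite /cyc; ring.
rewrite -(RintegralZl _ measurableT ip); apply: eq_Rintegral => y _; exact: E.
Qed.

End fourier_L1.

Section complex_modulus.
Context (R : realType).
Implicit Types (w : R * R).

Lemma norm_re_le_cabs w : `|w.1| <= cabs w.
Proof. by rewrite -sqrtr_sqr ler_wsqrtr// lerDl sqr_ge0. Qed.

Lemma norm_im_le_cabs w : `|w.2| <= cabs w.
Proof. by rewrite -sqrtr_sqr ler_wsqrtr// lerDr sqr_ge0. Qed.

Lemma cyc_le_cabs w a : `|cyc w a| <= 2 * cabs w.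
Proof.
apply: (le_trans (cyc_norm_le w a)); rewrite mulr_natl mulr2n.
by apply: lerD; [exact: norm_re_le_cabs|exact: norm_im_le_cabs].
Qed.

Lemma cycB w w' a : cyc w a - cyc w' a = cyc (csub w w') a.
Proof. by rewrite /cyc /=; ring. Qed.

Lemma measurable_cabs d (T : measurableType d) (f : T -> R * R) :
  measurable_fun setT (fun x => (f x).1) -> measurable_fun setT (fun x => (f x).2) ->
  measurable_fun setT (fun x => cabs (f x)).
Proof.
move=> m1 m2; apply: (measurableT_comp (@measurable_sqrt R)); apply: measurable_funD; exact: measurable_funX.
Qed.

Lemma measurable_cabs_powR d (T : measurableType d) (f : T -> R * R) (p : R) :
  measurable_fun setT (fun x => (f x).1) -> measurable_fun setT (fun x => (f x).2) ->
  measurable_fun setT (fun x => cabs (f x) `^ p).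
Proof.
by move=> m1 m2; apply: (measurableT_comp (measurable_powR p)); exact: measurable_cabs.
Qed.

(** Either [a <= delta], or [a = a^p / a^(p-1) <= a^p / delta^(p-1)]. This plays the part of
    Hölder's inequality in the pairings below. *)
Lemma le_add_powR (a delta p : R) : 0 <= a -> 0 < delta -> 1 <= p ->
  a <= delta + a `^ p / delta `^ (p - 1).
Proof.
move=> a0 d0 p1; have D0 : 0 < delta `^ (p - 1) by exact: powR_gt0.
have [ad|da] := leP a delta; first by rewrite ler_wpDr// divr_ge0 ?powR_ge0.
apply: ler_wpDl; first exact: ltW.
have a00 : 0 < a by exact: lt_trans da.
rewrite ler_pdivlMr// -[X in a `^ X](subrK 1) (@powRD _ a); last by rewrite (gt_eqF a00) implybT.
rewrite powRr1// mulrC ler_wpM2r//; apply: ge0_ler_powR; rewrite ?nnegrE ?subr_ge0//; exact: ltW.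
Qed.

Lemma powR_ge_sub1 (a p : R) : 0 <= a -> 1 <= p -> a <= 1 + a `^ p.
Proof.
by move=> a0 p1; have := le_add_powR a0 ltr01 p1; rewrite powR1 divr1.
Qed.

End complex_modulus.

Section pairing_limit.
Context d (T : measurableType d) (R : realType) (mu : {measure set T -> \bar R}).
Variables (K a : T -> R) (u : nat -> T -> R * R) (v : T -> R * R) (p B : R).
Hypothesis p1 : 1 <= p.
Hypothesis iK : mu.-integrable setT (EFin \o K).
Hypothesis B0 : 0 <= B.
Hypothesis KB : forall x, `|K x| <= B.
Hypothesis mu1 : forall n, measurable_fun setT (fun x => (u n x).1).
Hypothesis mu2 : forall n, measurable_fun setT (fun x => (u n x).2).
Hypothesis mv1 : measurable_fun setT (fun x => (v x).1).
Hypothesis mv2 : measurable_fun setT (fun x => (v x).2).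
Hypothesis iu : forall n, mu.-integrable setT (EFin \o (fun x => K x * cyc (u n x) (a x))).
Hypothesis iv : mu.-integrable setT (EFin \o (fun x => K x * cyc (v x) (a x))).

(** Split at height [delta]: the lower part is controlled by the integral of [|K|], the upper part
    by [B] times the p-th power distance. The choices of [delta] and [e'] make each contribute at
    most [e / 2]; the added 1 avoids dividing by 0. *)
Lemma pairing_limit :
  ((\int[mu]_x (cabs (csub (u n x) (v x)) `^ p)%:E)%E @[n --> \oo] --> 0%E) ->
  \int[mu]_x (K x * cyc (u n x) (a x)) @[n --> \oo] --> \int[mu]_x (K x * cyc (v x) (a x)).
Proof.
move=> /fine_cvgP[finL /cvgrPdist_le cvgL]; apply/cvgrPdist_le => e e0.
pose I := \int[mu]_x `|K x|; have I0 : 0 <= I by apply: Rintegral_ge0.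
pose delta := e / (4 * (I + 1)); have d0 : 0 < delta by rewrite divr_gt0// mulr_gt0// ltr_wpDl.
pose D := delta `^ (p - 1); have D0 : 0 < D by exact: powR_gt0.
pose e' := D * e / (4 * (B + 1)); have e'0 : 0 < e' by rewrite divr_gt0 ?mulr_gt0// ltr_wpDl.
near=> n.
have fn : (\int[mu]_x (cabs (csub (u n x) (v x)) `^ p)%:E)%E \is a fin_num by near: n.
have Ln : fine (\int[mu]_x (cabs (csub (u n x) (v x)) `^ p)%:E)%E <= e'.
  have : `|0 - fine (\int[mu]_x (cabs (csub (u n x) (v x)) `^ p)%:E)%E| <= e'.
    by near: n; exact: cvgL.
  by rewrite sub0r normrN => /(le_trans (ler_norm _)).
have ip : mu.-integrable setT (EFin \o (fun x => cabs (csub (u n x) (v x)) `^ p)).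
  apply: integrable_ge0_lty => [|x|].
  - by apply: measurable_cabs_powR => /=; exact: measurable_funB.
  - exact: powR_ge0.
  - by rewrite ltey_eq fn.
have iaK : mu.-integrable setT (EFin \o (fun x => `|K x|)) by exact: (integrable_abse iK).
have iB : mu.-integrable setT (EFin \o (fun x => K x * cyc (v x) (a x) - K x * cyc (u n x) (a x))).
  by have h := integrableB measurableT iv (iu n); apply: (eq_integrable measurableT) h => x _ /=.
have iG : mu.-integrable setT (EFin \o (fun x => 2 * delta * `|K x| +
     2 * B / D * cabs (csub (u n x) (v x)) `^ p)).
  have h := integrableD measurableT (integrable_Zl (2 * delta) iaK) (integrable_Zl (2 * B / D) ip).
  by apply: (eq_integrable measurableT) h => x _ /=.
rewrite -(RintegralB measurableT iv (iu n)).
apply: (le_trans (normr_Rintegral_le iB iG _)) => [x|].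
  rewrite -mulrBr cycB normrM.
  set w := csub (v x) _; have wE : cabs w = cabs (csub (u n x) (v x)).
    by rewrite /cabs /w /= -sqrrN opprB -[X in _ + X]sqrrN opprB.
  rewrite -wE; apply: (@le_trans _ _ (`|K x| * (2 * (delta + cabs w `^ p / D)))).
    rewrite ler_wpM2l// (le_trans (cyc_le_cabs _ _))// ler_pM2l//.
    by apply: le_add_powR => //; exact: cabs_ge0.
  rewrite !mulrDr; apply: lerD; first by rewrite mulrC.
  rewrite (_ : 2 * B / D * _ = B * (2 * (cabs w `^ p / D))); last by ring.
  by rewrite ler_wpM2r// mulr_ge0// divr_ge0 ?powR_ge0// ltW.
rewrite (RintegralD measurableT (integrable_Zl _ iaK) (integrable_Zl _ ip)).
rewrite (RintegralZl _ measurableT iaK) (RintegralZl _ measurableT ip) -/I.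
have h1 : 2 * delta * I <= e / 2.
  have -> : 2 * delta * I = e / 2 * (I / (I + 1)).
    have E (J : R) : 0 <= J -> 2 * (e / (4 * (J + 1))) * J = e / 2 * (J / (J + 1)).
      by move=> J0; field; rewrite gt_eqF// ltr_wpDl.
    exact: E.
  by rewrite ler_piMr ?divr_ge0 ?(ltW e0)// ler_pdivrMr ?mul1r ?lerDl ?ltr_wpDl.
have h2 : 2 * B / D * (\int[mu]_x cabs (csub (u n x) (v x)) `^ p) <= e / 2.
  have c0 : 0 <= 2 * B / D by rewrite divr_ge0 ?mulr_ge0// ltW.
  apply: (le_trans (ler_wpM2l c0 Ln)); rewrite /e'.
  have -> : 2 * B / D * (D * e / (4 * (B + 1))) = e / 2 * (B / (B + 1)).
    by field; rewrite !gt_eqF// ltr_wpDl.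
  by rewrite ler_piMr ?divr_ge0 ?(ltW e0)// ler_pdivrMr ?mul1r ?lerDl ?ltr_wpDl.
lra.
Unshelve. all: by end_near.
Qed.

End pairing_limit.

Section fourier_Lp.
Context (R : realType) (d : nat).
Let V := 'rV[R]_d.
Variable lam : {measure set (Rd R d) -> \bar R}.
Hypothesis lamP : is_lebesgue lam.

Record test_pair (kappa : R) (phi Phi : V -> R) : Prop := TestPair {
  tp_shift : forall x : V, lam.-integrable setT (EFin \o (fun y : V => phi (x - y)));
  tp_bounded : exists B, forall y, `|phi y| <= B;
  tp_integrable : lam.-integrable setT (EFin \o Phi);
  tp_Bounded : exists B, forall xi, `|Phi xi| <= B;
  tp_inv : forall a (y : V),
    \int[lam]_xi (Phi xi * cos (a + 2 * pi * dotv xi y)) = cos a * (kappa * phi y)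
}.

Lemma inLp_integrable (p : R) (f : V -> R * R) : inLp lam p f ->
  lam.-integrable setT (EFin \o (fun x : V => cabs (f x) `^ p)).
Proof.
move=> [[m1 m2] foo]; apply: integrable_ge0_lty => // [|x]; last exact: powR_ge0.
exact: measurable_cabs_powR.
Qed.

Lemma inL1_integrable (f : V -> R * R) : inLp lam 1 f ->
  lam.-integrable setT (EFin \o (fun x : V => (f x).1)) /\
  lam.-integrable setT (EFin \o (fun x : V => (f x).2)).
Proof.
move=> h; have [[m1 m2] _] := h; have := inLp_integrable h.
under [EFin \o _]eq_fun do rewrite /= powRr1 ?cabs_ge0//.
move=> i; split.
  by apply: (@integrable_le _ _ _ lam _ (fun x : V => cabs (f x)) m1 i) => x; exact: norm_re_le_cabs.
by apply: (@integrable_le _ _ _ lam _ (fun x : V => cabs (f x)) m2 i) => x; exact: norm_im_le_cabs.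
Qed.

Lemma inLp_pairing_integrable (p B c : R) (f : V -> R * R) (K : V -> R) :
  1 <= p -> inLp lam p f -> lam.-integrable setT (EFin \o K) -> (forall y, `|K y| <= B) ->
  lam.-integrable setT (EFin \o (fun y : V => K y * cyc (f y) c)).
Proof.
move=> p1 fp iK KB; have [[m1 m2] _] := fp; have ip := inLp_integrable fp.
have iG : lam.-integrable setT (EFin \o (fun y : V => 2 * `|K y| + 2 * B * cabs (f y) `^ p)).
  have h := integrableD measurableT (integrable_Zl 2 (integrable_abse iK)) (integrable_Zl (2 * B) ip).
  by apply: (eq_integrable measurableT) h => y _ /=.
apply: (@integrable_le _ _ _ lam _ _ _ iG) => [|y].
  by apply: measurable_funM; [exact: integrable_measurable iK|exact: measurable_cyc].
rewrite normrM; apply: (@le_trans _ _ (`|K y| * (2 * (1 + cabs (f y) `^ p)))).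
  rewrite ler_wpM2l// (le_trans (cyc_le_cabs _ _))// ler_pM2l//.
  by apply: powR_ge_sub1 => //; exact: cabs_ge0.
rewrite !mulrDr mulr1 [2 * _ in leRHS]mulrC lerD2l -mulrA mulrCA ler_pM2l//.
by rewrite ler_wpM2r ?powR_ge0.
Qed.

Let mphase c (x : V) : measurable_fun [set: Rd R d] (fun xi : V => c + 2 * pi * dotv xi x).
Proof. by apply: measurable_funD => //; apply: measurable_funM => //; exact: measurable_dotv. Qed.

Lemma ftL1_bounded (f : V -> R * R) xi a : inLp lam 1 f ->
  `|cyc (ftL1 lam f xi) a| <= \int[lam]_y (`|(f y).1| + `|(f y).2|).
Proof.
move=> f1; have [i1 i2] := inL1_integrable f1; have [[m1 m2] _] := f1.
have iF : lam.-integrable setT (EFin \o (fun y : V => `|(f y).1| + `|(f y).2|)).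
  have h := integrableD measurableT (integrable_abse i1) (integrable_abse i2).
  by apply: (eq_integrable measurableT) h => y _ /=.
rewrite ftL1_cyc//; apply: (normr_Rintegral_le _ iF) => [|y]; last exact: cyc_norm_le.
apply: (@integrable_le _ _ _ lam _ _ _ iF) => [|y]; last exact: cyc_norm_le.
apply: measurable_cyc => //; apply: measurable_funB => //.
by apply: measurable_funM => //; exact: measurable_dotv.
Qed.

(** For [p = 1], [g] is only almost everywhere equal to the integral and may fail to be measurable,
    hence the representative [g']. For [p > 1], Parseval for the approximants passes to the limit by
    [pairing_limit], with exponent [p / (p - 1)] on the frequency side and [p] on the other. *)
Lemma fourier_parseval (p : R) (f g : V -> R * R) :
  1 <= p -> inLp lam p f -> is_fourier lam p f g ->
  exists g' : V -> R * R, [/\ {ae lam, forall xi, g xi = g' xi}, cmeasurable g' &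
    forall kappa phi Phi c (x : V), test_pair kappa phi Phi ->
      lam.-integrable setT (EFin \o (fun xi : V => Phi xi * (`|(g' xi).1| + `|(g' xi).2|))) ->
      \int[lam]_xi (Phi xi * cyc (g' xi) (c + 2 * pi * dotv xi x)) =
      kappa * \int[lam]_y (phi (x - y) * cyc (f y) c)].
Proof.
have P1 f1 kappa phi Phi c (x : V) : inLp lam 1 f1 -> test_pair kappa phi Phi ->
    \int[lam]_xi (Phi xi * cyc (ftL1 lam f1 xi) (c + 2 * pi * dotv xi x)) =
      kappa * \int[lam]_y (phi (x - y) * cyc (f1 y) c).
  move=> f1i [sh [B hB] iP _ inv]; have [i1 i2] := inL1_integrable f1i.
  apply: parseval_L1 => //.
  by apply: (inLp_pairing_integrable (B := B) (p := 1)) => // y.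
move=> p1 fp [[pE ae]|[/andP[p1' p2] [[mg1 mg2] [fn [fnp [cvgf cvgg]]]]]].
  subst p; exists (ftL1 lam f); split => //.
    by apply: cmeasurable_ftL1 => //; have [] := inL1_integrable fp.
  by move=> kappa phi Phi c x tp _; exact: P1.
exists g; split => [||kappa phi Phi c x tp ig]; [exact: aeW|by split|].
have [sh [B hB] iP [B' hB'] inv] := tp.
have [[mf1 mf2] _] := fp.
have B0 : 0 <= B by exact: le_trans (hB 0).
have B'0 : 0 <= B' by exact: le_trans (hB' 0).
have mft n : cmeasurable (ftL1 lam (fn n)).
  by apply: cmeasurable_ftL1 => //; have [] := inL1_integrable (fnp n).1.
have p'1 : 1 <= p / (p - 1) by rewrite ler_pdivlMr ?subr_gt0// mul1r gerBl.
have L := @pairing_limit _ _ R lam Phi (fun xi : V => c + 2 * pi * dotv xi x)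
  (fun n => ftL1 lam (fn n)) g _ B' p'1 iP B'0 hB'
  (fun n => (mft n).1) (fun n => (mft n).2) mg1 mg2 _ _ cvgg.
have L2 := @pairing_limit _ _ R lam (fun y : V => phi (x - y)) (fun=> c)
  fn f p B p1 (sh x) B0 (fun y => hB _)
  (fun n => (fnp n).1.1.1) (fun n => (fnp n).1.1.2) mf1 mf2 _ _ cvgf.
have {}L : \int[lam]_xi (Phi xi * cyc (ftL1 lam (fn n) xi) (c + 2 * pi * dotv xi x)) @[n --> \oo] -->
   \int[lam]_xi (Phi xi * cyc (g xi) (c + 2 * pi * dotv xi x)).
  apply: L => [n|].
    apply: (integrable_mulbdd (c := \int[lam]_y (`|(fn n y).1| + `|(fn n y).2|)) iP).
      by apply: measurable_cyc; [exact: (mft n).1|exact: (mft n).2|exact: mphase].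
    by move=> xi; apply: ftL1_bounded; exact: (fnp n).1.
  apply: (@integrable_le _ _ _ lam _ _ _ (integrable_abse ig)) => [|xi].
    apply: measurable_funM; first exact: integrable_measurable iP.
    exact: measurable_cyc.
  rewrite /= !normrM ler_wpM2l// [leRHS]ger0_norm ?addr_ge0//; exact: cyc_norm_le.
have {}L2 : \int[lam]_y (phi (x - y) * cyc (fn n y) c) @[n --> \oo] -->
   \int[lam]_y (phi (x - y) * cyc (f y) c).
  apply: L2 => [n|].
    exact: (inLp_pairing_integrable c (lexx 1) (fnp n).1 (sh x) (fun y => hB _)).
  exact: (inLp_pairing_integrable c p1 fp (sh x) (fun y => hB _)).
have {}L2 : \int[lam]_xi (Phi xi * cyc (ftL1 lam (fn n) xi) (c + 2 * pi * dotv xi x)) @[n --> \oo] -->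
   kappa * \int[lam]_y (phi (x - y) * cyc (f y) c).
  under eq_cvg do rewrite (P1 _ _ _ _ _ _ (fnp _).1 tp).
  exact: (cvgM (cvg_cst kappa) L2).
exact: (cvg_unique _ L L2).
Qed.

End fourier_Lp.

(** * Uniqueness *)

Section ae_comparison.
Context d (T : measurableType d) (R : realType) (mu : {measure set T -> \bar R}).

(** The majorant may be non-measurable, as the integrand of [growth_int] can be when [p = 1]; [f] is
    integrated off a null set and compared there. *)
Lemma ae_le_integral_lty (f g : T -> R) : measurable_fun setT f ->
  (forall x, 0 <= f x) -> (forall x, 0 <= g x) -> {ae mu, forall x, f x <= g x} ->
  (\int[mu]_x (g x)%:E < +oo)%E -> (\int[mu]_x (f x)%:E < +oo)%E.
Proof.
move=> mf f0 g0 [N [mN N0 hN]]; apply: le_lt_trans.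
rewrite (@ge0_negligible_integral _ _ _ mu setT N)//.
- rewrite integral_mkcond; apply: ge0_le_integral_sup => x; rewrite patchE.
    by case: ifPn => // _; rewrite lee_fin.
  case: ifPn => [|_]; last by rewrite lee_fin.
  rewrite inE => -[_ hx]; rewrite lee_fin leNgt; apply/negP => fg; apply: hx.
  by apply: hN => /= le; move: fg; rewrite ltNge le.
- exact/measurable_EFinP.
- by move=> x _; rewrite lee_fin.
Qed.

End ae_comparison.

(** * Integrability of the mollified transform against the weight *)

Section spectral_integrability.
Context (R : realType) (d : nat).
Let V := 'rV[R]_d.
Variable lam : {measure set (Rd R d) -> \bar R}.
Hypothesis lamP : is_lebesgue lam.

Lemma monomial_sum_le (I : Type) (s : seq I) (c : I -> R) (e : I -> 'I_d -> nat) :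
  exists C M, 0 <= C /\ forall xi : V,
    `|\sum_(m <- s) c m * \prod_i xi 0 i ^+ e m i| <= C * (1 + enorm xi) ^+ M.
Proof.
elim: s => [|m s [C [M [C0 IH]]]].
  by exists 0, 0%N; split=> // xi; rewrite big_nil normr0 mul0r.
pose E := (\sum_i e m i)%N.
exists (`|c m| + C), (E + M)%N; split=> [|xi]; first by rewrite addr_ge0.
have r1 : 1 <= 1 + enorm xi by rewrite lerDl enorm_ge0.
rewrite big_cons (le_trans (ler_normD _ _))// mulrDl; apply: lerD; last first.
  by apply: (le_trans (IH xi)); rewrite ler_wpM2l// ler_weXn2l// leq_addl.
rewrite normrM ler_wpM2l// normr_prod exprD.
apply: (@le_trans _ _ ((1 + enorm xi) ^+ E)); last first.
  by rewrite ler_peMr ?exprn_ge0 ?exprn_ege1// (le_trans ler01).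
rewrite /E -prodrXr; apply: ler_prod => i _; rewrite normr_ge0 normrX /=.
have r0 : 0 <= 1 + enorm xi by rewrite (le_trans ler01).
rewrite lerXn2r ?nnegrE//.
by rewrite (le_trans (coord_le_enorm xi i))// lerDr.
Qed.

Variables (theta : V -> R) (g g' : V -> R * R) (Phi : V -> R) (C : R).
Hypothesis mtheta : measurable_fun [set: Rd R d] theta.
Hypothesis mg' : cmeasurable g'.
Hypothesis gg' : {ae lam, forall xi, g xi = g' xi}.
Hypothesis mPhi : measurable_fun [set: Rd R d] Phi.
Hypothesis PhiC : forall xi,
  0 <= Phi xi <= C * (cauchy_weight xi * expR (- (5 * Num.sqrt (enorm xi)))).

Let aeF : Filter (almost_everywhere lam) := @ae_filter_ringOfSetsType _ (Rd R d) R lam.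

Let weight (xi : V) := expR (theta xi * enorm xi + 4 * Num.sqrt (enorm xi)).

Let mr : measurable_fun [set: Rd R d] (fun xi : V => enorm xi) := @measurable_enorm R d.

Let msr : measurable_fun [set: Rd R d] (fun xi : V => Num.sqrt (enorm xi)) :=
  @measurable_sqrt_enorm R d.

Let mexp (f : V -> R) : measurable_fun [set: Rd R d] f ->
  measurable_fun [set: Rd R d] (fun xi : V => expR (f xi)).
Proof. by move=> mf; exact: (measurableT_comp (@measurable_expR R)). Qed.

Let mweight : measurable_fun [set: Rd R d] weight.
Proof.
by apply: mexp; apply: measurable_funD; apply: measurable_funM.
Qed.

Let Phi0 xi : 0 <= Phi xi. Proof. by case/andP: (PhiC xi). Qed.

Let mcabs : measurable_fun [set: Rd R d] (fun xi : V => cabs (g' xi)).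
Proof. by apply: measurable_cabs; [exact: mg'.1|exact: mg'.2]. Qed.

Let CW0 : 0 <= C.
Proof.
have w0 (xi : V) : 0 < cauchy_weight xi.
  by apply: prodr_gt0 => i _; rewrite invr_gt0 ltr_wpDr ?sqr_ge0.
have := Phi0 0; case/andP: (PhiC 0) => _ /[swap] P0 /(le_trans P0).
by rewrite pmulr_lge0// mulr_gt0 ?expR_gt0.
Qed.

(** Here the five square roots are spent: four on the exponential factor, one on the power through
    [poly_exp_sqrt]. *)
Let Phi_poly (M : nat) : exists K, 0 <= K /\
  forall xi, Phi xi * expR (4 * Num.sqrt (enorm xi)) * (1 + enorm xi) ^+ M <= K * cauchy_weight xi.
Proof.
exists (C * (2 * M.+1%:R ^+ 2) ^+ M); split=> [|xi].
  by rewrite mulr_ge0// exprn_ge0// mulr_ge0// exprn_ge0.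
have h1 := poly_exp_sqrt M (enorm_ge0 xi); set r := enorm xi in h1 *.
set K := (2 * M.+1%:R ^+ 2) ^+ M in h1 *.
have [_ h2] := andP (PhiC xi).
apply: (@le_trans _ _ (C * (cauchy_weight xi * expR (- (5 * Num.sqrt r))) * expR (4 * Num.sqrt r) * (K * expR (Num.sqrt r)))).
  apply: ler_pM => //; rewrite ?mulr_ge0 ?expR_ge0 ?exprn_ge0 ?addr_ge0 ?enorm_ge0//.
  by rewrite ler_wpM2r ?expR_ge0.
have e : expR (- (5 * Num.sqrt r)) * expR (4 * Num.sqrt r) * expR (Num.sqrt r) = 1.
  by rewrite -!expRD -[RHS]expR0; congr expR; ring.
rewrite le_eqVlt; apply/orP; left; apply/eqP.
rewrite -[RHS]mulr1 -[X in _ = _ * X]e; ring.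
Qed.

Let A (xi : V) := cabs (g' xi) * weight xi * Phi xi.

Let mA : measurable_fun [set: Rd R d] A.
Proof. by apply: measurable_funM => //; exact: measurable_funM. Qed.

Let A0 xi : 0 <= A xi.
Proof. by rewrite !mulr_ge0 ?cabs_ge0 ?expR_ge0. Qed.

Let iw := integrable_cauchy_weight lamP.

Let cw0 := @cauchy_weight_ge0 R d.

(** With [u = cabs (g' xi) * exp(theta |xi|)], use [u <= 1 + u^q]. The 1 is integrated against
    [Phi]; the [u^q] is integrable by the growth condition because [Phi] absorbs the power [N] of
    [1 + |xi|]. *)
Let iA_growth (q N : R) : 1 <= q -> growth_int lam theta q N g ->
  lam.-integrable setT (EFin \o A).
Proof.
move=> q1 gr; pose J (xi : V) := (cabs (g' xi)) `^ q * expR (q * theta xi * enorm xi) / (1 + enorm xi) `^ N.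
have r0 xi : 0 < 1 + enorm xi :> R by rewrite ltr_wpDr ?enorm_ge0.
have mJ : measurable_fun [set: Rd R d] J.
  apply: measurable_funM; first apply: measurable_funM.
  - exact: (measurableT_comp (@measurable_powR R q)).
  - by apply: mexp; apply: measurable_funM => //; exact: measurable_funM.
  apply: (measurableT_comp (@measurable_invr R)); apply: (measurableT_comp (@measurable_powR R N)).
  exact: measurable_funD.
have J0 xi : 0 <= J xi by rewrite divr_ge0 ?powR_ge0// mulr_ge0 ?powR_ge0 ?expR_ge0.
have iJ : lam.-integrable setT (EFin \o J).
  apply: (@integrable_ge0_lty _ _ _ lam J mJ J0).
  apply: (@ae_le_integral_lty _ _ _ lam J (fun xi : V => (cabs (g xi)) `^ q * expR (q * theta xi * enorm xi) /
      (1 + enorm xi) `^ N) mJ J0 _ _ gr).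
    by move=> xi; rewrite divr_ge0 ?powR_ge0// mulr_ge0 ?powR_ge0 ?expR_ge0.
  by apply: (@filterS _ _ aeF _ _ _ gg') => xi gxi; rewrite /J gxi.
have [K0 [K00 hK0]] := Phi_poly 0.
pose M := (Num.truncn `|N|).+1; have [K [Kge0 hK]] := Phi_poly M.
have NM : N <= M%:R by rewrite (le_trans (ler_norm N))// ltW// truncnS_gt.
have h := integrableD measurableT (integrable_Zl K0 iw) (integrable_Zl K iJ).
have iG : lam.-integrable setT (EFin \o (fun xi : V => K0 * cauchy_weight xi + K * J xi)).
  by apply: (eq_integrable measurableT) h => y _ /=.
apply: (@integrable_le _ _ _ lam _ _ mA iG) => xi; rewrite ger0_norm//.
pose u := cabs (g' xi) * expR (theta xi * enorm xi).
pose W := Phi xi * expR (4 * Num.sqrt (enorm xi)).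
have W0 : 0 <= W by rewrite mulr_ge0 ?expR_ge0.
have -> : A xi = u * W by rewrite /A /weight expRD /u /W; ring.
have u0 : 0 <= u by rewrite mulr_ge0 ?cabs_ge0 ?expR_ge0.
apply: (le_trans (ler_wpM2r W0 (powR_ge_sub1 u0 q1))); rewrite mulrDl mul1r; apply: lerD.
  by have := hK0 xi; rewrite expr0 mulr1.
have uJ : u `^ q = J xi * (1 + enorm xi) `^ N.
  rewrite /J divfK ?gt_eqF ?powR_gt0// /u powRM ?cabs_ge0 ?expR_ge0// -expRM.
  by congr (_ * expR _); ring.
have hW : W * (1 + enorm xi) `^ N <= K.
  have hN : (1 + enorm xi) `^ N <= (1 + enorm xi) ^+ M.
    by rewrite -powR_mulrn ?ler_powR// ?lerDl ?enorm_ge0// ltW.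
  apply: (le_trans (ler_wpM2l W0 hN)); apply: (le_trans (hK xi)).
  by rewrite ler_piMr// cauchy_weight_le1.
by rewrite uJ -mulrA mulrC ler_wpM2r// mulrC.
Qed.

Let iA_poly (C1 : R) (P1 P2 : mpoly.mpoly d R) : 0 < C1 ->
  poly_bound lam theta C1 P1 P2 g -> lam.-integrable setT (EFin \o A).
Proof.
move=> C10 pb.
have [B1 [M1 [B10 hB1]]] := monomial_sum_le (mpoly.msupp P1) (fun m => mpoly.mcoeff m P1) (fun m i => mpoly.fun_of_multinom m i).
have [B2 [M2 [B20 hB2]]] := monomial_sum_le (mpoly.msupp P2) (fun m => mpoly.mcoeff m P2) (fun m i => mpoly.fun_of_multinom m i).
have [K [K0 hK]] := Phi_poly (M1 + M2).
pose G (xi : V) := C1 * (B1 + B2) * K * cauchy_weight xi.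
have iG : lam.-integrable setT (EFin \o G) by exact: integrable_Zl.
have G0 xi : 0 <= G xi by rewrite !mulr_ge0 ?addr_ge0// ltW.
apply: (@integrable_ge0_lty _ _ _ lam A mA A0); apply: (@ae_le_integral_lty _ _ _ lam A G mA A0 G0); last first.
  have := integrable_fin_num measurableT iG; rewrite fin_numE => /andP[_].
  by rewrite lt_neqAle leey andbT.
apply: (@filterS2 _ _ aeF _ _ _ _ gg' pb) => xi gxi hg.
have r1 : 1 <= 1 + enorm xi :> R by rewrite lerDl enorm_ge0.
have cP : cabs (mpoly.meval (fun i => xi 0 i) P1, mpoly.meval (fun i => xi 0 i) P2) <=
    (B1 + B2) * (1 + enorm xi) ^+ (M1 + M2).
  have h1 : cabs (mpoly.meval (fun i => xi 0 i) P1, mpoly.meval (fun i => xi 0 i) P2) <=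
      `|mpoly.meval (fun i => xi 0 i) P1| + `|mpoly.meval (fun i => xi 0 i) P2|.
    rewrite /cabs /=; set a := mpoly.meval _ P1; set b := mpoly.meval _ P2.
    rewrite -(ger0_norm (addr_ge0 (normr_ge0 a) (normr_ge0 b))) -sqrtr_sqr ler_wsqrtr//.
    by rewrite sqrrD !real_normK ?num_real// -addrA lerD2l lerDr mulrn_wge0// mulr_ge0.
  apply: (le_trans h1); rewrite mulrDl; apply: lerD.
    rewrite mpoly.mevalE; apply: (le_trans (hB1 xi)).
    by rewrite ler_wpM2l// ler_weXn2l// leq_addr.
  rewrite mpoly.mevalE; apply: (le_trans (hB2 xi)).
  by rewrite ler_wpM2l// ler_weXn2l// leq_addl.
rewrite /A -gxi /weight expRD.
have c1 : 0 <= C1 * (B1 + B2) by rewrite mulr_ge0 ?addr_ge0// ltW.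
apply: (@le_trans _ _ (C1 * (B1 + B2) * (Phi xi * expR (4 * Num.sqrt (enorm xi)) * (1 + enorm xi) ^+ (M1 + M2)))); last first.
  by rewrite /G -[leRHS]mulrA ler_wpM2l.
set e1 := expR (theta xi * enorm xi); set e2 := expR (4 * _).
have ee : expR (- (theta xi * enorm xi)) * e1 = 1 by rewrite -expRD addNr expR0.
have E : cabs (g xi) * e1 <= C1 * ((B1 + B2) * (1 + enorm xi) ^+ (M1 + M2)).
  apply: (le_trans (ler_wpM2r (expR_ge0 _) hg)); rewrite -[leLHS]mulrA -/e1 ee mulr1.
  by rewrite ler_wpM2l// ltW.
have p0 : 0 <= e2 * Phi xi by rewrite mulr_ge0 ?expR_ge0.
rewrite [leLHS](_ : _ = cabs (g xi) * e1 * (e2 * Phi xi)); last by ring.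
apply: (le_trans (ler_wpM2r p0 E)).
by rewrite le_eqVlt; apply/orP; left; apply/eqP; ring.
Qed.

Definition decay_condition : Prop :=
  (exists q N : R, 1 <= q /\ 0 <= N /\ growth_int lam theta q N g) \/
  (exists C : R, 0 < C /\ exists P1 P2 : mpoly.mpoly d R, poly_bound lam theta C P1 P2 g).

(** The integrability that [unique_continuation] asks of the two components of [Phi * g']. *)
Lemma decay_integrable : decay_condition ->
  lam.-integrable setT (EFin \o (fun xi : V =>
    (`|Phi xi * (g' xi).1| + `|Phi xi * (g' xi).2|) *
    expR (theta xi * enorm xi + 4 * Num.sqrt (enorm xi)))).
Proof.
move=> h; have iA : lam.-integrable setT (EFin \o A).
  case: h => [[q [N [q1 [_ h]]]]|[C1 [C10 [P1 [P2 h]]]]]; first exact: iA_growth h.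
  exact: iA_poly h.
have [m1 m2] := mg'.
apply: (@integrable_le _ _ _ lam _ _ _ (integrable_Zl 2 iA)) => [|xi].
  apply: measurable_funM; last exact: mweight.
  by apply: measurable_funD; apply: measurableT_comp => //; exact: measurable_funM.
rewrite ger0_norm ?mulr_ge0 ?expR_ge0// !normrM (ger0_norm (Phi0 xi)) -mulrDr /A /weight.
set e := expR _; rewrite (_ : 2 * _ = Phi xi * (2 * cabs (g' xi)) * e); last by ring.
rewrite ler_wpM2r ?expR_ge0// ler_wpM2l// mulr_natl mulr2n.
by apply: lerD; [exact: norm_re_le_cabs|exact: norm_im_le_cabs].
Qed.

End spectral_integrability.

Lemma decay_const_ge0 (R : realType) (X : R -> R) (C : R) :
  (forall s, 0 <= X s <= C * ((1 + s ^+ 2)^-1 * expR (- (5 * Num.sqrt `|s|)))) -> 0 <= C.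
Proof.
move=> /(_ 0) /andP[X0 /(le_trans X0)].
have w0 : 0 < (1 + (0 : R) ^+ 2)^-1 * expR (- (5 * Num.sqrt `|0 : R|)).
  by apply: mulr_gt0; [rewrite invr_gt0 ltr_wpDr ?sqr_ge0|exact: expR_gt0].
by rewrite pmulr_lge0.
Qed.

Section windows.
Context (R : realType) (d : nat).
Let V := 'rV[R]_d.
Variable lam : {measure set (Rd R d) -> \bar R}.
Hypothesis lamP : is_lebesgue lam.
Variables (iota eps rho : R) (chi X : R -> R) (h : 'I_d -> R) (C : R).
Hypothesis pairX : fourier_pair iota eps chi X.
Hypothesis h0 : forall i, 0 < h i.
Hypothesis hrho : forall i, eps + h i <= rho.
Hypothesis XC : forall s, 0 <= X s <= C * ((1 + s ^+ 2)^-1 * expR (- (5 * Num.sqrt `|s|))).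

(** Up to the factor [prod (2 h_i)], the indicator of a box with half-sides [h i], smoothed at scale
    [eps]. *)
Definition window (x : V) : R := prodf (fun i => avg (h i) chi) x.
Definition window_ft (xi : V) : R := prodf (fun i s => X s * sinc (2 * pi * (s * h i))) xi.

Let fp i : fourier_pair iota rho (avg (h i) chi) (fun s => X s * sinc (2 * pi * (s * h i))).
Proof. exact: fourier_pair_widen (hrho i) (fourier_pair_avg (h0 i) pairX). Qed.

Let iavg i : (@lebesgue_measure R).-integrable setT (EFin \o avg (h i) chi).
Proof.
have [M hM] := fp_bounded (fp i).
apply: (integrable_supported (M := M) (fp_measurable (fp i)) _ (fp_support (fp i))).
by move=> x; rewrite ger0_norm// (fp_ge0 (fp i)).
Qed.

Lemma window_ft_decay (xi : V) :
  `|window_ft xi| <= C ^+ d * (cauchy_weight xi * expR (- (5 * Num.sqrt (enorm xi)))).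
Proof.
have -> : `|window_ft xi| = prodf (fun i s => `|X s * sinc (2 * pi * (s * h i))|) xi.
  by rewrite /window_ft /prodf normr_prod.
have -> : - (5 * Num.sqrt (enorm xi)) = - ((fun=> 0) (enorm xi) * enorm xi) - 5 * Num.sqrt (enorm xi).
  by rewrite mul0r oppr0 add0r.
suff : forall i s, 0 <= `|X s * sinc (2 * pi * (s * h i))| <=
    C * ((1 + s ^+ 2)^-1 * expR (- ((fun=> 0) `|s| * `|s|) - 5 * Num.sqrt `|s|)).
  by move/(@prodf_decay R d _ (fun=> 0) C xi (fun _ _ => lexx 0) (fun _ _ _ _ => lexx 0)) => /andP[].
move=> i s; rewrite normr_ge0 /= mul0r oppr0 add0r normrM.
have /andP[X0 XCs] := XC s; apply: le_trans XCs.
by rewrite ger0_norm// ler_piMr// normr_sinc_le1.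
Qed.

Lemma window_test_pair : test_pair lam (iota ^+ d) window window_ft.
Proof.
split.
- move=> x; have -> : (fun y : V => window (x - y)) =
      prodf (fun i t => avg (h i) chi (-1 * t + x 0 i)).
    apply/funext => y; apply: eq_bigr => i _; rewrite !mxE mulN1r addrC//.
  apply: (integrable_prodf lamP) => i.
  have n1 : `|-1 : R| = 1 by rewrite normrN1.
  by have [] := @Rintegral_isometry R (-1) (x 0 i) (avg (h i) chi) n1 (iavg i).
- have hM i : exists M, forall x, avg (h i) chi x <= M := fp_bounded (fp i).
  pose M i := sval (cid (hM i)).
  exists (\prod_i M i) => y; rewrite /window /prodf normr_prod; apply: ler_prod => i _.
  rewrite normr_ge0 ger0_norm ?(fp_ge0 (fp i))//; exact: (svalP (cid (hM i))).
- exact: (prodf_integrable_ft lamP fp).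
- exists (C ^+ d) => xi; apply: (le_trans (window_ft_decay xi)).
  have C0 := decay_const_ge0 XC.
  rewrite ler_piMr ?exprn_ge0// mulr_ile1 ?cauchy_weight_ge0 ?expR_ge0 ?cauchy_weight_le1//.
- by move=> a y; exact: (prodf_inv lamP fp).
Qed.

Lemma window_support (z : V) i : rho < `|z 0 i| -> window z = 0.
Proof.
by move=> zi; rewrite /window /prodf (bigD1 i)//= (fp_support (fp i)) ?mul0r.
Qed.

End windows.

Lemma ae_zero_Rintegral d (T : measurableType d) (R : realType)
    (mu : {measure set T -> \bar R}) (f : T -> R) :
  measurable_fun setT f -> {ae mu, forall x, f x = 0} -> \int[mu]_x f x = 0.
Proof.
move=> mf f0; rewrite /Rintegral (ae_eq_integral (cst 0%E)) ?integral0//.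
  exact/measurable_EFinP.
case: f0 => N [mN N0 hN]; exists N; split=> // x /= h; apply: hN => /= e; apply: h => _.
by rewrite e.
Qed.

Section annihilation.
Context (R : realType) (d : nat).
Let V := 'rV[R]_d.+1.
Variable lam : {measure set (Rd R d.+1) -> \bar R}.
Hypothesis lamP : is_lebesgue lam.
Variables (theta : V -> R) (th : R -> R).
Hypothesis theta0 : forall xi, 0 <= theta xi.
Hypothesis mtheta : measurable_fun [set: Rd R d.+1] theta.
Hypothesis thE : forall x, theta x = th (enorm x).
Hypothesis th0 : forall r, 0 <= th r.
Hypothesis th_dec : forall s t, 0 <= s -> s <= t -> th t <= th s.
Hypothesis Ioo : Iint lam theta = +oo%E.
Variables (p : R) (f g : V -> R * R).
Hypothesis p1 : 1 <= p.
Hypothesis fp : inLp lam p f.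
Hypothesis fg : is_fourier lam p f g.
Hypothesis gdecay : decay_condition lam theta g.
Variables (U : set V) (x0 : V) (rho : R).
Hypothesis rho0 : 0 < rho.
Hypothesis Ux0 : forall y : V, (forall i, `|y 0 i - x0 0 i| <= 2 * rho) -> U y.
Hypothesis fU : {ae lam, forall x, U x -> f x = (0, 0)}.

Lemma window_annihilates (eps : R) (chi X : R -> R) (h : 'I_d.+1 -> R) (C : R) :
  fourier_pair (sincK R / pi) eps chi X ->
  (forall s, 0 <= X s <= C * ((1 + s ^+ 2)^-1 * expR (- (5 * Num.sqrt `|s|)))) ->
  (forall i, 0 < h i) -> (forall i, eps + h i <= rho) ->
  forall c (x : V), \int[lam]_y (window chi h (x - y) * cyc (f y) c) = 0.
Proof.
move=> pairX XC h0 hrho c x; set phi := window chi h.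
have tp := window_test_pair lamP pairX h0 hrho XC.
set kappa := _ ^+ d.+1 in tp; have kappa0 : kappa != 0.
  by rewrite expf_neq0// gt_eqF// divr_gt0 ?sincK_gt0 ?pi_gt0.
have [g' [gg' mg' pars]] := fourier_parseval lamP p1 fp fg.
(* [decay_integrable] takes a nonnegative function, while [window_ft] may change sign; it is applied
   to the majorant [B] and the result transferred by [PhiB]. *)
pose B (xi : V) := cauchy_weight xi * expR (- (5 * Num.sqrt (enorm xi))).
have icw := integrable_cauchy_weight lamP.
have B0 xi : 0 <= B xi by rewrite mulr_ge0 ?cauchy_weight_ge0 ?expR_ge0.
have mB : measurable_fun [set: Rd R d.+1] B.
  apply: measurable_funM; first exact: integrable_measurable icw.
  apply: (measurableT_comp (@measurable_expR R)); apply: measurableT_comp => //.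
  by apply: measurable_funM => //; exact: (@measurable_sqrt_enorm R d.+1).
have BB xi : 0 <= B xi <= 1 * B xi by rewrite B0 mul1r lexx.
have iB := @decay_integrable R d.+1 lam lamP theta g g' B 1 mtheta mg' gg' mB
  BB gdecay.
pose Phi := window_ft X h.
have PhiB (xi : V) : `|Phi xi| <= C ^+ d.+1 * B xi by exact: window_ft_decay.
have mPhi : measurable_fun [set: Rd R d.+1] Phi := integrable_measurable (tp_integrable tp).
have [mg1 mg2] := mg'.
have C0 : 0 <= C ^+ d.+1.
  by rewrite exprn_ge0// (decay_const_ge0 XC).
pose W (xi : V) := expR (theta xi * enorm xi + 4 * Num.sqrt (enorm xi)).
have W1 xi : 1 <= W xi.
  by rewrite -expR0 ler_expR addr_ge0// mulr_ge0 ?enorm_ge0 ?sqrtr_ge0.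
have mW : measurable_fun [set: Rd R d.+1] W.
  apply: (measurableT_comp (@measurable_expR R)); apply: measurable_funD.
    by apply: measurable_funM => //; exact: measurable_enorm.
  by apply: measurable_funM => //; exact: (@measurable_sqrt_enorm R d.+1).
have iG : lam.-integrable setT (EFin \o (fun xi : V =>
    (`|Phi xi * (g' xi).1| + `|Phi xi * (g' xi).2|) * W xi)).
  apply: (@integrable_le _ _ _ lam _ _ _ (integrable_Zl (C ^+ d.+1) iB)) => [|xi].
    apply: measurable_funM => //.
    by apply: measurable_funD; apply: measurableT_comp => //; exact: measurable_funM.
  have W0 : 0 <= W xi by exact: le_trans (W1 xi).
  rewrite ger0_norm ?mulr_ge0// -/(W xi) mulrA ler_wpM2r// 2!(normrM (Phi xi)) 2!(normrM (B xi)) -!mulrDr (ger0_norm (B0 xi)) mulrA.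
  by rewrite ler_wpM2r ?addr_ge0.
have iP : lam.-integrable setT (EFin \o (fun xi : V => Phi xi * (`|(g' xi).1| + `|(g' xi).2|))).
  apply: (@integrable_le _ _ _ lam _ _ _ iG) => [|xi].
    apply: measurable_funM => //.
    by apply: measurable_funD; apply: measurableT_comp.
  rewrite !normrM -mulrDr [X in _ * X <= _]ger0_norm ?addr_ge0//.
  by rewrite ler_peMr// mulr_ge0 ?addr_ge0.
have {}pars x' := pars kappa phi Phi c x' tp iP.
(* A window centred within [rho] of [x0] sees only points within [2 * rho] of [x0], where [f]
   vanishes. *)
have F0 (x' : V) : (forall i, `|x' 0 i - x0 0 i| <= rho) ->
    \int[lam]_xi (Phi xi * cyc (g' xi) (c + 2 * pi * dotv xi x')) = 0.
  move=> xx0; rewrite pars; apply/eqP; rewrite mulf_eq0 (negbTE kappa0)/=; apply/eqP.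
  have [[mf1 mf2] _] := fp.
  apply: ae_zero_Rintegral.
    apply: measurable_funM; last exact: measurable_cyc.
    exact: integrable_measurable (tp_shift tp x').
  case: fU => N [mN N0 hN]; exists N; split=> // y hy; apply: hN => /= fy.
  apply: hy => /=; have [Uy|nUy] := pselect (U y).
    by rewrite fy// /cyc /= !mul0r addr0 mulr0.
  have [i hi] : exists i, rho < `|(x' - y) 0 i|.
    apply: contrapT => hx; apply: nUy; apply: Ux0 => i.
    rewrite -(subrK (x' 0 i) (y 0 i)) -addrA (le_trans (ler_normD _ _))//.
    rewrite mulr_natl mulr2n; apply: lerD => //.
    by rewrite distrC leNgt; apply/negP => hi; apply: hx; exists i; rewrite !mxE.
  by rewrite /phi (window_support pairX h0 hrho hi) mul0r.
have e (xi y : V) : Phi xi * cyc (g' xi) (c + 2 * pi * dotv xi y) =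
   Phi xi * (g' xi).1 * cos (c + 2 * pi * dotv xi y) +
   Phi xi * (g' xi).2 * cos (c + 2 * pi * dotv xi y + pi / 2).
  by rewrite /cyc; ring.
have U0 := @unique_continuation R d lam lamP theta th mtheta thE th0 th_dec Ioo
  (fun xi => Phi xi * (g' xi).1) (fun xi => Phi xi * (g' xi).2) c x0 rho
  (measurable_funM mPhi mg1) (measurable_funM mPhi mg2) iG rho0 _ x.
apply/eqP; have := pars x; under eq_Rintegral do rewrite e.
rewrite U0; first by move/esym/eqP; rewrite mulf_eq0 (negbTE kappa0).
move=> y yx0; rewrite -[RHS](F0 y).
  by apply: eq_Rintegral => xi _; rewrite e.
move=> i; apply: (le_trans _ (ltW yx0)).
have -> : y 0 i - x0 0 i = (y - x0) 0 i by rewrite !mxE.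
have -> : `|y - x0| = mx_norm (y - x0) by [].
by rewrite mx_normrE; exact: (le_bigmax _ (fun ij : 'I_1 * 'I_d.+1 => `|(y - x0) ij.1 ij.2|) (ord0, i)).
Qed.

End annihilation.

Section mollified_interval.
Context (R : realType).
Local Notation mu := (@lebesgue_measure R).
Variables (iota eps h : R) (chi X : R -> R).
Hypothesis pairX : fourier_pair iota eps chi X.
Hypothesis X1 : X 0 = 1.
Hypothesis h0 : 0 < h.

Let ichi : mu.-integrable setT (EFin \o chi).
Proof.
have [M hM] := fp_bounded pairX.
apply: (integrable_supported (M := M) (fp_measurable pairX) _ (fp_support pairX)).
by move=> x; rewrite ger0_norm// (fp_ge0 pairX).
Qed.

Let chi1 : \int[mu]_t chi t = 1.
Proof.
have := fp_ft pairX 0 0; rewrite X1 cos0 mulr1 => <-.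
by apply: eq_Rintegral => x _; rewrite !mulr0 addr0 cos0 mulr1.
Qed.

Let shift z : mu.-integrable setT (EFin \o (fun t => chi (z + t))) /\ \int[mu]_t chi (z + t) = 1.
Proof.
have [i e] := @Rintegral_isometry R 1 z chi (normr1 R) ichi.
have E : (fun t => chi (1 * t + z)) = (fun t => chi (z + t)).
  by apply/funext => t; rewrite mul1r addrC.
by rewrite E in i e; rewrite e chi1.
Qed.

(** [chi] has total mass [X 0 = 1], and all of it falls inside [[-h, h]] when translated by at most
    [h - eps]. *)
Lemma avg_plateau z : `|z| <= h - eps -> 2 * h * avg h chi z = 1.
Proof.
move=> zh; rewrite /avg mulVKf ?mulf_neq0 ?gt_eqF//.
rewrite -(shift z).2; apply: eq_Rintegral => t _; rewrite indicE.
case: (boolP (t \in _)) => [_|]; first by rewrite mul1r.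
rewrite notin_setE /= in_itv/= => /negP; rewrite -ler_norml -ltNge => ht.
have -> : chi (z + t) = 0; last by rewrite mulr0.
apply: (fp_support pairX); have := ler_normB (z + t) z.
by rewrite [z + t]addrC addrK; lra.
Qed.

Lemma avg_le1 z : 0 <= 2 * h * avg h chi z <= 1.
Proof.
apply/andP; split.
  apply: mulr_ge0; first by rewrite mulr_ge0// ltW.
  exact: (avg_ge0 z h0 (fp_ge0 pairX)).
rewrite /avg mulVKf ?mulf_neq0 ?gt_eqF// -(shift z).2.
have [M hM] := fp_bounded pairX.
have hM' x : `|chi x| <= M by rewrite ger0_norm ?(fp_ge0 pairX).
apply: le_Rintegral => //; first exact: (integrable_avg _ _ (fp_measurable pairX) hM').
  exact: (shift z).1.
move=> t _; rewrite ler_piMl ?(fp_ge0 pairX)// indicE; by case: (_ \in _).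
Qed.

Lemma avg_outside z : h + eps < `|z| -> 2 * h * avg h chi z = 0.
Proof.
move=> hz; rewrite (avg_support (L := eps)) ?mulr0//; last by rewrite addrC.
by move=> x; exact: (fp_support pairX).
Qed.

End mollified_interval.

(** * A function with zero integral over small boxes vanishes *)

Section boxes.
Context (R : realType) (d : nat).
Let V := 'rV[R]_d.
Variable lam : {measure set (Rd R d) -> \bar R}.
Variables (k : V -> R) (w : R).
Hypothesis w0 : 0 < w.
Hypothesis ik : forall a b, lam.-integrable setT (EFin \o (fun y : V => \1_(cbox a b) y * k y)).
Hypothesis k_box : forall a b : V, (forall i, a 0 i <= b 0 i <= a 0 i + w) ->
  \int[lam]_y (\1_(cbox a b) y * k y) = 0.

Let k_box' (a b : V) : (forall i, b 0 i <= a 0 i + w) -> \int[lam]_y (\1_(cbox a b) y * k y) = 0.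
Proof.
move=> ab; have [h|h] := pselect (forall i, a 0 i <= b 0 i).
  by apply: k_box => i; rewrite h ab.
transitivity (\int[lam]_y (cst 0 y : R)); last by rewrite Rintegral_cst// mul0r.
apply: eq_Rintegral => y _; rewrite indicE memNset ?mul0r// => hy; apply: h => i.
by have /andP[h1 h2] := hy i; exact: le_trans h2.
Qed.

(** Dynkin induction: a box meets the given small box in a box that is again small, and the sets
    satisfying the identity are closed under complements and disjoint unions. *)
Let box_measurable (a b : V) : (forall i, b 0 i <= a 0 i + w) ->
  forall A : set (Rd R d), measurable A -> \int[lam]_y (\1_A y * (\1_(cbox a b) y * k y)) = 0.
Proof.
move=> ab; have ikQ := ik a b; set kQ := fun y => _ in ikQ *.
have iA (A : set (Rd R d)) : measurable A ->
    lam.-integrable setT (EFin \o (fun y : V => \1_A y * kQ y)).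
  move=> mA; apply: (@integrable_le _ _ _ lam _ _ _ (integrable_abse ikQ)) => [|y].
    by apply: measurable_funM; [exact: measurable_indic|exact: integrable_measurable ikQ].
  by rewrite normrM /= indicE; case: (_ \in _); rewrite ?normr1 ?normr0 ?mul1r ?mul0r.
rewrite measurable_RdE; apply: (@dynkin_induction _ (Rd R d) [set A | exists a b, A = cbox a b]
    (fun A => \int[lam]_y (\1_A y * kQ y) = 0)).
- exact: measurable_RdE.
- by move=> _ _ [a1 [b1 ->]] [a2 [b2 ->]]; rewrite cboxI; do 2 eexists.
- under eq_Rintegral do rewrite indicT mul1r.
  exact: k_box'.
- move=> _ [a' [b' ->]].
  rewrite -[RHS](k_box' (a := \row_i Num.max (a 0 i) (a' 0 i)) (b := \row_i Num.min (b 0 i) (b' 0 i))).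
    apply: eq_Rintegral => y _; rewrite -cboxI /kQ indicI mulrA; congr (_ * _).
    by rewrite mulrC.
  move=> i; rewrite !mxE ge_min; apply/orP; left.
  by apply: (le_trans (ab i)); rewrite lerD2r le_max lexx.
- move=> A mA h.
  have -> : (fun y => \1_(~` A) y * kQ y) = (fun y => kQ y - \1_A y * kQ y).
    by apply/funext => y; rewrite !indicE in_setC; case: (y \in A); rewrite /= ?mul1r ?mul0r ?subrr ?subr0.
  by rewrite (RintegralB measurableT ikQ (iA _ mA)) h subr0; exact: k_box'.
- move=> F mF tF hF.
  have mU : measurable (\bigcup_k F k) by exact: bigcupT_measurable.
  (* By disjointness the partial sums at [y] jump at most once, from 0 to [kQ y]. *)
  have sumF (y : V) : (exists j : nat, (forall n, \sum_(i < n) \1_(F i) y * kQ y = (j < n)%N%:R * kQ y) /\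
      \1_(\bigcup_k F k) y = 1 :> R) \/
      ((forall n, \sum_(i < n) \1_(F i) y * kQ y = 0) /\ \1_(\bigcup_k F k) y = 0 :> R).
    have [[j _ Fj]|nF] := pselect ((\bigcup_k F k) y); last first.
      right; split=> [n|]; last by rewrite indicE memNset.
      by rewrite big1// => i _; rewrite indicE memNset ?mul0r// => Fi; apply: nF; exists (i : nat).
    left; exists j; split=> [n|]; last by rewrite indicE mem_set//; exists j.
    have Fi (i : nat) : \1_(F i) y = (i == j)%:R :> R.
      rewrite indicE; congr (_%:R); congr nat_of_bool; apply/idP/eqP => [|->]; last by rewrite inE.
      by rewrite inE => Fi; apply: tF => //; exists y.
    under eq_bigr do rewrite Fi.
    have [jn|nj] := ltnP j n; last first.
      rewrite mul0r big1// => i _; rewrite (_ : (i : nat) == j = false) ?mul0r//.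
      by apply/negbTE; rewrite neq_ltn (leq_trans (ltn_ord i)).
    rewrite (bigD1 (Ordinal jn))//= eqxx big1 ?addr0// => i ij.
    by rewrite (_ : (i : nat) == j = false) ?mul0r//; apply/negbTE.
  have [] := @Rintegral_dominated _ _ R lam (fun n y => \sum_(i < n) \1_(F i) y * kQ y)
    (fun y => \1_(\bigcup_k F k) y * kQ y) (fun y => `|kQ y|).
  + by move=> n; apply: measurable_sum => i; exact: (integrable_measurable (iA _ (mF i))).
  + move=> y; have [[j [sE ->]]|[sE ->]] := sumF y.
      rewrite mul1r; apply: cvg_near_cst; exists j.+1 => // n /= jn.
      by rewrite sE jn mul1r.
    by rewrite mul0r; apply: cvg_near_cst; exists 0%N => // n _; rewrite sE.
  + exact: (integrable_abse ikQ).
  + move=> n y; have [[j [sE _]]|[sE _]] := sumF y; rewrite sE ?normr0//.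
    by case: (j < n)%N; rewrite ?mul1r ?mul0r ?normr0.
  + move=> _; under eq_cvg => n.
      rewrite (Rintegral_sum_seq _ (fun i : 'I_n => iA _ (mF i))) big1; last by move=> i _; exact: hF.
      over.
    by move=> h; exact: (cvg_unique _ h (cvg_cst 0)).
Qed.

(** Testing with the set where [kQ] is positive and with its complement shows that [|kQ|] has
    integral 0. *)
Let k_ae_box (a b : V) : (forall i, b 0 i <= a 0 i + w) ->
  {ae lam, forall y, cbox a b y -> k y = 0}.
Proof.
move=> ab; have ikQ := ik a b; set kQ := fun y => _ in ikQ *.
have mkQ := integrable_measurable ikQ.
pose P : set (Rd R d) := [set y | 0 < kQ y]; pose N : set (Rd R d) := ~` P.
have mP : measurable P.
  rewrite (_ : P = kQ @^-1` `]0, +oo[%classic); last by apply/seteqP; split=> y; rewrite /= in_itv/= andbT.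
  by rewrite -[X in measurable X]setTI; apply: mkQ => //; exact: measurable_itv.
have mN : measurable N by exact: measurableC.
have hP := box_measurable ab mP; have hN := box_measurable ab mN.
have iA (A : set (Rd R d)) : measurable A ->
    lam.-integrable setT (EFin \o (fun y : V => \1_A y * kQ y)).
  move=> mA; apply: (@integrable_le _ _ _ lam _ _ _ (integrable_abse ikQ)) => [|y].
    by apply: measurable_funM; [exact: measurable_indic|].
  by rewrite normrM /= indicE; case: (_ \in _); rewrite ?normr1 ?normr0 ?mul1r ?mul0r.
have h0 : \int[lam]_y `|kQ y| = 0.
  rewrite -[RHS](subrr 0) -[in X in _ = X - _]hP -[in RHS]hN -(RintegralB measurableT (iA _ mP) (iA _ mN)).
  apply: eq_Rintegral => y _; rewrite /N !indicE in_setC.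
  have [yP|yP] := boolP (y \in P).
    by rewrite mul0r subr0 mul1r gtr0_norm//; move: yP; rewrite inE.
  rewrite mul0r mul1r sub0r ler0_norm//.
  by move: yP; rewrite notin_setE /P /= => /negP; rewrite -leNgt.
have h1 : (\int[lam]_(y in setT) `|(EFin \o kQ) y| = 0)%E.
  have := integrable_fin_num measurableT (integrable_abse ikQ).
  by move=> /fineK <-; congr EFin.
have mE : measurable_fun [set: Rd R d] (EFin \o kQ) by exact/measurable_EFinP.
have [M [mM M0 hM]] := (ae_eq_integral_abs lam measurableT mE).1 h1.
exists M; split=> // y hy; apply: hM => /= e; apply: hy => /= yab.
by have := e I; rewrite /kQ indicE mem_set// mul1r => -[].
Qed.

(** The countably many cubes of half-side [w / 4] with rational centres cover the space, and their
    side [w / 2] is small enough for [k_ae_box]. *)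
Lemma ae_zero_of_small_boxes : {ae lam, forall y, k y = 0}.
Proof.
pose r : R := w / 4; have r0 : 0 < r by rewrite divr_gt0.
pose Q (q : 'rV[rat]_d) : set V := cbox (\row_i (ratr (q 0 i) - r)) (\row_i (ratr (q 0 i) + r)).
have aeQ q : {ae lam, forall y, Q q y -> k y = 0}.
  by apply: k_ae_box => i; rewrite !mxE /r; move: (ratr _) w0 => t w00; lra.
pose F (n : nat) : set (Rd R d) := if unpickle n is Some q then [set y | ~ (Q q y -> k y = 0)] else set0.
have nF n : lam.-negligible (F n).
  by rewrite /F; case: unpickle => [q|]; [exact: aeQ|exact: negligible_set0].
have [M [mM M0 hM]] := negligible_bigcup nF.
exists M; split=> // y /= ky; apply: hM.
have /choice[q hq] : forall i, exists q : rat, ratr q \in `]y 0 i - r, y 0 i + r[.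
  by move=> i; apply: rat_in_itvoo; lra.
exists (pickle (\row_i q i)) => //; rewrite /F pickleK /= => h; apply: ky; apply: h => i.
rewrite !mxE; move: (hq i); rewrite in_itv/=. lra.
Qed.

End boxes.

Section vanishing.
Context (R : realType) (d : nat).
Let V := 'rV[R]_d.
Variable lam : {measure set (Rd R d) -> \bar R}.
Hypothesis lamP : is_lebesgue lam.
Variables (p rho : R) (f : V -> R * R) (c : R).
Hypothesis p1 : 1 <= p.
Hypothesis fp : inLp lam p f.
Hypothesis rho0 : 0 < rho.
Hypothesis annih : forall (eps : R) (chi X : R -> R) (h : 'I_d -> R) (C : R),
  fourier_pair (sincK R / pi) eps chi X ->
  (forall s, 0 <= X s <= C * ((1 + s ^+ 2)^-1 * expR (- (5 * Num.sqrt `|s|)))) ->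
  (forall i, 0 < h i) -> (forall i, eps + h i <= rho) ->
  forall x : V, \int[lam]_y (window chi h (x - y) * cyc (f y) c) = 0.

Let k (y : V) := cyc (f y) c.

Let mk : measurable_fun [set: Rd R d] k.
Proof. by have [[m1 m2] _] := fp; exact: measurable_cyc. Qed.

Let ik (a b : V) : lam.-integrable setT (EFin \o (fun y : V => \1_(cbox a b) y * k y)).
Proof.
have mb : measurable (cbox a b : set (Rd R d)) by exact: measurable_cbox.
apply: (inLp_pairing_integrable (B := 1) c p1 fp) => [|y]; last first.
  by rewrite indicE; case: (_ \in _); rewrite ?normr1 ?normr0.
apply: (@integrable_ge0_lty _ _ _ lam); [exact: measurable_indic|by move=> y; rewrite indicE|].
by rewrite (integral_indic _ measurableT mb) setIT; exact: lebesgue_cbox_lty.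
Qed.

(** Ingham's construction with [th = 0]: the decay [exp(- 5 sqrt |s|)] alone, on a support as small
    as desired. *)
Let mollifier (eps : R) : 0 < eps -> exists chi X C,
  [/\ fourier_pair (sincK R / pi) eps chi X, X 0 = 1 &
    forall s, 0 <= X s <= C * ((1 + s ^+ 2)^-1 * expR (- (5 * Num.sqrt `|s|)))].
Proof.
move=> eps0; have half0 : (0 : R) <= 2^-1 by [].
have sum0 n : \sum_(k < n) (0 : R) / k.+1%:R <= 0.
  by rewrite big1// => i _; rewrite mul0r.
have [chi [X [C [h1 h2 h3]]]] := @ingham_pair_sqrt R (fun=> 0) 0 0 eps eps0
  (fun _ _ => lexx 0) (fun _ _ _ _ => lexx 0) (fun _ _ => half0)
  sum0.
exists chi, X, C; split=> // s; move: (h3 s).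
by rewrite mul0r oppr0 add0r.
Qed.

Let k_box (a b : V) : (forall i, a 0 i <= b 0 i <= a 0 i + rho) ->
  \int[lam]_y (\1_(cbox a b) y * k y) = 0.
Proof.
move=> ab; pose s i := (b 0 i - a 0 i) / 2; pose x : V := \row_i ((a 0 i + b 0 i) / 2).
have s0 i : 0 <= s i by have /andP[] := ab i; rewrite /s; lra.
have s1 i : s i <= rho / 2 by have /andP[] := ab i; rewrite /s; lra.
have boxE (y : V) : cbox a b y <-> forall i, `|(x - y) 0 i| <= s i.
  by split=> hy i; have := hy i; rewrite !mxE ler_norml /s => /andP[]; lra.
pose eps (n : nat) : R := rho / 6 / n.+1%:R.
have eps0 n : 0 < eps n by rewrite !divr_gt0.
have eps1 n : eps n <= rho / 6 by rewrite ler_pdivrMr// ler_peMr ?ler1n// divr_ge0// ltW.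
have eps_lim e : 0 < e -> exists N, forall n, (N <= n)%N -> eps n < e.
  move=> e0; exists (Num.truncn (rho / 6 / e)) => n Nn.
  rewrite /eps ltr_pdivrMr// [e * _]mulrC -ltr_pdivrMr//; apply: (lt_le_trans (truncnS_gt _)).
  by rewrite ler_nat.
(* The window is then 1 up to [s + eps] and 0 beyond [s + 3 eps], so it converges to the indicator
   at every point, faces included, and [h] is positive even for a flat box. The choice
   [eps <= rho / 6] gives [s + 3 eps <= rho]. *)
pose h n i := s i + 2 * eps n.
have h0 n i : 0 < h n i by have := s0 i; have := eps0 n; rewrite /h; lra.
have /choice[chi hchi] : forall n, exists chi, exists X C,
    [/\ fourier_pair (sincK R / pi) (eps n) chi X, X 0 = 1 &
    forall s, 0 <= X s <= C * ((1 + s ^+ 2)^-1 * expR (- (5 * Num.sqrt `|s|)))].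
  by move=> n; exact: mollifier.
pose K n (y : V) := \prod_i (2 * h n i * avg (h n i) (chi n) ((x - y) 0 i)).
have K01 n y : 0 <= K n y <= 1.
  have [X [C [pX X1 _]]] := hchi n.
  rewrite /K; apply/andP; split; first by apply: prodr_ge0 => i _; have /andP[] := avg_le1 pX X1 (h0 n i) ((x - y) 0 i).
  apply: (@le_trans _ _ (\prod_(i < d) (1 : R))); last by rewrite big1.
  by apply: ler_prod => i _; exact: (avg_le1 pX X1 (h0 n i)).
have KE n y : K n y = (\prod_i (2 * h n i)) * window (chi n) (h n) (x - y).
  by rewrite /K big_split.
have Kout n y i : rho < `|(x - y) 0 i| -> K n y = 0.
  have [X [C [pX X1 _]]] := hchi n => hi.
  rewrite /K (bigD1 i)//= (avg_outside pX) ?mul0r//.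
  by have := s1 i; have := eps1 n; rewrite /h; lra.
have int0 n : \int[lam]_y (K n y * k y) = 0.
  have [X [C [pX X1 XC]]] := hchi n.
  have hr i : eps n + h n i <= rho by have := s1 i; have := eps1 n; rewrite /h; lra.
  have iw : lam.-integrable setT (EFin \o (fun y : V => window (chi n) (h n) (x - y) * k y)).
    have [sh [B hB] _ _ _] := window_test_pair lamP pX (h0 n) hr XC.
    exact: (inLp_pairing_integrable c p1 fp (sh x) (fun y => hB _)).
  rewrite -[RHS](mulr0 (\prod_i (2 * h n i))) -(annih pX XC (h0 n) hr x) -(RintegralZl _ measurableT iw).
  by apply: eq_Rintegral => y _; rewrite KE mulrA.
pose a' : V := \row_i (x 0 i - rho); pose b' : V := \row_i (x 0 i + rho).
have [] := @Rintegral_dominated _ _ R lam (fun n y => K n y * k y)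
    (fun y => \1_(cbox a b) y * k y) (fun y => `|\1_(cbox a' b') y * k y|).
- move=> n; apply: measurable_funM => //.
  have [X [C [pX X1 XC]]] := hchi n.
  have hr i : eps n + h n i <= rho by have := s1 i; have := eps1 n; rewrite /h; lra.
  have [sh _ _ _ _] := window_test_pair lamP pX (h0 n) hr XC.
  rewrite (_ : K n = fun y => (\prod_i (2 * h n i)) * window (chi n) (h n) (x - y)); last exact/funext/KE.
  by apply: measurable_funM => //; exact: integrable_measurable (sh x).
- move=> y; have [yab|nab] := pselect (cbox a b y).
    rewrite indicE mem_set// mul1r; apply: cvg_near_cst; exists 0%N => // n _ /=.
    have [X [C [pX X1 _]]] := hchi n.
    rewrite /K big1 ?mul1r// => i _; apply: (avg_plateau pX X1 (h0 n i)).
    by have := (boxE y).1 yab i; have := eps0 n; rewrite /h; lra.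
  rewrite indicE memNset// mul0r.
  have [i hi] : exists i, s i < `|(x - y) 0 i|.
    apply: contrapT => hx; apply: nab; apply/boxE => i.
    by rewrite leNgt; apply/negP => hi; apply: hx; exists i.
  have e0 : 0 < (`|(x - y) 0 i| - s i) / 3 by rewrite divr_gt0// subr_gt0.
  have [N hN] := eps_lim _ e0.
  apply: cvg_near_cst; exists N => // n /= Nn.
  have [X [C [pX X1 _]]] := hchi n.
  rewrite /K (bigD1 i)//= (avg_outside pX) ?mul0r//.
  by have := hN n Nn; rewrite /h; lra.
- exact: (integrable_abse (ik a' b')).
- move=> n y; have [yab|nab] := pselect (cbox a' b' y).
    rewrite indicE mem_set// mul1r normrM ler_piMl//.
    by have /andP[k0 k1] := K01 n y; rewrite ger0_norm.
  have [i hi] : exists i, rho < `|(x - y) 0 i|.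
    apply: contrapT => hx; apply: nab => i.
    have : `|(x - y) 0 i| <= rho by rewrite leNgt; apply/negP => hi; apply: hx; exists i.
    by rewrite !mxE ler_norml => /andP[]; lra.
  by rewrite (Kout n y i)// mul0r normr0.
move=> _; under eq_cvg do rewrite int0.
by move=> hc; exact: (cvg_unique _ hc (cvg_cst 0)).
Qed.

Lemma ae_cyc_zero : {ae lam, forall y, cyc (f y) c = 0}.
Proof. exact: (ae_zero_of_small_boxes rho0 ik k_box). Qed.

End vanishing.

Section uniqueness.
Context (R : realType) (d : nat).
Let V := 'rV[R]_d.+1.
Variable lam : {measure set (Rd R d.+1) -> \bar R}.
Hypothesis lamP : is_lebesgue lam.
Variable theta : V -> R.
Hypothesis theta0 : forall xi, 0 <= theta xi.
Hypothesis theta_rad : radially_decreasing theta.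
Hypothesis mtheta : measurable_fun [set: Rd R d.+1] theta.
Hypothesis Ioo : Iint lam theta = +oo%E.

Lemma vanishes_of_fourier_decay (p : R) (f g : V -> R * R) : 1 <= p -> inLp lam p f -> is_fourier lam p f g ->
  decay_condition lam theta g ->
  (exists U : set V, open U /\ U !=set0 /\ {ae lam, forall x, U x -> f x = (0, 0)}) ->
  {ae lam, forall x, f x = (0, 0)}.
Proof.
move=> p1 fp fg gd [U [oU [[z Uz] fU]]].
have [[q m] [_ boxU]] := open_ratbox oU Uz.
(* [2 * rho] is the half-side of the rational cube contained in [U]. *)
pose x0 : V := \row_i ratr (q 0 i); pose rho : R := (2 * m.+1%:R)^-1.
have rho0 : 0 < rho by rewrite invr_gt0 mulr_gt0.
have rho2 : 2 * rho = m.+1%:R^-1 by rewrite /rho invfM mulVKf.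
have Ux0 (y : V) : (forall i, `|y 0 i - x0 0 i| <= 2 * rho) -> U y.
  move=> h; apply: boxU => i; have := h i; rewrite rho2 !mxE /= ler_norml => /andP[h1 h2].
  by rewrite lerBlDl addrC -lerBlDr; move: h1 h2 => h1; rewrite -lerBlDl; move: (ratr _) (m.+1%:R^-1) (y 0 i) h1 => A B Y h1 h2; lra.
have cz c := ae_cyc_zero (c := c) lamP p1 fp rho0
  (fun eps chi X h C pX XC h0 hr => window_annihilates lamP theta0 mtheta
    (profileE theta_rad) (profile_ge0 theta0) (profile_dec theta_rad) Ioo p1 fp fg gd rho0 Ux0 fU pX XC h0 hr c).
have aeF : Filter (almost_everywhere lam) := @ae_filter_ringOfSetsType _ (Rd R d.+1) R lam.
(* The phases 0 and [- (pi / 2)] read off the real and imaginary parts of [f]. *)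
apply: (@filterS2 _ _ aeF _ _ _ _ (cz 0) (cz (- (pi / 2)))) => x.
by rewrite cyc0 cycNpihalf; case: (f x) => a b /= -> ->.
Qed.

End uniqueness.

Theorem theorem2p1 (R : realType) (d : nat)
  (lam : {measure set (Rd R d) -> \bar R}) (theta : 'rV[R]_d -> R) :
  (0 < d)%N ->
  is_lebesgue lam ->
  (forall xi, 0 <= theta xi) ->
  radially_decreasing theta ->
  measurable_fun (setT : set (Rd R d)) theta ->
  vanishes_at_infinity theta ->
  (* (a) *)
  (forall (p : R) (f g : 'rV[R]_d -> R * R),
     1 <= p <= 2 -> inLp lam p f -> is_fourier lam p f g ->
     ((exists q N : R, 1 <= q /\ 0 <= N /\ growth_int lam theta q N g) \/
      (exists C : R, 0 < C /\
        exists P1 P2 : mpoly.mpoly d R, poly_bound lam theta C P1 P2 g)) ->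
     (exists U : set 'rV[R]_d, open U /\ U !=set0 /\
        {ae lam, forall x, U x -> f x = (0, 0)}) ->
     Iint lam theta = +oo%E ->
     {ae lam, forall x, f x = (0, 0)}) /\
  (* (b) *)
  ((Iint lam theta < +oo)%E ->
     (forall q N : R, 1 <= q -> 0 <= N ->
        exists f : 'rV[R]_d -> R * R,
          Cc_infty f /\ (exists x, f x != (0, 0)) /\
          growth_int lam theta q N (ftL1 lam f)) /\
     (exists (f : 'rV[R]_d -> R * R) (C : R) (P1 P2 : mpoly.mpoly d R),
          Cc_infty f /\ (exists x, f x != (0, 0)) /\
          poly_bound lam theta C P1 P2 (ftL1 lam f))).
Proof.
case: d lam theta => [//|d] lam theta _ lamP theta0 theta_rad mtheta theta_van; split.
  move=> p f g /andP[p1 _] fp fg gd fU Ioo.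
  exact: (vanishes_of_fourier_decay lamP theta0 theta_rad mtheta Ioo p1 fp fg gd fU).
move=> Ioo; split=> [q N q1 N0|].
  exact: (exists_test_function_growth lamP theta0 theta_rad mtheta theta_van Ioo q1 N0).
exact: (exists_test_function_poly_bound lamP theta0 theta_rad mtheta theta_van Ioo).
Qed.
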